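(* Every $10$-connected (finite, simple) graph $G$ is $C_5$-minor-linked; that is, for every $5$-element set $X\subseteq V(G)$ and every ordering $x_1,x_2,x_3,x_4,x_5$ of the vertices of $X$, there exist pairwise disjoint sets $X_1,\dots,X_5\subseteq V(G)$ such that for each $i\in[5]$, $G[X_i]$ is connected, $x_i\in X_i$, and $G$ has an edge with one end in $X_i$ and the other in $X_{i+1}$, where $X_6=X_1$.
   Context: For a graph $G$ and distinct vertices $x_1,\dots,x_k$ ($k\ge 3$), $(G,x_1\dots x_k)$ has a $C_k$-minor if there are pairwise disjoint vertex sets $X_1,\dots,X_k$ with $G[X_i]$ connected, $x_i\in X_i$, and an edge of $G$ between $X_i$ and $X_{i+1}$ for all $i\in[k]$ (indices mod $k$, $X_{k+1}=X_1$). For $X\subseteq V(G)$, $(G,X)$ is cycle-linked if $|X|\ge 3$ and for every ordering of $X$ the pair has a $C_{|X|}$-minor, or if $|X|\in\{1,2\}$ and $G$ contains a path between the vertices of $X$. A graph $G$ is $C_k$-minor-linked if $(G,X)$ is cycle-linked for every $X\subseteq V(G)$ with $|X|=k$. *)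

(* Defs.v *)
(* A finite simple graph G = (T, e): T a finType (vertex set),
   e : rel T a symmetric irreflexive adjacency relation. *)
From mathcomp Require Import all_boot.
Set Implicit Arguments. Unset Strict Implicit. Unset Printing Implicit Defensive.

Section Graphs.
Variable T : finType.
Variable e : rel T.

Definition induced_rel (A : {set T}) : rel T :=
  [rel x y | [&& x \in A, y \in A & e x y]].

Definition connected_in (A : {set T}) : Prop :=
  A != set0 /\ forall x y, x \in A -> y \in A -> connect (induced_rel A) x y.

Definition k_connected (k : nat) : Prop :=
  k < #|T| /\ forall S : {set T}, #|S| < k -> connected_in (~: S).

(* (G, x_1 ... x_k) has a C_k-minor (indices in 'I_k, successor mod k is ordS) *)
Definition has_cycle_minor (k : nat) (x : 'I_k -> T) : Prop :=
  exists X : 'I_k -> {set T},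
    (forall i j, i != j -> [disjoint X i & X j]) /\
    (forall i, connected_in (X i)) /\
    (forall i, x i \in X i) /\
    (forall i, exists u v, [/\ u \in X i, v \in X (ordS i) & e u v]).

Definition cycle_linked (X : {set T}) : Prop :=
  if 3 <= #|X| then
    forall x : 'I_#|X| -> T, injective x -> (forall v, v \in X -> exists i, x i = v) ->
      has_cycle_minor x
  else if 1 <= #|X| then
    (forall u v, u \in X -> v \in X -> connect e u v)
  else False.

Definition Ck_minor_linked (k : nat) : Prop :=
  forall X : {set T}, #|X| = k -> cycle_linked X.

End Graphs.

(* Main.v *)
Require Import Defs.
From mathcomp Require Import all_boot zify.
From Stdlib Require Import Classical.

(* Thomas and Wollan's minimal counterexample method for linkages.  Let [X] have
   at most five vertices, and let [rho(S)] count the edges touching [S].  If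
   [rho(W \ X) > 5 |W \ X|] and [rho(U) <= 5 |U|] for every [U] cut off from [X] by
   fewer than [|X|] vertices, then all rooted C_5-minors on [X] (and all rooted
   K_n-minors on [n <= 4] vertices of [X]) exist, with one exceptional
   configuration that has too few edges to matter for a 10-connected graph.

   In a minimal counterexample no piece behind fewer than [|X|] vertices can be
   linked to them, since it could be replaced by a clique on its boundary.  Hence
   contracting an edge must destroy the edge bound, so every edge outside [X] has
   at least five common neighbours (pairs in [X] counting as adjacent).  By
   averaging, some vertex [v] outside [X] has so few neighbours that its
   neighbourhood is nearly complete.  Menger's theorem carries the roots to
   neighbours of [v], where the minors are found by counting common neighbours. *)
Set Implicit Arguments. Unset Strict Implicit. Unset Printing Implicit Defensive.

(** * Connected sets and rooted minors *)

(** The constant 5 comes from 10-connectivity: degrees at least 10 put twice the number of edges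
    touching [Y], the complement of [X], at 10 |Y| plus the number of edges between [Y] and [X].
    Cliques are demanded for at most four roots because separators in the induction have at most
    four vertices.

    The exceptional configuration shapes the proof. Two adjacent vertices joined to five roots carry
    11 = 5 * 2 + 1 edges, which meets the bound, but they help only four of the five cycle edges. So
    every appeal to minimality may return it. Its slack of one edge defeats it: a new clique edge
    outside the roots exceeds the slack, two common neighbours lost in a contraction consume it, and
    an exceptional contraction yields three vertices with at least 16 of their 18 possible edges,
    which suffice.

    At the end let [f] be the excess of edges over the bound. A neighbour of [v] misses at most t =
    |N(v)| - 5 - f others, and averaging gives |N(v)| + |N(v) :&: X| <= 9 + f. Hence t + |N(v) :&:
    X| <= 4: the more roots near [v], the fewer missing edges. *)

Section Conn.
Variables (T : finType).
Implicit Types (e : rel T) (A B V W X : {set T}).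

Lemma disjointUs A B V : [disjoint A :|: B & V] = [disjoint A & V] && [disjoint B & V].
Proof. by rewrite -!setI_eq0 setIUl setU_eq0. Qed.

Lemma disjointsP A B : (forall x, x \in A -> x \in B -> False) -> [disjoint A & B].
Proof. by move=> H; apply/pred0P=> x /=; apply/negP=> /andP[]; apply: H. Qed.

Lemma disjointsE A B x : [disjoint A & B] -> x \in A -> x \in B -> False.
Proof. by move=> /pred0P/(_ x) /= H xA xB; rewrite xA xB in H. Qed.

Definition adj e A B := exists u v, [/\ u \in A, v \in B & e u v].

Lemma adj_sym e A B : symmetric e -> adj e A B -> adj e B A.
Proof. by move=> se [u [v [uA vB uv]]]; exists v, u; rewrite se. Qed.

Lemma adjS e A B A' B' : A \subset A' -> B \subset B' -> adj e A B -> adj e A' B'.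
Proof.
by move=> /subsetP sA /subsetP sB [u [v [uA vB uv]]]; exists u, v; split; auto.
Qed.

Lemma connect_preserve (R : rel T) (Q : T -> Prop) x y :
  (forall a b, R a b -> Q a -> Q b) -> connect R x y -> Q x -> Q y.
Proof.
move=> RQ /connectP[p pth ->]; elim: p x pth => //= b p IH x /andP[xb pth] Qx.
by apply: IH pth (RQ _ _ xb Qx).
Qed.

Lemma induced_sym e A : symmetric e -> symmetric (induced_rel e A).
Proof. by move=> se x y; rewrite /induced_rel /= se andbCA. Qed.

Lemma induced_connect_sub e A B x y : A \subset B ->
  connect (induced_rel e A) x y -> connect (induced_rel e B) x y.
Proof.
move=> /subsetP sAB; apply: connect_sub => a b /and3P[aA bA ab].
by apply: connect1; rewrite /induced_rel /= !sAB.
Qed.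

Lemma conn_root e A x : symmetric e -> x \in A ->
  (forall y, y \in A -> connect (induced_rel e A) x y) -> connected_in e A.
Proof.
move=> se xA Ax; split; first by apply/set0Pn; exists x.
move=> y z yA zA; apply: connect_trans (Ax _ zA).
by rewrite (sym_connect_sym (induced_sym A se)) Ax.
Qed.

Lemma conn1 e x : connected_in e [set x].
Proof.
split; first by apply/set0Pn; exists x; rewrite inE.
by move=> y z /set1P-> /set1P->.
Qed.

Lemma connU e A B : symmetric e -> connected_in e A -> connected_in e B ->
  adj e A B -> connected_in e (A :|: B).
Proof.
move=> se [_ cA] [_ cB] [u [v [uA vB uv]]].
apply: (@conn_root _ _ u) => //; first by rewrite inE uA.
move=> y /setUP[yA|yB].
  exact: induced_connect_sub (subsetUl _ _) (cA _ _ uA yA).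
apply: connect_trans (induced_connect_sub (subsetUr _ _) (cB _ _ vB yB)).
by apply: connect1; rewrite /induced_rel /= !inE uA vB uv orbT.
Qed.

Lemma conn_star e x (S : {set T}) : symmetric e -> {in S, forall y, e x y} ->
  connected_in e (x |: S).
Proof.
move=> se xS; apply: (@conn_root _ _ x) => //; first by rewrite !inE eqxx.
move=> y; rewrite !inE => /orP[/eqP->//|yS].
by apply: connect1; rewrite /induced_rel /= !inE eqxx yS orbT xS.
Qed.

(* If the vertices of a connected set are blown up into connected sets that
   respect its edges, the union stays connected. *)
Lemma conn_bigcup e1 e A (g : T -> {set T}) : symmetric e ->
  connected_in e1 A ->
  {in A, forall a, connected_in e (g a)} ->
  {in A &, forall a b, e1 a b -> adj e (g a) (g b)} ->
  connected_in e (\bigcup_(a in A) g a).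
Proof.
move=> se [/set0Pn[a0 a0A] cA] cg ag.
have /set0Pn[s0 s0g] := (cg _ a0A).1.
have sub a : a \in A -> g a \subset \bigcup_(a in A) g a by move=> aA; apply: bigcup_sup.
apply: (@conn_root _ _ s0) => //; first by apply/bigcupP; exists a0.
move=> y /bigcupP[a aA yga].
pose Q b := forall z, b \in A -> z \in g b ->
  connect (induced_rel e (\bigcup_(a in A) g a)) s0 z.
have step b c : induced_rel e1 A b c -> Q b -> Q c.
  move=> /and3P[bA cA' bc] Qb z _ zc; have [u [v [ub vc uv]]] := ag _ _ bA cA' bc.
  apply: connect_trans (Qb u bA ub) _.
  apply: connect_trans (induced_connect_sub (sub _ cA') ((cg _ cA').2 _ _ vc zc)).
  apply: connect1; rewrite /induced_rel /= uv andbT.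
  by rewrite (subsetP (sub _ bA)) // (subsetP (sub _ cA')).
have Q0 : Q a0.
  by move=> z _ z0; apply: induced_connect_sub (sub _ a0A) ((cg _ a0A).2 _ _ s0g z0).
exact: (connect_preserve step (cA _ _ a0A aA) Q0 y aA yga).
Qed.

(** A minor model of the graph [F] on [D] with branch sets inside [V]. Models compose, which is how
    contractions and added cliques are undone. *)
Definition model (I : finType) (D : {set I}) (F : rel I) e V (g : I -> {set T}) :=
  [/\ {in D, forall i, connected_in e (g i) /\ g i \subset V},
      {in D &, forall i j, i != j -> [disjoint g i & g j]} &
      {in D &, forall i j, F i j -> adj e (g i) (g j)}].

Lemma model_comp (I : finType) (D : {set I}) (F : rel I) e1 V1 e V
    (g : I -> {set T}) (h : T -> {set T}) : symmetric e ->
  model D F e1 V1 g -> model V1 e1 e V h ->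
  model D F e V (fun i => \bigcup_(a in g i) h a).
Proof.
move=> se [cg dg ag] [ch dh ah].
have gV i : i \in D -> {subset g i <= V1} by move=> /cg[_ /subsetP].
split=> [i iD|i j iD jD ij|i j iD jD Fij].
- split.
    apply: conn_bigcup se (cg _ iD).1 _ _ => [a ai|a b ai bi ab].
      exact: (ch _ (gV _ iD _ ai)).1.
    by apply: ah; rewrite // (gV _ iD).
  by apply/bigcupsP => a /(gV _ iD)/ch[].
- apply/pred0P => s /=; apply/negP => /andP[/bigcupP[a ai sa] /bigcupP[b bj sb]].
  have ab : a != b.
    apply/eqP => ab; subst b; have /pred0P/(_ a) := dg _ _ iD jD ij.
    by rewrite /= ai bj.
  by have /pred0P/(_ s) := dh _ _ (gV _ iD _ ai) (gV _ jD _ bj) ab; rewrite /= sa sb.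
have [u [v [ui vj uv]]] := ag _ _ iD jD Fij.
apply: adjS (ah _ _ (gV _ iD _ ui) (gV _ jD _ vj) uv); exact: bigcup_sup.
Qed.

(** Complete up to four vertices, so that a linked piece can stand in for a clique on its boundary;
    five roots are only asked for the cycle. *)
Definition pattern n : rel 'I_n :=
  fun i j => if n <= 4 then i != j else j == ordS i.

Definition rminor e V n (r : 'I_n -> T) :=
  exists2 g : 'I_n -> {set T}, model setT (@pattern n) e V g & forall i, r i \in g i.

Definition linked e V X := forall n (r : 'I_n -> T), n <= 5 -> injective r ->
  (forall i, r i \in X) -> rminor e V r.

Lemma rminor_comp e1 V1 e V n (r r' : 'I_n -> T) (h : T -> {set T}) : symmetric e ->
  model V1 e1 e V h -> (forall i, r' i \in h (r i)) ->
  rminor e1 V1 r -> rminor e V r'.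
Proof.
move=> se mh rh [g mg rg]; exists (fun i => \bigcup_(a in g i) h a).
  exact: model_comp mg mh.
by move=> i; apply/bigcupP; exists (r i).
Qed.

Lemma model_mono (I : finType) (D : {set I}) (F : rel I) e V V' (g : I -> {set T}) :
  V \subset V' -> model D F e V g -> model D F e V' g.
Proof.
move=> sV [cg dg ag]; split=> // i iD; have [c s] := cg _ iD; split=> //.
exact: subset_trans sV.
Qed.

Lemma linked_mono e V V' X : V \subset V' -> linked e V X -> linked e V' X.
Proof.
move=> sV L n r n5 ri rX; have [g mg rg] := L n r n5 ri rX.
by exists g => //; apply: model_mono mg.
Qed.

Lemma rminor_restrict e V n m (r : 'I_n -> T) (f : 'I_m -> 'I_n) :
  m <= 4 -> n <= 4 -> injective f -> rminor e V r -> rminor e V (r \o f).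
Proof.
move=> m4 n4 fi [g [cg dg ag] rg]; exists (g \o f); last by move=> i; apply: rg.
split=> [i _|i j _ _ ij|i j _ _]; first exact: cg.
  by apply: dg; rewrite ?inE // inj_eq.
by rewrite /pattern m4 => ij; apply: ag; rewrite ?inE // /pattern n4 inj_eq.
Qed.

End Conn.

(** * Counting edges *)

Section Count.
Variables (T : finType).
Implicit Types (e : rel T) (A B U V W X S K : {set T}).

Definition nb e W a := [set w in W | e a w].
Definition NU e W U := [set w in W :\: U | [exists u, (u \in U) && e u w]].

(* Ordered adjacent pairs of [W] touching [S]: twice the number of edges. *)
Definition Ep e W S := [set p : T * T |
  [&& p.1 \in W, p.2 \in W, e p.1 p.2 & (p.1 \in S) || (p.2 \in S)]].
Definition cnt e W S := #|Ep e W S|.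

Lemma NUP e W U w :
  reflect (exists u, [/\ w \in W, w \notin U, u \in U & e u w]) (w \in NU e W U).
Proof.
rewrite !inE; apply: (iffP idP) => [/andP[/andP[wU wW] /existsP[u /andP[uU uw]]]|].
  by exists u.
by case=> u [-> -> uU uw] /=; apply/existsP; exists u; rewrite uU.
Qed.

Lemma NU_sub e W U : NU e W U \subset W :\: U.
Proof. by apply/subsetP => w /NUP[u [wW wU _ _]]; rewrite inE wU. Qed.

(** A pair touching the union touches [S1], or avoids [S1] altogether and touches [S2]. *)
Lemma cntU e W S1 S2 : [disjoint S1 & S2] ->
  cnt e W (S1 :|: S2) = cnt e W S1 + cnt e (W :\: S1) S2.
Proof.
move=> dS; rewrite /cnt.
have -> : Ep e W (S1 :|: S2) = Ep e W S1 :|: Ep e (W :\: S1) S2.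
  apply/setP=> -[a b]; rewrite !inE /=.
  by case: (a \in W); case: (b \in W); case: (e a b); case: (a \in S1);
    case: (b \in S1); rewrite ?andbF ?orbF ?orbT.
rewrite cardsU (_ : _ :&: _ = set0) ?cards0 ?subn0 //.
apply/setP=> -[a b]; rewrite !inE /=.
by case: (a \in W); case: (b \in W); case: (e a b); case: (a \in S1);
    case: (b \in S1); rewrite ?andbF ?orbF ?orbT.
Qed.

Lemma cntD e W S1 S : S1 \subset S ->
  cnt e W S = cnt e W S1 + cnt e (W :\: S1) (S :\: S1).
Proof.
move=> s1; rewrite -cntU.
  by rewrite -{1}(setID S S1) (setIidPr s1).
by apply/pred0P=> x; rewrite /= !inE; case: (x \in S1).
Qed.

Lemma cnt_local e1 e2 W1 W2 U : symmetric e1 -> symmetric e2 ->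
  (forall a b, a \in U -> [&& a \in W1, b \in W1 & e1 a b] = [&& a \in W2, b \in W2 & e2 a b]) ->
  cnt e1 W1 U = cnt e2 W2 U.
Proof.
move=> s1 s2 H; congr #|pred_of_set _|; apply/setP=> -[a b]; rewrite !inE /=.
case aU: (a \in U); first by have := H a b aU; rewrite /= !andbT.
case bU: (b \in U); last by rewrite !andbF.
have := H b a bU; rewrite s1 s2 /= !andbT.
by rewrite [(b \in W1) && _]andbCA [(b \in W2) && _]andbCA.
Qed.

Lemma cnt0 e W : cnt e W set0 = 0.
Proof. by apply/eqP; rewrite cards_eq0; apply/eqP/setP=> p; rewrite !inE !andbF. Qed.

Lemma cnt_mono e1 e2 W1 W2 U : (forall a b, a \in W1 -> b \in W1 ->
    e1 a b -> (a \in U) || (b \in U) -> [&& a \in W2, b \in W2 & e2 a b]) ->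
  cnt e1 W1 U <= cnt e2 W2 U.
Proof.
move=> H; apply: subset_leq_card; apply/subsetP=> -[a b]; rewrite !inE /=.
by case/and4P=> aW bW ab abU; have /and3P[-> -> ->] := H _ _ aW bW ab abU; rewrite abU.
Qed.

(** The first summand counts the pairs that start in [S]; the second counts, reversed, those that
    only end there. *)
Lemma cnt_sum e W S : symmetric e -> S \subset W ->
  cnt e W S = \sum_(a in S) (#|nb e W a| + #|nb e W a :\: S|).
Proof.
move=> se /subsetP sS; rewrite big_split /= /cnt.
have cardE (P : pred T) (Q : T -> {set T}) :
  #|[set p : T * T | P p.1 && (p.2 \in Q p.1)]| = \sum_(a | P a) #|Q a|.
  rewrite -sum1dep_card (eq_bigl (fun p => P p.1 && (p.2 \in Q p.1))) //.
  rewrite -(pair_big_dep _ (fun a b => b \in Q a) (fun _ _ => 1)) /=.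
  by apply: eq_bigr => a _; rewrite sum1_card.
rewrite -(cardE (mem S) (nb e W)) -(cardE (mem S) (fun a => nb e W a :\: S)).
have inj : injective (fun p : T * T => (p.2, p.1)) by move=> [a b] [c d] [-> ->].
rewrite -(card_imset [set p : T * T | (p.1 \in S) && (p.2 \in nb e W p.1 :\: S)] inj).
have -> : Ep e W S = [set p : T * T | (p.1 \in S) && (p.2 \in nb e W p.1)] :|:
  [set (p.2, p.1) | p in [set p : T * T | (p.1 \in S) && (p.2 \in nb e W p.1 :\: S)]].
  apply/setP=> -[a b]; rewrite inE [RHS]inE inE /= inE.
  apply/idP/orP => [/and4P[aW bW ab]|].
    case aS: (a \in S); first by left; rewrite bW ab.
    move=> /= bS; right; apply/imsetP; exists (b, a) => //.
    by rewrite !inE /= bS aS aW se.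
  case=> [/and3P[aS -> ->]|/imsetP[[c d]]]; first by rewrite sS // aS.
  by rewrite !inE /= => /and4P[cS dS dW cd] [-> ->]; rewrite dW sS // se cd cS orbT.
rewrite cardsU (_ : _ :&: _ = set0) ?cards0 ?subn0 //.
apply/setP=> -[a b]; rewrite !inE /=; apply/negP=> /andP[/and3P[aS bW ab]].
by case/imsetP=> [[c d]]; rewrite !inE /= => /and4P[cS dS dW cd] [E _]; rewrite -E aS in dS.
Qed.

(** For [K] inside [U], disjointness of [NU e W K] from [U] says that [K] is a union of components
    of [U]. Components of the remainder are again components of [U]. *)
Lemma closed_diff e W U K K' : symmetric e -> U \subset W -> K \subset U ->
  [disjoint NU e W K & U] -> K' \subset U :\: K -> [disjoint NU e W K' & U :\: K] ->
  [disjoint NU e W K' & U].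
Proof.
move=> se /subsetP UW /subsetP KU dK /subsetP K'U dK'; apply/disjointsP=> w wN wU.
case wK: (w \in K); last by apply: (disjointsE dK' wN); rewrite in_setD wK.
have [u [_ _ uK' uw]] := NUP _ _ _ _ wN.
have := K'U _ uK'; rewrite in_setD => /andP[uK uU].
by apply: (disjointsE dK _ uU); apply/NUP; exists w; rewrite UW // se.
Qed.

Lemma cnt_closed_diff e W U K : symmetric e -> U \subset W -> K \subset U ->
  [disjoint NU e W K & U] -> cnt e W U = cnt e W K + cnt e W (U :\: K).
Proof.
move=> se UW KU dK; rewrite (cntD _ _ KU); congr addn.
apply: cnt_local => // b c; rewrite in_setD => /andP[bK bU].
rewrite !in_setD bK /=; case cK: (c \in K) => //=; rewrite andbF; apply/esym/negP.
move=> /and3P[bW _ bc]; apply: (disjointsE dK _ bU); apply/NUP; exists c.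
by rewrite se.
Qed.

(** No edge joins two components of [U], so the counts add up and components can be peeled off one
    at a time. *)
Lemma cnt_comps e W U : symmetric e -> U \subset W ->
  (forall K, K \subset U -> connected_in e K -> [disjoint NU e W K & U] ->
     cnt e W K <= 10 * #|K|) -> cnt e W U <= 10 * #|U|.
Proof.
move=> se; elim: {U}_.+1 {-2}U (ltnSn #|U|) => // n IH U Un sU HK.
case: (set_0Vmem U) => [U0|[a aU]]; first by rewrite U0 cnt0.
pose K := [set w in U | connect (induced_rel e U) a w].
have aK : a \in K by rewrite inE aU connect0.
have sKU : K \subset U by apply/subsetP=> w; rewrite inE => /andP[].
have clK u w : u \in K -> w \in U -> e u w -> w \in K.
  rewrite !inE => /andP[uU au] wU uw; rewrite wU; apply: connect_trans au _.
  by apply: connect1; rewrite /induced_rel /= uU wU.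
have cK : connected_in e K.
  apply: (conn_root se aK) => y yK; have yU := subsetP sKU _ yK.
  move: (yK); rewrite inE yU /= => ay.
  have step b c : induced_rel e U b c -> connect (induced_rel e K) a b /\ b \in K ->
     connect (induced_rel e K) a c /\ c \in K.
    move=> /and3P[bU cU bc] [ab bK]; have cK := clK _ _ bK cU bc; split=> //.
    by apply: connect_trans ab _; apply: connect1; rewrite /induced_rel /= bK cK.
  by have [] := connect_preserve step ay (conj (connect0 _ _) aK).
have dK : [disjoint NU e W K & U].
  apply/disjointsP=> w /NUP[u [wW wK uK uw]] wU.
  by rewrite (clK u w) in wK.
rewrite (cnt_closed_diff se sU sKU dK).
have cU : #|U| = #|K| + #|U :\: K| by rewrite cardsDS // subnKC // subset_leq_card.
have K0 : 0 < #|K| by rewrite card_gt0; apply/set0Pn; exists a.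
have ltn : #|U :\: K| < n by move: Un K0; rewrite cU; clear; lia.
have := HK _ sKU cK dK; rewrite cU.
suff : cnt e W (U :\: K) <= 10 * #|U :\: K| by clear; lia.
apply: IH => // [|K' sK' cK' dK']; first by apply: subset_trans sU; apply: subsetDl.
apply: HK => //; first by apply: subset_trans sK' (subsetDl _ _).
exact: closed_diff dK sK' dK'.
Qed.

End Count.

(** * Menger's theorem and routing of roots *)

Section Linking.
Variables (T : finType) (e : rel T).
Hypothesis se : symmetric e.
Implicit Types (A B U V W X S K : {set T}).

(** A path in [W] from [A] to [B] must use one of these vertices. Stating Menger's condition through
    sides [A] rather than cuts makes submodularity available. *)
Definition bd W B A := [set a in A | (a \in B) || [exists w, (w \in W :\: A) && e a w]].

Lemma bdP W B A a :
  reflect (a \in A /\ (a \in B \/ exists w, [/\ w \in W, w \notin A & e a w])) (a \in bd W B A).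
Proof.
rewrite inE; apply: (iffP andP) => [[-> /orP[|/existsP[w]]]|[-> [->//|[w [wW wA aw]]]]].
- by split=> //; left.
- by rewrite inE => /andP[/andP[wA wW] aw]; split=> //; right; exists w.
split=> //; apply/orP; right; apply/existsP; exists w; by rewrite inE wA wW.
Qed.

Lemma bd_submod W B A1 A2 :
  #|bd W B (A1 :|: A2)| + #|bd W B (A1 :&: A2)| <= #|bd W B A1| + #|bd W B A2|.
Proof.
rewrite -(cardsUI (bd W B A1)) -(cardsUI (bd W B (A1 :|: A2))).
apply: leq_add; apply: subset_leq_card; apply/subsetP => a.
  case/setUP=> /bdP[aA H]; rewrite inE; apply/orP.
    case/setUP: aA => aA; [left|right]; apply/bdP; split=> //;
      case: H => [->|[w [wW wA aw]]]; try (by left); right; exists w; split=> //;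
      by apply: contra wA; rewrite inE => ->; rewrite ?orbT.
  have /setIP[a1 a2] := aA.
  case: H => [aB|[w [wW wA aw]]]; first by left; apply/bdP; split=> //; left.
  move: wA; rewrite inE negb_and => /orP[wA|wA]; [left|right]; apply/bdP; split=> //;
    by right; exists w.
case/setIP=> /bdP[_ H] /bdP[/setIP[a1 a2] _].
rewrite inE; apply/andP; split; apply/bdP; split=> //;
  case: H => [->|[w [wW wA aw]]]; try (by left); right; exists w; split=> //;
  by apply: contra wA; rewrite inE => ->; rewrite ?orbT.
Qed.

(* A root outside the target moves along an edge. If no move
   preserves the separation hypothesis, then by submodularity one small
   separator serves for all neighbours of the root at once. *)
Lemma linking n W B (r : 'I_n -> T) : injective r -> (forall i, r i \in W) ->
  (forall A, (forall i, r i \in A) -> A \subset W -> n <= #|bd W B A|) ->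
  exists (s : 'I_n -> T) (g : 'I_n -> {set T}),
    [/\ forall i, connected_in e (g i) /\ g i \subset W,
        forall i j, i != j -> [disjoint g i & g j],
        forall i, r i \in g i & forall i, s i \in B /\ g i :&: B = [set s i]].
Proof.
elim: {W}_.+1 {-2}W (ltnSn #|W|) r => // N IH W WN r ri rW sep.
case: (boolP [forall i, r i \in B]) => [/forallP rB|].
  exists r, (fun i => [set r i]); split=> [i|i j ij|i|i].
  - by split; [apply: conn1|rewrite sub1set].
  - by rewrite disjoints1 inE inj_eq.
  - by rewrite inE.
  by split=> //; apply/setIidPl; rewrite sub1set.
rewrite negb_forall => /existsP[i0 xB]; set x := r i0 in xB.
pose W1 := W :\ x.
have W1N : #|W1| < N by move: WN; rewrite (cardsD1 x W) rW.
have sW1 : W1 \subset W by apply: subsetDl.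
pose X1 := [set r i | i in [set~ i0]].
pose small A := [&& X1 \subset A, A \subset W1 & #|bd W1 B A| < n].
have n0 : 0 < n by case: (n) (i0) => // -[].
have cX1 : #|X1| = n.-1 by rewrite card_imset // cardsC1 card_ord.
have rX1 i : i != i0 -> r i \in X1 by move=> ii; apply/imsetP; exists i; rewrite // !inE.
have X1W1 : X1 \subset W1.
  by apply/subsetP=> y /imsetP[i]; rewrite !inE => ii ->; rewrite rW inj_eq // ii.
have smallX1 : small X1.
  rewrite /small subxx X1W1 /=; apply: (@leq_ltn_trans #|X1|); last by rewrite cX1; lia.
  by apply: subset_leq_card; apply/subsetP=> y /bdP[].
(* [X1] itself has too few vertices for a large boundary, so a largest small side exists. *)
have [A smA maxA] := @arg_maxnP _ X1 small (fun A => #|A|) smallX1.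
have /and3P[X1A AW1 bA] := smA.
(* Putting [x] back enlarges a boundary by at most one vertex, so every side keeps at least n -
   1. *)
have low A' : X1 \subset A' -> A' \subset W1 -> n <= #|bd W1 B A'|.+1.
  move=> XA AW; apply: leq_trans (sep (x |: A') _ _) _.
  - move=> i; rewrite !inE; case: (eqVneq i i0) => [->|ii]; first by rewrite eqxx.
    by rewrite (subsetP XA) ?orbT // rX1.
  - by rewrite subUset sub1set rW (subset_trans AW).
  apply: (@leq_trans #|x |: bd W1 B A'|); last by rewrite cardsU1; case: (x \notin _).
  apply: subset_leq_card; apply/subsetP=> y /bdP[]; rewrite !inE.
  case: eqP => //= yx yA [yB|[w [wW]]]; first by rewrite yA yB.
  rewrite !inE negb_or => /andP[wx wA] yw; rewrite yA; apply/orP; right.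
  by apply/existsP; exists w; rewrite !inE wA wx wW yw.
case: (boolP [exists y, [&& y \in nb e W1 x, y \notin X1 & [forall A' : {set T},
    [&& y \in A', X1 \subset A' & A' \subset W1] ==> (n <= #|bd W1 B A'|)]]]).
  case/existsP=> y /and3P[]; rewrite inE => /andP[yW xy] yX1 /forallP good.
  pose r' i := if i == i0 then y else r i.
  have ri' : injective r'.
    move=> i j; rewrite /r'; case: eqP => [->|/eqP ii]; case: eqP => [->|/eqP jj] //.
    - by move=> E; rewrite E rX1 in yX1.
    - by move=> E; rewrite -E rX1 in yX1.
    exact: ri.
  have rW' i : r' i \in W1.
    by rewrite /r'; case: eqP => // /eqP ii; apply: (subsetP X1W1); apply: rX1.
  have [|s [g [cg dg rg sg]]] := IH W1 W1N r' ri' rW'.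
    move=> A' r'A A'W; apply: (implyP (good A')); rewrite A'W andbT; apply/andP; split.
      by have := r'A i0; rewrite /r' eqxx.
    apply/subsetP=> z /imsetP[i]; rewrite !inE => /negPf ii ->.
    by have := r'A i; rewrite /r' ii.
  have xg i : x \notin g i.
    by apply/negP=> xgi; have := subsetP (cg i).2 _ xgi; rewrite !inE eqxx.
  exists s, (fun i => if i == i0 then x |: g i else g i); split=> [i|i j ij|i|i].
  - case: eqP => [->|_]; last by have [c sub] := cg i; rewrite (subset_trans sub).
    have [c sub] := cg i0; split; last by rewrite subUset sub1set rW (subset_trans sub).
    apply: connU => //; first exact: conn1.
    by exists x, y; rewrite inE; split=> //; have := rg i0; rewrite /r' eqxx.
  - have D := dg _ _ ij; case: eqP => [E|_]; case: eqP => [E'|_] //.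
    + by rewrite E E' eqxx in ij.
    + by rewrite disjointUs disjoints1 xg.
    by rewrite disjoint_sym disjointUs disjoints1 xg disjoint_sym.
  - by have := rg i; rewrite /r'; case: eqP => [->|//]; rewrite !inE eqxx.
  have [sB gB] := sg i; split=> //; case: eqP => // _.
  rewrite setIUl gB (_ : [set x] :&: B = set0) ?set0U //.
  by apply/setP=> z; rewrite !inE; case: eqP => // ->; apply: negPf.
rewrite negb_exists => /forallP noy.
have nbA y : y \in nb e W1 x -> y \in A.
  move=> yN; have := noy y; rewrite yN /= negb_and negbK => /orP[|].
    by apply: (subsetP X1A).
  rewrite negb_forall => /existsP[A']; rewrite negb_imply -ltnNge.
  case/andP=> /and3P[yA' XA' AW'] bA'.
  (* The intersection has at least n - 1 boundary vertices and each of the two sides at most n - 1,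
     so submodularity leaves at most n - 1 for the union; maximality of [A] then absorbs [A']. *)
  have smU : small (A :|: A').
    rewrite /small subUset AW1 AW' (subset_trans X1A (subsetUl _ _)) /=.
    have := bd_submod W1 B A A'.
    have := low (A :&: A'); rewrite subsetI X1A XA' subIset ?AW1 // => /(_ isT isT).
    by move: bA bA'; clear; lia.
  have /eqP E : A == A :|: A'.
    by rewrite eqEcard subsetUl /=; apply: maxA.
  by rewrite E inE yA' orbT.
suff: n <= #|bd W1 B A| by rewrite leqNgt bA.
apply: leq_trans (sep (x |: A) _ _) _.
- move=> i; rewrite !inE; case: (eqVneq i i0) => [->|ii]; first by rewrite eqxx.
  by rewrite (subsetP X1A) ?orbT // rX1.
- by rewrite subUset sub1set rW (subset_trans AW1).
apply: subset_leq_card; apply/subsetP=> z /bdP[]; rewrite !inE.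
case: eqP => [->|zx] /= zA.
  case=> [xB'|[w [wW]]]; first by rewrite xB' in xB.
  rewrite !inE negb_or => /andP[wx wA] xw.
  by rewrite nbA // !inE wx wW in wA.
move=> H; rewrite zA /=; case: H => [->//|[w [wW]]].
rewrite !inE negb_or => /andP[wx wA] zw; apply/orP; right.
by apply/existsP; exists w; rewrite !inE wx wA wW.
Qed.
End Linking.

Section Link.
Variables (T : finType).
Implicit Types (e : rel T) (A B U V W X Z S K : {set T}).

Lemma inj_card n (r : 'I_n -> T) X : injective r -> (forall i, r i \in X) -> n <= #|X|.
Proof.
move=> ri rX; rewrite -[n in n <= _]card_ord -cardsT -(card_imset _ ri).
by apply: subset_leq_card; apply/subsetP=> x /imsetP[i _ ->].
Qed.

Lemma inj_onto n (r : 'I_n -> T) X x : injective r -> (forall i, r i \in X) ->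
  #|X| <= n -> x \in X -> exists i, r i = x.
Proof.
move=> ri rX Xn xX; suff E : [set r i | i in setT] = X.
  by move: xX; rewrite -E => /imsetP[i _ ->]; exists i.
apply/eqP; rewrite eqEcard card_imset // cardsT card_ord Xn andbT.
by apply/subsetP=> y /imsetP[i _ ->].
Qed.

(* [s x] is the unique vertex of [B] on the connected set [g x] starting at [x]. *)
Definition linkage e W B X (s : T -> T) (g : T -> {set T}) :=
  [/\ {in X, forall x, connected_in e (g x) /\ g x \subset W},
      {in X &, forall x y, x != y -> [disjoint g x & g y]},
      {in X, forall x, x \in g x} &
      {in X, forall x, s x \in B /\ g x :&: B = [set s x]}].

Lemma linkage_inj e W B X s g : linkage e W B X s g -> {in X &, injective s}.
Proof.
case=> _ dg _ sg x y xX yX E; apply/eqP/negPn/negP=> xy.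
have [_ gx] := sg _ xX; have [_ gy] := sg _ yX.
apply: (disjointsE (x := s x) (dg _ _ xX yX xy)).
  by have: s x \in g x :&: B by [rewrite gx inE]; case/setIP.
by have: s x \in g y :&: B by [rewrite gy E inE]; case/setIP.
Qed.

Lemma linking_set e W B X : symmetric e -> X \subset W ->
  (forall A, X \subset A -> A \subset W -> #|X| <= #|bd e W B A|) ->
  exists s g, linkage e W B X s g.
Proof.
move=> se XW sep.
have [||s [g [cg dg rg sg]]] := @linking T e se #|X| W B (@enum_val _ (mem X)) enum_val_inj.
- by move=> i; apply: (subsetP XW); apply: enum_valP.
- move=> A rA AW; apply: sep => //; apply/subsetP=> x xX.
  by rewrite -(enum_rankK_in xX xX); apply: rA.
pose idx x := [pick i | @enum_val _ (mem X) i == x].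
have idxP x : x \in X -> exists2 i, idx x = Some i & enum_val i = x.
  move=> xX; rewrite /idx; case: pickP => [i /eqP E|/(_ (enum_rank_in xX x))].
    by exists i.
  by rewrite enum_rankK_in // eqxx.
exists (fun x => if idx x is Some i then s i else x).
exists (fun x => if idx x is Some i then g i else set0).
split=> [x|x y|x|x] /idxP[i -> Ei].
- exact: cg.
- case/idxP=> j -> Ej ij; apply: dg; apply: contra ij => /eqP E.
  by rewrite -Ei -Ej E.
- by rewrite -{1}Ei.
exact: sg.
Qed.

(** Vertices [s x] of the minor are blown up to the connected sets [g x]. These miss [U] and meet
    [B] only in [s x], so branch sets stay disjoint. *)
Lemma route e W B X s g U V n (r : 'I_n -> T) : symmetric e ->
  linkage e W B X s g -> [disjoint U & W] -> U :|: B \subset V -> W \subset V ->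
  injective r -> (forall i, r i \in X) -> rminor e (U :|: B) (s \o r) -> rminor e V r.
Proof.
move=> se L dUW UBV WV ri rX; have si := linkage_inj L; have [cg dg xg sg] := L.
pose h a := if [pick x in X | s x == a] is Some x then g x else [set a].
have hs x : x \in X -> h (s x) = g x.
  move=> xX; rewrite /h; case: pickP => [y /andP[yX /eqP E]|/(_ x)].
    by rewrite (si _ _ yX xX E).
  by rewrite xX eqxx.
have hP a : (exists2 x, x \in X & s x = a /\ h a = g x) \/ h a = [set a].
  rewrite /h; case: pickP => [y /andP[yX /eqP E]|_]; last by right.
  by left; exists y.
have ha a : a \in U :|: B -> a \in h a.
  move=> aUB; case: (hP a) => [[x xX [<- ->]]|->]; last by rewrite inE.
  have [_ gx] := sg _ xX.
  by have: s x \in g x :&: B by [rewrite gx inE]; case/setIP.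
have hUB a b : b \in U :|: B -> b \in h a -> b = a.
  move=> bUB; case: (hP a) => [[x xX [<- ->]] bg|->]; last by move/set1P.
  have [_ gx] := sg _ xX; have [_ /subsetP gW] := cg _ xX.
  case/setUP: bUB => [bU|bB]; first by have := disjointsE dUW bU (gW _ bg).
  by apply/set1P; rewrite -gx inE bg.
move=> rm; apply: (@rminor_comp _ e (U :|: B) e V n (s \o r) r h se _ _ rm); last first.
  by move=> i; rewrite /= hs //; apply: xg.
split=> [a aUB|a b aUB bUB ab|a b aUB bUB ab].
- case: (hP a) => [[x xX [_ ->]]|->].
    by have [c sub] := cg _ xX; split; last exact: subset_trans sub WV.
  by split; [apply: conn1|rewrite sub1set (subsetP UBV)].
- case: (hP a) => [[x xX [sa Ea]]|Ea]; case: (hP b) => [[y yX [sb Eb]]|Eb].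
  + rewrite Ea Eb; apply: dg => //; apply: contra ab => /eqP E.
    by rewrite -sa -sb E.
  + rewrite Eb disjoint_sym disjoints1; apply: contra ab => bh.
    by rewrite (hUB a b).
  + rewrite Ea disjoints1; apply: contra ab => bh.
    by rewrite (hUB b a).
  by rewrite Ea Eb disjoints1 inE.
by exists a, b; split=> //; apply: ha.
Qed.

(** [Z] separates the piece [W :\: A] from the roots and is smaller than [X]; being linked to [Z],
    the piece can simulate a clique on [Z]. *)
Definition rigid e W X A Z := [/\ X \subset A, A \proper W,
  NU e W (W :\: A) \subset Z, Z \subset A & #|Z| < #|X| /\ linked e ((W :\: A) :|: Z) Z].

(* If the roots cannot be routed to the boundary of [U], then the linked subsets
   of that boundary make a smallest separator linked on its far side. *)
Lemma link_core e W X U : symmetric e -> X \subset W -> #|X| <= 5 ->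
  U \subset W :\: X -> U != set0 -> (forall A Z, ~ rigid e W X A Z) ->
  (forall n (r : 'I_n -> T), n <= 5 -> injective r -> (forall i, r i \in NU e W U) ->
     (n = 5 -> forall x, x \in X -> x \in NU e W U -> exists i, r i = x) ->
     rminor e (U :|: NU e W U) r) ->
  linked e W X.
Proof.
move=> se XW X5 UWX U0 norigid H; set B := NU e W U.
pose W' := W :\: U.
have UW : U \subset W by apply: subset_trans UWX (subsetDl _ _).
have XW' : X \subset W'.
  by apply/subsetP=> x xX; rewrite inE (subsetP XW) // andbT; apply/negP=> /(subsetP UWX); rewrite inE xX.
have BW' : B \subset W' := NU_sub e W U.
have dUW' : [disjoint U & W'] by apply/disjointsP=> x xU; rewrite inE xU.
have W'W : W' \subset W by apply: subsetDl.
have UBW : U :|: B \subset W by rewrite subUset UW (subset_trans BW').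
have [sep|] := boolP [forall A : {set T}, (X \subset A) && (A \subset W') ==> (#|X| <= #|bd e W' B A|)].
  have [|s [g L]] := @linking_set e W' B X se XW'.
    by move=> A XA AW; have /forallP/(_ A) := sep; rewrite XA AW.
  have [cg dg xg sg] := L.
  move=> n r n5 ri rX; apply: (route se L dUW' UBW W'W ri rX).
  apply: H => // [i j /= E|i|n5' x xX xB].
  - by apply: ri; apply: (linkage_inj L).
  - by have [] := sg _ (rX i).
  have [|i Ei] := inj_onto ri rX _ xX; first by rewrite n5'.
  exists i; rewrite /= Ei.
  (* A root already in [B] is the only vertex of [B] on its own connected set, hence its own
     endpoint. This gives the extra hypothesis for n = 5. *)
  have [_ gx] := sg _ xX; apply/esym/set1P; rewrite -gx inE xB andbT.
  exact: xg.
rewrite negb_forall => /existsP[A0]; rewrite negb_imply -ltnNge => H0.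
pose P0 (A : {set T}) := (X \subset A) && (A \subset W') && (#|bd e W' B A| < #|X|).
have [A /andP[/andP[XA AW'] ltA] minA] := @arg_minnP _ A0 P0 (fun A => #|bd e W' B A|) H0.
set Z := bd e W' B A in ltA minA.
have ZA : Z \subset A by apply/subsetP=> a /bdP[].
have AW : A \subset W := subset_trans AW' W'W.
have NZ : NU e W (W :\: A) \subset Z.
  apply/subsetP=> w /NUP[u [wW wA uA uw]]; move: wA uA; rewrite !in_setD wW andbT negbK => wA /andP[uA uW].
  apply/bdP; split=> //; case uU: (u \in U); last first.
    by right; exists u; rewrite in_setD uU uA uW se.
  left; apply/NUP; exists u; split=> //.
  by have := subsetP AW' _ wA; rewrite inE => /andP[].
have UA : U \subset W :\: A.
  apply/subsetP=> u uU; rewrite inE (subsetP UW) // andbT; apply/negP => /(subsetP AW').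
  by rewrite inE uU.
case: (norigid A Z); split=> //.
  rewrite properEneq AW andbT; apply: contraNneq U0 => E.
  by rewrite -subset0 -(setDv W) -{2}E.
split=> //.
pose W2 := Z :|: (W' :\: A).
have ZW2 : Z \subset W2 by apply: subsetUl.
have W2W' : W2 \subset W' by rewrite subUset (subset_trans ZA AW') subsetDl.
have [|s [g L]] := @linking_set e W2 B Z se ZW2.
  move=> A2 ZA2 A2W.
  (* A side of [W2] with a smaller boundary, united with [A], would contradict the minimality of
     [Z]. *)
  have sbd : bd e W' B (A :|: A2) \subset bd e W2 B A2.
    apply/subsetP=> a /bdP[aA H2].
    have aA2 : a \in A2.
      case/setUP: aA => // aA; apply: (subsetP ZA2); apply/bdP; split=> //.
      case: H2 => [->|[w [wW wA aw]]]; first by left.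
      by right; exists w; split=> //; apply: contra wA; rewrite inE => ->.
    apply/bdP; split=> //; case: H2 => [->|[w [wW]]]; first by left.
    rewrite inE negb_or => /andP[wA wA2] aw; right; exists w; split=> //.
    by rewrite !in_setU in_setD wA wW orbT.
  apply: leq_trans (subset_leq_card sbd).
  case: (ltnP #|bd e W' B (A :|: A2)| #|X|) => [lt|]; last by apply: leq_trans; apply: ltnW.
  apply: minA; rewrite /P0 lt (subset_trans XA (subsetUl _ _)) subUset AW'.
  by rewrite (subset_trans A2W W2W').
move=> n r n5 ri rZ.
have n4 : n <= 4 by have := inj_card ri rZ; move: ltA X5; clear; lia.
have si : injective (s \o r).
  by move=> i j /= E; apply: ri; apply: (linkage_inj L).
have dUW2 : [disjoint U & W2].
  by apply: disjointWr W2W' dUW'.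
apply: (route se L dUW2 _ _ ri rZ).
- rewrite subUset; apply/andP; split; first by apply: subset_trans UA (subsetUl _ _).
  apply/subsetP=> b bB; rewrite !in_setU in_setD; case bA: (b \in A).
    by apply/orP; right; apply/bdP; split=> //; left.
  by rewrite (subsetP W'W) // (subsetP BW').
- by rewrite subUset subsetUr (subset_trans _ (subsetUl _ _)) ?setSD.
apply: H => // [i|E]; last by rewrite E in n4.
by case: L => _ _ _ sg; have [] := sg _ (rZ i).
Qed.
End Link.

(** * Minors in small dense graphs *)

Section Small.
Variables (T : finType) (e : rel T).
Hypothesis se : symmetric e.
Implicit Types (A B U V W X Y Z S K H R : {set T}).

Definition clique4 V p0 p1 p2 p3 := exists A0 A1 A2 A3 : {set T},
  [/\ [/\ connected_in e A0, connected_in e A1, connected_in e A2 & connected_in e A3],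
      [/\ A0 \subset V, A1 \subset V, A2 \subset V & A3 \subset V],
      [/\ p0 \in A0, p1 \in A1, p2 \in A2 & p3 \in A3],
      pairwise (fun A B => [disjoint A & B]) [:: A0; A1; A2; A3] &
      [/\ adj e A0 A1, adj e A0 A2 & adj e A0 A3] /\
      [/\ adj e A1 A2, adj e A1 A3 & adj e A2 A3]].

Definition cycle5 V p0 p1 p2 p3 p4 := exists A0 A1 A2 A3 A4 : {set T},
  [/\ [/\ connected_in e A0, connected_in e A1, connected_in e A2, connected_in e A3 &
          connected_in e A4],
      [/\ A0 \subset V, A1 \subset V, A2 \subset V, A3 \subset V & A4 \subset V],
      [/\ p0 \in A0, p1 \in A1, p2 \in A2, p3 \in A3 & p4 \in A4],
      pairwise (fun A B => [disjoint A & B]) [:: A0; A1; A2; A3; A4] &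
      [/\ adj e A0 A1, adj e A1 A2, adj e A2 A3, adj e A3 A4 & adj e A4 A0]].

Lemma cycle5_rot V p0 p1 p2 p3 p4 : cycle5 V p0 p1 p2 p3 p4 -> cycle5 V p1 p2 p3 p4 p0.
Proof.
case=> A0 [A1 [A2 [A3 [A4 [[c0 c1 c2 c3 c4] [s0 s1 s2 s3 s4] [r0 r1 r2 r3 r4] d [a0 a1 a2 a3 a4]]]]]].
exists A1, A2, A3, A4, A0; split=> //; move: d => /=.
rewrite !andbT => /and4P[/and4P[d1 d2 d3 d4] /and3P[-> -> ->] /andP[-> ->] ->].
by rewrite ![[disjoint _ & A0]]disjoint_sym d1 d2 d3 d4.
Qed.

Lemma clique4_rot V p0 p1 p2 p3 : clique4 V p0 p1 p2 p3 -> clique4 V p1 p2 p3 p0.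
Proof.
case=> A0 [A1 [A2 [A3 [[c0 c1 c2 c3] [s0 s1 s2 s3] [r0 r1 r2 r3] d [[a0 a1 a2] [a3 a4 a5]]]]]].
exists A1, A2, A3, A0; split=> //; last by do !split=> //; apply: adj_sym.
move: d; rewrite /= !andbT => /and3P[/and3P[d1 d2 d3] /andP[-> ->] ->].
by rewrite ![[disjoint _ & A0]]disjoint_sym d1 d2 d3.
Qed.

Lemma clique4_swap V p0 p1 p2 p3 : clique4 V p0 p1 p2 p3 -> clique4 V p1 p0 p2 p3.
Proof.
case=> A0 [A1 [A2 [A3 [[c0 c1 c2 c3] [s0 s1 s2 s3] [r0 r1 r2 r3] d [[a0 a1 a2] [a3 a4 a5]]]]]].
exists A1, A0, A2, A3; split=> //; last by do !split=> //; apply: adj_sym.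
move: d; rewrite /= !andbT => /and3P[/and3P[d1 d2 d3] /andP[d4 d5] ->].
by rewrite [[disjoint A1 & A0]]disjoint_sym d1 d2 d3 d4 d5.
Qed.

Definition o4 k : 'I_4 := inord k.
Definition o5 k : 'I_5 := inord k.

Lemma uniq_o5 (r : 'I_5 -> T) : injective r ->
  uniq [:: r (o5 0); r (o5 1); r (o5 2); r (o5 3); r (o5 4)].
Proof.
move=> ri; rewrite -[[:: _; _; _; _; _]]/(map (r \o o5) (iota 0 5)) map_inj_in_uniq ?iota_uniq //.
by move=> i j; rewrite !mem_iota /= => i5 j5 /ri /(congr1 val); rewrite /= !inordK.
Qed.

Lemma cycle5_rminor V (r : 'I_5 -> T) :
  cycle5 V (r (o5 0)) (r (o5 1)) (r (o5 2)) (r (o5 3)) (r (o5 4)) -> rminor e V r.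
Proof.
case=> A0 [A1 [A2 [A3 [A4 [[c0 c1 c2 c3 c4] [s0 s1 s2 s3 s4] [r0 r1 r2 r3 r4] d [a0 a1 a2 a3 a4]]]]]].
have ro k (lt : k < 5) : Ordinal lt = o5 k by apply: val_inj; rewrite /= inordK.
exists (fun i => nth set0 [:: A0; A1; A2; A3; A4] i); last first.
  by case=> [[|[|[|[|[|//]]]]] lt]; rewrite ro inordK.
split.
- by case=> [[|[|[|[|[|//]]]]] lt] _ /=.
- have /(pairwiseP set0) D := d.
  move=> i j _ _ ij; have /orP[ltij|ltij] : (i < j) || (j < i) by rewrite -neq_ltn.
    by apply: D; rewrite ?inE /= ?ltn_ord.
  by rewrite disjoint_sym; apply: D; rewrite ?inE /= ?ltn_ord.
move=> i j _ _; rewrite /pattern /= => /eqP->.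
by case: i => [[|[|[|[|[|//]]]]] lt] /=.
Qed.

Lemma clique4_rminor V (r : 'I_4 -> T) :
  clique4 V (r (o4 0)) (r (o4 1)) (r (o4 2)) (r (o4 3)) -> rminor e V r.
Proof.
case=> A0 [A1 [A2 [A3 [[c0 c1 c2 c3] [s0 s1 s2 s3] [r0 r1 r2 r3] d [[a0 a1 a2] [a3 a4 a5]]]]]].
have ro k (lt : k < 4) : Ordinal lt = o4 k by apply: val_inj; rewrite /= inordK.
exists (fun i => nth set0 [:: A0; A1; A2; A3] i); last first.
  by case=> [[|[|[|[|//]]]] lt]; rewrite ro inordK.
split.
- by case=> [[|[|[|[|//]]]] lt] _ /=.
- have /(pairwiseP set0) D := d.
  move=> i j _ _ ij; have /orP[ltij|ltij] : (i < j) || (j < i) by rewrite -neq_ltn.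
    by apply: D; rewrite ?inE /= ?ltn_ord.
  by rewrite disjoint_sym; apply: D; rewrite ?inE /= ?ltn_ord.
by case=> [[|[|[|[|//]]]] lt]; case=> [[|[|[|[|//]]]] lt'] _ _ //= _; try (by []);
  apply: adj_sym.
Qed.

Lemma disjoint_rooted p q S S' : p != q -> p \notin S' -> q \notin S ->
  [disjoint S & S'] -> [disjoint p |: S & q |: S'].
Proof.
move=> pq pS qS d; rewrite disjointUs disjoints1 !inE negb_or pq pS /=.
by rewrite disjoint_sym disjointUs disjoints1 qS disjoint_sym.
Qed.

Lemma rooted_facts V (P : seq T) S p : {in S, forall s, s \in V /\ s \notin P} ->
  p \in V -> p |: S \subset V.
Proof. by move=> H pV; rewrite subUset sub1set pV; apply/subsetP=> s /H[]. Qed.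

Lemma helper_notin V (P : seq T) S p : {in S, forall s, s \in V /\ s \notin P} ->
  p \in P -> p \notin S.
Proof. by move=> H pP; apply/negP=> /H[_]; rewrite pP. Qed.

(** The last root gets no helper set: the sets around its two cycle neighbours reach it directly. *)
Lemma cycle5_build V p0 p1 p2 p3 p4 S0 S1 S2 S3 : let P := [:: p0; p1; p2; p3; p4] in
  uniq P -> {in P, forall p, p \in V} ->
  {in S0, forall s, s \in V /\ s \notin P} -> {in S1, forall s, s \in V /\ s \notin P} ->
  {in S2, forall s, s \in V /\ s \notin P} -> {in S3, forall s, s \in V /\ s \notin P} ->
  pairwise (fun A B => [disjoint A & B]) [:: S0; S1; S2; S3] ->
  [/\ connected_in e (p0 |: S0), connected_in e (p1 |: S1),
      connected_in e (p2 |: S2) & connected_in e (p3 |: S3)] ->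
  [/\ adj e (p0 |: S0) (p1 |: S1), adj e (p1 |: S1) (p2 |: S2),
      adj e (p2 |: S2) (p3 |: S3), adj e (p3 |: S3) [set p4] & adj e [set p4] (p0 |: S0)] ->
  cycle5 V p0 p1 p2 p3 p4.
Proof.
move=> P uP PV h0 h1 h2 h3 dS [c0 c1 c2 c3] adjs.
have := uP; rewrite /= !inE !negb_or !andbT.
move=> /and4P[/and4P[n01 n02 n03 n04] /and3P[n12 n13 n14] /andP[n23 n24] n34].
move: dS; rewrite /= !andbT => /and3P[/and3P[d01 d02 d03] /andP[d12 d13] d23].
have [i0 i1 i2 i3 i4] : [/\ p0 \in P, p1 \in P, p2 \in P, p3 \in P & p4 \in P].
  by rewrite /P !inE !eqxx !orbT.
exists (p0 |: S0), (p1 |: S1), (p2 |: S2), (p3 |: S3), [set p4]; split=> //.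
- by split=> //; apply: conn1.
- split; try (apply: rooted_facts; [eassumption|exact: PV]).
  by rewrite sub1set PV.
- by split; rewrite ?inE ?eqxx.
rewrite /= !andbT ![[disjoint _ & [set p4]]]disjoint_sym !disjoints1 !in_setU1 !negb_or.
rewrite ![p4 == _]eq_sym n04 n14 n24 n34 /=.
rewrite (helper_notin h0 i4) (helper_notin h1 i4) (helper_notin h2 i4) (helper_notin h3 i4).
rewrite !disjoint_rooted // ?(helper_notin h0) ?(helper_notin h1) ?(helper_notin h2) //.
all: exact: (helper_notin h3).
Qed.

Lemma clique4_build V p0 p1 p2 p3 S0 S1 S2 : let P := [:: p0; p1; p2; p3] in
  uniq P -> {in P, forall p, p \in V} ->
  {in S0, forall s, s \in V /\ s \notin P} -> {in S1, forall s, s \in V /\ s \notin P} ->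
  {in S2, forall s, s \in V /\ s \notin P} ->
  pairwise (fun A B => [disjoint A & B]) [:: S0; S1; S2] ->
  [/\ connected_in e (p0 |: S0), connected_in e (p1 |: S1) & connected_in e (p2 |: S2)] ->
  [/\ adj e (p0 |: S0) (p1 |: S1), adj e (p0 |: S0) (p2 |: S2) & adj e (p0 |: S0) [set p3]] ->
  [/\ adj e (p1 |: S1) (p2 |: S2), adj e (p1 |: S1) [set p3] & adj e (p2 |: S2) [set p3]] ->
  clique4 V p0 p1 p2 p3.
Proof.
move=> P uP PV h0 h1 h2 dS [c0 c1 c2] adj1 adj2.
have := uP; rewrite /= !inE !negb_or !andbT.
move=> /and3P[/and3P[n01 n02 n03] /andP[n12 n13] n23].
move: dS; rewrite /= !andbT => /andP[/andP[d01 d02] d12].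
have [i0 i1 i2 i3] : [/\ p0 \in P, p1 \in P, p2 \in P & p3 \in P].
  by rewrite /P !inE !eqxx !orbT.
exists (p0 |: S0), (p1 |: S1), (p2 |: S2), [set p3]; split=> //.
- by split=> //; apply: conn1.
- split; try (apply: rooted_facts; [eassumption|exact: PV]).
  by rewrite sub1set PV.
- by split; rewrite ?inE ?eqxx.
rewrite /= !andbT ![[disjoint _ & [set p3]]]disjoint_sym !disjoints1 !in_setU1 !negb_or.
rewrite ![p3 == _]eq_sym n03 n13 n23 /=.
rewrite (helper_notin h0 i3) (helper_notin h1 i3) (helper_notin h2 i3).
rewrite !disjoint_rooted // ?(helper_notin h0) ?(helper_notin h1) //.
all: exact: (helper_notin h2).
Qed.
(** Fewer than four roots are padded with further vertices of [H]; a clique minor restricts to any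
    subset of its roots. *)
Lemma rminor_clique4 V H n (r : 'I_n -> T) : 4 <= #|H| ->
  (forall p0 p1 p2 p3, uniq [:: p0; p1; p2; p3] -> {subset [:: p0; p1; p2; p3] <= H} ->
     clique4 V p0 p1 p2 p3) ->
  n <= 4 -> injective r -> (forall i, r i \in H) -> rminor e V r.
Proof.
move=> H4 K n4 ri rH.
pose l := codom r ++ take (4 - n) (enum (H :\: [set r i | i in setT])).
have cR : #|[set r i | i in setT]| = n by rewrite card_imset // cardsT card_ord.
have RH : [set r i | i in setT] \subset H by apply/subsetP=> x /imsetP[i _ ->].
have sl : size l = 4.
  rewrite size_cat size_codom card_ord size_takel ?subnKC // -cardE cardsDS // cR.
  by move: H4; clear; lia.
have ul : uniq l.
  rewrite cat_uniq take_uniq ?enum_uniq // andbT; apply/andP; split.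
    by rewrite map_inj_uniq ?enum_uniq.
  apply/hasPn=> x /mem_take; rewrite mem_enum in_setD => /andP[xr _].
  by apply: contra xr => /codomP[i ->]; apply: imset_f.
have lH : {subset l <= H}.
  move=> x; rewrite mem_cat => /orP[/codomP[i ->]//|/mem_take].
  by rewrite mem_enum in_setD => /andP[].
have [x0 _] : exists x0, x0 \in H by apply/set0Pn; rewrite -card_gt0; apply: leq_trans H4.
pose f := widen_ord n4.
have fi : injective f by move=> i j /(congr1 val) /= E; apply: val_inj.
have [|g mg rg] := rminor_restrict n4 (leqnn 4) fi
  (@clique4_rminor V (fun i : 'I_4 => nth x0 l i) _).
  have El : l = [:: nth x0 l 0; nth x0 l 1; nth x0 l 2; nth x0 l 3].
    by move: sl; case: (l) => [|? [|? [|? [|? [|]]]]].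
  by rewrite /o4 !inordK //; apply: K; rewrite -El.
exists g => // i; have := rg i; rewrite /= nth_cat size_codom card_ord ltn_ord.
by rewrite codomE (nth_map i) ?size_enum_ord // nth_ord_enum.
Qed.

Lemma linked5 V X : #|X| = 5 ->
  (forall p0 p1 p2 p3 p4, uniq [:: p0; p1; p2; p3; p4] ->
     {subset [:: p0; p1; p2; p3; p4] <= X} -> cycle5 V p0 p1 p2 p3 p4) ->
  (forall p0 p1 p2 p3, uniq [:: p0; p1; p2; p3] -> {subset [:: p0; p1; p2; p3] <= X} ->
     clique4 V p0 p1 p2 p3) ->
  linked e V X.
Proof.
move=> X5 C K n r n5 ri rX; have [n4|n4] := leqP n 4.
  by apply: (rminor_clique4 _ K) => //; rewrite X5.
have E : n = 5 by move: n4 n5; clear; lia.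
subst n; apply: cycle5_rminor; apply: C; first exact: uniq_o5.
by move=> x; rewrite !inE; do !case/orP; move/eqP->.
Qed.
Lemma adj1 A B x y : x \in A -> y \in B -> e x y -> adj e A B.
Proof. by move=> xA yB xy; exists x, y. Qed.

Lemma count_roots X Z (s : seq T) : uniq s -> {subset s <= X} ->
  #|X :&: Z| <= count (mem Z) s + (#|X| - size s).
Proof.
move=> us sX; have sub : X :&: Z \subset [set x in filter (mem Z) s] :|: X :\: [set x in s].
  apply/subsetP=> x; rewrite !inE mem_filter /= => /andP[-> ->].
  by rewrite andbT orbN.
apply: leq_trans (subset_leq_card sub) _; apply: leq_trans (leq_card_setU _ _) _.
have -> : #|[set x in filter (mem Z) s]| = count (mem Z) s.
  by rewrite cardsE (card_uniqP _) ?filter_uniq // size_filter.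
rewrite leq_add2l cardsDS; last by apply/subsetP=> x; rewrite inE; apply: sX.
by rewrite cardsE (card_uniqP _).
Qed.

Definition full_pair W X y z :=
  [/\ y \in W :\: X, z \in W :\: X, e y z & forall x, x \in X -> e x y && e x z].

Hypothesis ie : irreflexive e.

(** In the cycle, [y] joined to one root and [z] to another non-consecutive one provide four edges;
    [K], joined to a root that sees it, provides the edge between two consecutive roots seeing [K].
    In a clique on four roots, [y] serves all edges at one root, [z] those left at a second, and [K]
    the last edge. *)
Lemma full_pair_linked W X y z K : X \subset W ->
  full_pair W X y z -> K \subset W :\: X :\: [set y; z] -> connected_in e K ->
  #|X| = 5 -> 2 < #|X :&: NU e W K| -> linked e W X.
Proof.
move=> XW [yY zY yz full] KU cK X5 N3; set N := NU e W K in N3.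
have yzn : y != z by apply: contraTneq yz => ->; rewrite ie.
have notX x : x \in W :\: X -> x \in W /\ x \notin X by rewrite inE => /andP[].
have yW := notX _ yY; have zW := notX _ zY.
have KP k : k \in K -> [/\ k \in W, k \notin X, k != y & k != z].
  by move/(subsetP KU); rewrite !inE negb_or => /and3P[/andP[-> ->] -> ->].
have help (P : seq T) : {subset P <= X} -> [/\
    {in [set y], forall s, s \in W /\ s \notin P}, {in [set z], forall s, s \in W /\ s \notin P} &
    {in K, forall s, s \in W /\ s \notin P}].
  move=> PX; have no x : x \notin X -> x \notin P by apply: contra; apply: PX.
  by split=> [x /set1P->|x /set1P->|x /KP[]]; case: yW zW => ? ? [? ?]; split=> //; apply: no.
have dyz : [disjoint [set y] & [set z]] by rewrite disjoints1 inE.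
have dyK : [disjoint [set y] & K] by rewrite disjoints1; apply/negP=> /KP[]; rewrite eqxx.
have dzK : [disjoint [set z] & K] by rewrite disjoints1; apply/negP=> /KP[_ _ _]; rewrite eqxx.
have conny p : p \in X -> connected_in e (p |: [set y]).
  by move=> pX; apply: conn_star => // w /set1P->; case/andP: (full _ pX).
have connz p : p \in X -> connected_in e (p |: [set z]).
  by move=> pX; apply: conn_star => // w /set1P->; case/andP: (full _ pX).
have toK p : p \in N -> adj e [set p] K.
  by case/NUP=> k [_ _ kK kp]; apply: adj1 (set11 p) kK _; rewrite se.
have connK p : p \in N -> connected_in e (p |: K).
  by move=> pN; apply: connU => //; [apply: conn1|apply: toK].
have ey p : p \in X -> e y p by move=> pX; rewrite se; case/andP: (full _ pX).
have ez p : p \in X -> e z p by move=> pX; rewrite se; case/andP: (full _ pX).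
have core p0 p1 p2 p3 p4 : uniq [:: p0; p1; p2; p3; p4] ->
    {subset [:: p0; p1; p2; p3; p4] <= X} -> p1 \in N -> p2 \in N -> cycle5 W p0 p1 p2 p3 p4.
  move=> up PX n1 n2; have [hy hz hK] := help _ PX.
  have [x0 x1 x2 x3 x4] : [/\ p0 \in X, p1 \in X, p2 \in X, p3 \in X & p4 \in X].
    by split; apply: PX; rewrite !inE eqxx ?orbT.
  apply: (@cycle5_build W p0 p1 p2 p3 p4 [set y] set0 K [set z]) => //.
  - by move=> p /PX/(subsetP XW).
  - by move=> s; rewrite inE.
  - by rewrite /= dyz dyK [[disjoint K & _]]disjoint_sym dzK ![[disjoint _ & set0]]disjoint_sym -!setI_eq0 !set0I eqxx.
  - by split; [apply: conny|rewrite setU0; apply: conn1|apply: connK|apply: connz].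
  split.
  - by apply: (adj1 (x := y) (y := p1)); rewrite ?inE ?eqxx ?orbT // ey.
  - by apply: adjS (toK _ n1); rewrite ?subsetUl ?subsetUr.
  - by apply: (adj1 (x := p2) (y := z)); rewrite ?inE ?eqxx ?orbT // se ez.
  - by apply: (adj1 (x := z) (y := p4)); rewrite ?inE ?eqxx ?orbT // ez.
  by apply: (adj1 (x := p4) (y := y)); rewrite ?inE ?eqxx ?orbT // se ey.
have core4 p0 p1 p2 p3 : uniq [:: p0; p1; p2; p3] ->
    {subset [:: p0; p1; p2; p3] <= X} -> p2 \in N -> p3 \in N -> clique4 W p0 p1 p2 p3.
  move=> up PX n2 n3; have [hy hz hK] := help _ PX.
  have [x0 x1 x2 x3] : [/\ p0 \in X, p1 \in X, p2 \in X & p3 \in X].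
    by split; apply: PX; rewrite !inE eqxx ?orbT.
  apply: (@clique4_build W p0 p1 p2 p3 [set y] [set z] K) => //.
  - by move=> p /PX/(subsetP XW).
  - by rewrite /= dyz dyK dzK.
  - by split; [apply: conny|apply: connz|apply: connK].
  - by split; [apply: (adj1 (x := y) (y := p1))|apply: (adj1 (x := y) (y := p2))|
      apply: (adj1 (x := y) (y := p3))]; rewrite ?inE ?eqxx ?orbT // ey.
  split; [apply: (adj1 (x := z) (y := p2))|apply: (adj1 (x := z) (y := p3))|];
    rewrite ?inE ?eqxx ?orbT ?ez //.
  by apply: adj_sym => //; apply: adjS (toK _ n3); rewrite ?subsetUr.
apply: (linked5 X5) => [p0 p1 p2 p3 p4 up PX|p0 p1 p2 p3 up PX].
  have := count_roots N up PX; rewrite X5 /= => cN.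
  have rots k : uniq (rot k [:: p0; p1; p2; p3; p4]) /\ {subset rot k [:: p0; p1; p2; p3; p4] <= X}.
    by rewrite rot_uniq; split=> // x; rewrite mem_rot; apply: PX.
  (* Three of five cyclic positions always include two consecutive ones. *)
  have : [|| (p1 \in N) && (p2 \in N), (p2 \in N) && (p3 \in N), (p3 \in N) && (p4 \in N),
             (p4 \in N) && (p0 \in N) | (p0 \in N) && (p1 \in N)].
    have := leq_trans N3 cN; move: (p0 \in N) (p1 \in N) (p2 \in N) (p3 \in N) (p4 \in N).
    by do 5!case.
  case/or4P=> [||| /orP[]] /andP[n1 n2].
  - exact: core.
  - have [u s] := rots 1; do 4!apply: cycle5_rot; exact: core.
  - have [u s] := rots 2; do 3!apply: cycle5_rot; exact: core.
  - have [u s] := rots 3; do 2!apply: cycle5_rot; exact: core.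
  have [u s] := rots 4; apply: cycle5_rot; exact: core.
have := count_roots N up PX; rewrite X5 /= => cN.
have H a b c d : perm_eq [:: a; b; c; d] [:: p0; p1; p2; p3] -> c \in N -> d \in N ->
    clique4 W a b c d.
  move=> pe; apply: core4; first by rewrite (perm_uniq pe).
  by move=> x; rewrite (perm_mem pe); apply: PX.
have perm q0 q1 q2 q3 : (forall Q : pred T, Q q0 + Q q1 + Q q2 + Q q3 = Q p0 + Q p1 + Q p2 + Q p3) ->
    perm_eq [:: q0; q1; q2; q3] [:: p0; p1; p2; p3].
  by move=> E; apply/permP=> Q /=; have := E Q; clear; lia.
have : [|| (p2 \in N) && (p3 \in N), (p1 \in N) && (p2 \in N), (p0 \in N) && (p1 \in N),
           (p3 \in N) && (p0 \in N), (p0 \in N) && (p2 \in N) | (p1 \in N) && (p3 \in N)].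
  by have := leq_trans N3 cN; move: (p0 \in N) (p1 \in N) (p2 \in N) (p3 \in N); do 4!case.
case/or4P=> [|||/or3P[]] /andP[n1 n2].
- exact: core4.
- by apply: clique4_rot; apply: H => //; apply: perm => Q; clear; lia.
- by do 2!apply: clique4_rot; apply: H => //; apply: perm => Q; clear; lia.
- by do 3!apply: clique4_rot; apply: H => //; apply: perm => Q; clear; lia.
- by apply: clique4_swap; apply: clique4_rot; apply: H => //; apply: perm => Q; clear; lia.
by apply: clique4_swap; do 3!apply: clique4_rot; apply: H => //; apply: perm => Q; clear; lia.
Qed.
End Small.

(** * Three vertices almost completely joined to five roots *)

Section Three.
Variables (T : finType) (e : rel T).
Hypothesis se : symmetric e.
Hypothesis ie : irreflexive e.
Implicit Types (A B U V W X Y Z S K H R : {set T}).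

(** Of the eleven possible edges from [b] and [c] to the roots and to each other, at most two are
    missing. With [a] attached to one root to serve its edges, [b] and [c] have to supply the rest;
    a finite check finds a suitable rotation. *)
Lemma three_core X V a b c : X \subset V -> uniq [:: a; b; c] -> {subset [:: a; b; c] <= V :\: X} ->
  #|X| = 5 -> {in X, forall x, e a x} ->
  9 <= #|X :&: nb e V b| + #|X :&: nb e V c| + e b c -> linked e V X.
Proof.
rewrite /= !inE !negb_or !andbT => XV /andP[/andP[ab ac] bc] sub X5 full big.
have notX x : x \in [:: a; b; c] -> x \in V /\ x \notin X by move/sub; rewrite inE => /andP[].
have help (P : seq T) y : {subset P <= X} -> y \in [:: a; b; c] ->
    {in [set y], forall s, s \in V /\ s \notin P}.
  by move=> PX /notX[yV yX] s /set1P->; split=> //; apply: contra yX; apply: PX.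
have [ia ib ic] : [/\ a \in [:: a; b; c], b \in [:: a; b; c] & c \in [:: a; b; c]].
  by rewrite !inE !eqxx !orbT.
have conn p y : e y p -> connected_in e (p |: [set y]).
  by move=> yp; apply: conn_star => // w /set1P->; rewrite se.
have link p q y z : [|| e y z, e y q | e z p] -> adj e (p |: [set y]) (q |: [set z]).
  case/or3P=> H.
  - by apply: (adj1 (x := y) (y := z)); rewrite ?inE ?eqxx ?orbT.
  - by apply: (adj1 (x := y) (y := q)); rewrite ?inE ?eqxx ?orbT.
  by apply: (adj1 (x := p) (y := z)); rewrite ?inE ?eqxx ?orbT // se.
have link1 p q y : e y q -> adj e (p |: [set y]) [set q].
  by move=> H; apply: (adj1 (x := y) (y := q)); rewrite ?inE ?eqxx ?orbT.
have core p0 p1 p2 p3 p4 : uniq [:: p0; p1; p2; p3; p4] ->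
    {subset [:: p0; p1; p2; p3; p4] <= X} ->
    [&& e b p1, e b p2, e c p3, e c p4 & [|| e b c, e b p3 | e c p2]] -> cycle5 e V p0 p1 p2 p3 p4.
  move=> up PX /and5P[b1 b2 c3 c4 bc'].
  have [x0 x1 x2 x3 x4] : [/\ p0 \in X, p1 \in X, p2 \in X, p3 \in X & p4 \in X].
    by split; apply: PX; rewrite !inE eqxx ?orbT.
  apply: (@cycle5_build _ _ V p0 p1 p2 p3 p4 [set a] set0 [set b] [set c]); rewrite ?setU0 //; try exact: help.
  - by move=> p /PX/(subsetP XV).
  - by move=> s; rewrite inE.
  - by rewrite /= ![[disjoint _ & set0]]disjoint_sym -!setI_eq0 !set0I eqxx !setI_eq0 !disjoints1 !inE ab ac bc.
  - by split; [apply: conn; apply: full|apply: conn1|apply: conn|apply: conn].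
  split; [apply: link1; exact: full| |apply: link; exact: bc'|exact: link1|].
    by apply: adj_sym => //; apply: link1.
  by apply: adj_sym => //; apply: link1; apply: full.
have core4 b' c' p0 p1 p2 p3 : uniq [:: a; b'; c'] -> b' \in [:: a; b; c] -> c' \in [:: a; b; c] ->
    uniq [:: p0; p1; p2; p3] -> {subset [:: p0; p1; p2; p3] <= X} ->
    [&& e b' p1, e b' p3, e c' p2, e c' p3 & [|| e b' c', e b' p2 | e c' p1]] ->
    clique4 e V p0 p1 p2 p3.
  move=> u3 ib' ic' up PX /and5P[b1 b3 c2 c3 bcp].
  move: u3; rewrite /= !inE negb_or !andbT => /andP[/andP[ab' ac'] bc'].
  have [x0 x1 x2 x3] : [/\ p0 \in X, p1 \in X, p2 \in X & p3 \in X].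
    by split; apply: PX; rewrite !inE eqxx ?orbT.
  apply: (@clique4_build _ _ V p0 p1 p2 p3 [set a] [set b'] [set c']); rewrite ?setU0 //;
    try exact: help.
  - by move=> p /PX/(subsetP XV).
  - by rewrite /= !disjoints1 !inE ab' ac' bc'.
  - by split; [apply: conn; apply: full|apply: conn|apply: conn].
  - by split; [apply: link|apply: link|apply: link1]; rewrite ?(full _ x1) ?(full _ x2) ?(full _ x3) ?orbT.
  by split; [apply: link|apply: link1|apply: link1].
apply: (linked5 se X5) => [p0 p1 p2 p3 p4 up PX|p0 p1 p2 p3 up PX].
  have cb := count_roots (nb e V b) up PX; have cc := count_roots (nb e V c) up PX.
  move: cb cc; rewrite X5 /= !inE !(subsetP XV) ?PX ?inE ?eqxx ?orbT //= => cb cc.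
  have rots k : uniq (rot k [:: p0; p1; p2; p3; p4]) /\ {subset rot k [:: p0; p1; p2; p3; p4] <= X}.
    by rewrite rot_uniq; split=> // x; rewrite mem_rot; apply: PX.
  have : [|| [&& e b p1, e b p2, e c p3, e c p4 & [|| e b c, e b p3 | e c p2]],
             [&& e b p2, e b p3, e c p4, e c p0 & [|| e b c, e b p4 | e c p3]],
             [&& e b p3, e b p4, e c p0, e c p1 & [|| e b c, e b p0 | e c p4]],
             [&& e b p4, e b p0, e c p1, e c p2 & [|| e b c, e b p1 | e c p0]] |
             [&& e b p0, e b p1, e c p2, e c p3 & [|| e b c, e b p2 | e c p1]]].
    have := leq_trans big (leq_add (leq_add cb cc) (leqnn _)).
    move: (e b p0) (e b p1) (e b p2) (e b p3) (e b p4) (e c p0) (e c p1) (e c p2) (e c p3) (e c p4) (e b c).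
    by do 11!case.
  case/or4P=> [H|H|H|/orP[H|H]].
  - exact: core.
  - have [u s] := rots 1; do 4!apply: cycle5_rot; exact: core.
  - have [u s] := rots 2; do 3!apply: cycle5_rot; exact: core.
  - have [u s] := rots 3; do 2!apply: cycle5_rot; exact: core.
  have [u s] := rots 4; apply: cycle5_rot; exact: core.
have cb := count_roots (nb e V b) up PX; have cc := count_roots (nb e V c) up PX.
move: cb cc; rewrite X5 /= !inE !(subsetP XV) ?PX ?inE ?eqxx ?orbT //= => cb cc.
have rots k : uniq (rot k [:: p0; p1; p2; p3]) /\ {subset rot k [:: p0; p1; p2; p3] <= X}.
  by rewrite rot_uniq; split=> // x; rewrite mem_rot; apply: PX.
pose ok y z q1 q2 q3 := [&& e y q1, e y q3, e z q2, e z q3 & [|| e y z, e y q2 | e z q1]].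
have use q0 q1 q2 q3 : uniq [:: q0; q1; q2; q3] /\ {subset [:: q0; q1; q2; q3] <= X} ->
   ok b c q1 q2 q3 || ok c b q1 q2 q3 -> clique4 e V q0 q1 q2 q3.
  case=> uq qX /orP[]; apply: core4 => //=; rewrite !inE negb_or ab ac ?bc //.
  by rewrite eq_sym bc.
have : [|| ok b c p1 p2 p3 || ok c b p1 p2 p3, ok b c p2 p3 p0 || ok c b p2 p3 p0,
           ok b c p3 p0 p1 || ok c b p3 p0 p1 | ok b c p0 p1 p2 || ok c b p0 p1 p2].
  rewrite /ok [e c b]se.
  have := leq_trans big (leq_add (leq_add cb cc) (leqnn _)).
  move: (e b p0) (e b p1) (e b p2) (e b p3) (e c p0) (e c p1) (e c p2) (e c p3) (e b c).
  by do 9!case.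
case/or4P=> H.
- exact: use H.
- do 3!apply: clique4_rot => //; exact: use (rots 1) H.
- do 2!apply: clique4_rot => //; exact: use (rots 2) H.
apply: clique4_rot => //; exact: use (rots 3) H.
Qed.

(** More than 30 ordered pairs mean at least 16 of the 15 + 3 possible edges. Three vertices cannot
    all miss a root then, so one sees all of [X]; at most seven edges touch it, and nine remain for
    the other two. *)
Lemma three_linked X Y : [disjoint X & Y] ->
  #|X| = 5 -> #|Y| = 3 -> 30 < cnt e (X :|: Y) Y -> linked e (X :|: Y) X.
Proof.
move=> dXY X5 Y3; set V := X :|: Y; rewrite cnt_sum ?subsetUr //.
have := Y3; rewrite cardE; case E : (enum Y) => [|a [|b [|c [|]]]] // _.
have uY : uniq [:: a; b; c] by rewrite -E enum_uniq.
have YP y : (y \in Y) = (y \in [:: a; b; c]) by rewrite -E mem_enum.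
have sY : {subset [:: a; b; c] <= V :\: X}.
  move=> y; rewrite -YP => yY; rewrite in_setD in_setU yY orbT andbT.
  by apply/negP=> yX; apply: disjointsE dXY yX yY.
rewrite -big_enum E !big_cons big_nil /= addn0.
have part y z w : perm_eq [:: y; z; w] [:: a; b; c] ->
   #|nb e V y :\: Y| = #|X :&: nb e V y| /\ #|nb e V y| <= #|X :&: nb e V y| + (e y z + e y w).
  move=> pe; have YPe v : (v \in Y) = (v \in [:: y; z; w]) by rewrite YP (perm_mem pe).
  have XD : nb e V y :\: Y = X :&: nb e V y.
    apply/setP=> v; rewrite !inE; case vY: (v \in Y) => /=; last by rewrite orbF andbA andbb.
    by case vX: (v \in X) => //; have := disjointsE dXY vX vY.
  split; first by rewrite XD.
  have : nb e V y \subset (X :&: nb e V y) :|: [set v in [:: z; w] | e y v].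
    apply/subsetP=> v; rewrite !inE => /andP[vV yv]; rewrite yv vV !andbT.
    case/orP: vV => [->//|]; rewrite YPe !inE => /or3P[/eqP E'|->|->]; rewrite ?orbT //.
    by rewrite E' ie in yv.
  move/subset_leq_card/leq_trans; apply; apply: leq_trans (leq_card_setU _ _) _; rewrite leq_add2l.
  have : [set v in [:: z; w] | e y v] \subset (if e y z then [set z] else set0) :|:
       (if e y w then [set w] else set0).
    apply/subsetP=> v; rewrite !inE => /andP[/orP[]/eqP-> H]; rewrite H inE eqxx ?orbT //.
  move/subset_leq_card/leq_trans; apply; apply: leq_trans (leq_card_setU _ _) _.
  by case: (e y z); case: (e y w); rewrite ?cards1 ?cards0.
have le5 y : #|X :&: nb e V y| <= 5 by rewrite -X5 subset_leq_card // subsetIl.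
have fullP y : 5 <= #|X :&: nb e V y| -> {in X, forall x, e y x}.
  move=> h x xX; have /eqP EX : X :&: nb e V y == X by rewrite eqEcard subsetIl X5.
  by move: xX; rewrite -EX !inE => /and3P[].
have pP q0 q1 q2 : (forall Q : pred T, Q q0 + Q q1 + Q q2 = Q a + Q b + Q c) ->
    perm_eq [:: q0; q1; q2] [:: a; b; c].
  by move=> H; apply/permP=> Q /=; have := H Q; clear; lia.
have p1 : perm_eq [:: b; a; c] [:: a; b; c] by apply: pP => Q; clear; lia.
have p2 : perm_eq [:: c; a; b] [:: a; b; c] by apply: pP => Q; clear; lia.
have [xa na] := part a b c (perm_refl _); have [xb nb'] := part b a c p1.
have [xc nc] := part c a b p2.
rewrite xa xb xc => tot; rewrite [e b a]se in nb'; rewrite [e c a]se [e c b]se in nc.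
have := (le5 a, le5 b, le5 c) => -[[la lb] lc].
have XV : X \subset V by apply: subsetUl.
have go q0 q1 q2 : perm_eq [:: q0; q1; q2] [:: a; b; c] -> 5 <= #|X :&: nb e V q0| ->
   9 <= #|X :&: nb e V q1| + #|X :&: nb e V q2| + e q1 q2 -> linked e V X.
  move=> pe h5 h9; apply: (three_core XV _ _ X5 (fullP _ h5) h9).
    by rewrite (perm_uniq pe).
  by move=> y; rewrite (perm_mem pe); apply: sY.
have : (5 <= #|X :&: nb e V a|) || (5 <= #|X :&: nb e V b|) || (5 <= #|X :&: nb e V c|).
  by move: tot na nb' nc la lb lc; clear; case: (e a b); case: (e a c); case: (e b c) => /=; lia.
case/orP=> [/orP[]|] h5.
- apply: (go a b c) => //; move: tot na nb' nc la lb lc; clear.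
  by case: (e a b); case: (e a c); case: (e b c) => /=; lia.
- apply: (go b a c) => //; move: tot na nb' nc la lb lc; clear.
  by case: (e a b); case: (e a c); case: (e b c) => /=; lia.
apply: (go c a b) => //; move: tot na nb' nc la lb lc; clear.
by case: (e a b); case: (e a c); case: (e b c) => /=; lia.
Qed.
End Three.

(** * Rooted minors in a vertex and its nearly complete neighbourhood *)

Section Dense.
Variables (T : finType) (e : rel T).
Hypothesis se : symmetric e.
Implicit Types (A B U V W X Y Z S K H R : {set T}).

Lemma clique4_swap12 V p0 p1 p2 p3 : clique4 e V p0 p1 p2 p3 -> clique4 e V p0 p2 p1 p3.
Proof.
move=> /(clique4_rot se)/(clique4_swap se)/(clique4_rot se)/(clique4_rot se).
exact: clique4_rot.
Qed.

Lemma clique4_swap23 V p0 p1 p2 p3 : clique4 e V p0 p1 p2 p3 -> clique4 e V p0 p1 p3 p2.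
Proof.
move=> /(clique4_rot se)/(clique4_rot se)/(clique4_swap se)/(clique4_rot se).
exact: clique4_rot.
Qed.

(** [H] plays the neighbourhood of [v], and [t] bounds the non-neighbours of a vertex inside [H].
    The roots of the minor are arbitrary vertices of [H]; [X] matters only because its internal
    non-edges are not bounded. *)
Variables (X H : {set T}) (v : T) (t : nat).
Hypotheses (vH : v \notin H) (evH : {in H, forall x, e v x}).
Hypotheses (H6 : t + 6 <= #|H|) (XH : #|X :&: H| + t <= 4) (t3 : t <= 3).
Hypothesis missH : {in H, forall x,
  #|[set w in H | [&& w != x, ~~ e x w & ~~ ((x \in X) && (w \in X))]]| <= t}.

(* Two roots in [X] need not be adjacent, and [missH] does not count such pairs. *)
Definition bad x p := ~~ e x p && ~~ ((x \in X) && (p \in X)).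
Definition missed Y x := [set w in Y | (w != x) && ~~ e x w].
Definition miss Y x := #|missed Y x|.

(** The non-neighbours of [x] in [Y] and among two further vertices share the single budget [t]:
    each missing root edge leaves more helpers in [Y]. *)
Lemma miss_count Y x p q : Y \subset H -> x \in H -> p \in H -> q \in H ->
  p \notin Y -> q \notin Y -> uniq [:: x; p; q] -> (x \in X -> [disjoint Y & X]) ->
  miss Y x + bad x p + bad x q <= t.
Proof.
rewrite /= !inE negb_or !andbT => YH xH pH qH pY qY /andP[/andP[xp xq] pq] xX.
apply: leq_trans (missH xH); set M := [set w in H | _].
have : miss Y x <= #|M :\ p :\ q|.
  apply: subset_leq_card; apply/subsetP=> w.
  rewrite !inE => /and3P[wY -> ->]; rewrite (subsetP YH) //=.
  have -> : w != q by apply: contraNneq qY => <-.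
  have -> : w != p by apply: contraNneq pY => <-.
  by apply/negP=> /andP[/xX d wX]; apply: disjointsE d wY wX.
have := cardsD1 p M; have := cardsD1 q (M :\ p).
have -> : (p \in M) = bad x p by rewrite !inE pH eq_sym xp.
have -> : (q \in M :\ p) = bad x q by rewrite !inE qH [q == p]eq_sym pq [q == x]eq_sym xq.
by clear; lia.
Qed.

Lemma avoid (A B C Y : {set T}) : #|A| + #|B| + #|C| < #|Y| ->
  exists w, [/\ w \in Y, w \notin A, w \notin B & w \notin C].
Proof.
move=> lt; have /set0Pn[w] : Y :\: (A :|: B :|: C) != set0.
  rewrite -card_gt0; have := (leq_card_setU (A :|: B) C).1; have := (leq_card_setU A B).1.
  have := cardsD Y (A :|: B :|: C); have := subset_leq_card (subsetIr Y (A :|: B :|: C)).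
  by move: lt; clear; lia.
by rewrite !inE !negb_or => /andP[/andP[/andP[? ?] ?] ?]; exists w.
Qed.

Lemma missedN Y x w : w \in Y -> x \notin Y -> w \notin missed Y x -> e x w.
Proof.
move=> wY xY; rewrite inE wY /= negb_and !negbK => /orP[/eqP E|//].
by rewrite E (negPf xY) in wY.
Qed.

Lemma common2 Y x y : x \notin Y -> y \notin Y -> miss Y x + miss Y y < #|Y| ->
  exists w, [/\ w \in Y, e x w & e y w].
Proof.
move=> xY yY lt; have [|w [wY wx wy _]] := @avoid (missed Y x) (missed Y y) set0 Y.
  by rewrite cards0 addn0.
by exists w; split=> //; apply: missedN wY _ _.
Qed.

(** The helper set is empty when [x] and [y] are adjacent, and otherwise a common neighbour found by
    counting. *)
Lemma helper Y x y : x \notin Y -> y \notin Y -> e x y || (miss Y x + miss Y y < #|Y|) ->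
  exists2 S : {set T}, S \subset Y /\ {in S, forall w, e x w} & adj e (x |: S) [set y].
Proof.
move=> xY yY; have [xy _|_ /= lt] := boolP (e x y); last first.
  have [w [wY xw yw]] := common2 xY yY lt.
  exists [set w]; first by split; [rewrite sub1set|move=> z /set1P->].
  by exists w, y; rewrite !inE eqxx orbT se.
exists set0; first by split; [exact: sub0set|move=> w; rewrite inE].
by exists x, y; rewrite !inE eqxx.
Qed.

Definition config (P : seq T) Y := [/\ uniq P, {subset P <= H}, Y \subset H &
  {in Y, forall y, y \notin P}].

Lemma config_helper (P : seq T) Y S : config P Y -> S \subset Y ->
  {in S, forall s, s \in v |: H /\ s \notin P}.
Proof.
case=> _ _ /subsetP YH YP /subsetP SY s sS; split; last by apply/YP/SY.
by rewrite in_setU1 YH ?orbT // SY.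
Qed.

Lemma config_v (P : seq T) Y : config P Y -> {in [set v], forall s, s \in v |: H /\ s \notin P}.
Proof.
case=> _ PH _ _ s /set1P->; split; first by rewrite setU11.
by apply: contra vH; apply: PH.
Qed.

Lemma config_notin (P : seq T) Y p : config P Y -> p \in P -> p \notin Y.
Proof. by case=> _ _ _ YP pP; apply/negP=> /YP; rewrite pP. Qed.

Lemma disjoint_v Y S : Y \subset H -> S \subset Y -> [disjoint [set v] & S].
Proof.
move=> YH SY; rewrite disjoints1; apply: contra vH => vS.
exact: subsetP YH _ (subsetP SY _ vS).
Qed.

Lemma conn_v p : p \in H -> connected_in e (p |: [set v]).
Proof. by move=> pH; apply: conn_star => // w /set1P->; rewrite se evH. Qed.

Lemma adj_v p q S : q \in H -> adj e (p |: [set v]) (q |: S).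
Proof. by move=> qH; exists v, q; rewrite !inE !eqxx orbT evH. Qed.

Lemma adj_v1 p q : q \in H -> adj e (p |: [set v]) [set q].
Proof. by move=> qH; exists v, q; rewrite !inE !eqxx orbT evH. Qed.

(** * Clique minors on four roots *)

Section Clique.
Variables (p0 p1 p2 p3 : T) (Y : {set T}).
Hypothesis rt : config [:: p0; p1; p2; p3] Y.

(** Adding [v] to the branch set of [p0] makes it adjacent to every other root, so only the triangle
    on [p1], [p2], [p3] remains. *)
Lemma triangle_build S1 S2 : S1 \subset Y -> S2 \subset Y -> [disjoint S1 & S2] ->
  {in S1, forall w, e p1 w} -> {in S2, forall w, e p2 w} ->
  adj e (p1 |: S1) (p2 |: S2) -> adj e (p1 |: S1) [set p3] -> adj e (p2 |: S2) [set p3] ->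
  clique4 e (v |: H) p0 p1 p2 p3.
Proof.
move=> S1Y S2Y d12 e1 e2 a12 a13 a23; have [up PH YH YP] := rt.
have [h0 h1 h2 h3] : [/\ p0 \in H, p1 \in H, p2 \in H & p3 \in H].
  by split; apply: PH; rewrite !inE eqxx ?orbT.
apply: (@clique4_build _ e (v |: H) p0 p1 p2 p3 [set v] S1 S2) => //.
- by move=> p /PH pH; rewrite in_setU1 pH orbT.
- exact: config_v rt.
- exact: config_helper rt S1Y.
- exact: config_helper rt S2Y.
- by rewrite /= d12 !(disjoint_v YH).
- by split; [apply: conn_v|apply: conn_star|apply: conn_star].
by split; [apply: adj_v|apply: adj_v|apply: adj_v1].
Qed.

(** Both helpers join the branch set of [p1], so they may coincide and no disjointness is
    required. *)
Lemma triangle_center : e p1 p2 || (miss Y p1 + miss Y p2 < #|Y|) ->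
  e p1 p3 || (miss Y p1 + miss Y p3 < #|Y|) -> e p2 p3 -> clique4 e (v |: H) p0 p1 p2 p3.
Proof.
have nY p : p \in [:: p0; p1; p2; p3] -> p \notin Y by apply: config_notin rt.
have [n1 n2 n3] : [/\ p1 \notin Y, p2 \notin Y & p3 \notin Y].
  by split; apply: nY; rewrite !inE eqxx ?orbT.
move=> /(helper n1 n2)[S2 [s2 e2] a2] /(helper n1 n3)[S3 [s3 e3] a3] e23.
apply: (@triangle_build (S2 :|: S3) set0); rewrite ?subUset ?s2 ?sub0set ?setU0 //.
- by rewrite disjoint_sym -setI_eq0 set0I.
- by move=> w /setUP[/e2|/e3].
- by move=> w; rewrite inE.
- by apply: adjS a2; rewrite ?setUA ?subsetUl.
- by apply: adjS a3; rewrite // setUCA subsetUr.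
by exists p2, p3; rewrite !inE !eqxx.
Qed.

(** For a triangle without edges, one helper seen by all three roots settles two edges and a second
    helper the third. *)
Lemma triangle_full : miss Y p1 + miss Y p2 + miss Y p3 < #|Y| ->
  miss Y p2 + miss Y p3 + 1 < #|Y| -> clique4 e (v |: H) p0 p1 p2 p3.
Proof.
have nY p : p \in [:: p0; p1; p2; p3] -> p \notin Y by apply: config_notin rt.
have [n1 n2 n3] : [/\ p1 \notin Y, p2 \notin Y & p3 \notin Y].
  by split; apply: nY; rewrite !inE eqxx ?orbT.
move=> /avoid[y [yY y1 y2 y3]] lt.
have [|z [zY z2 z3]] := @avoid (missed Y p2) (missed Y p3) [set y] Y; first by rewrite cards1.
rewrite inE => zy.
have [[e1 e2] e3] := (missedN yY n1 y1, missedN yY n2 y2, missedN yY n3 y3).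
have [e2' e3'] := (missedN zY n2 z2, missedN zY n3 z3).
apply: (@triangle_build [set y] [set z]); rewrite ?sub1set //.
- by rewrite disjoints1 inE eq_sym.
- by move=> w /set1P->.
- by move=> w /set1P->.
- by exists y, p2; rewrite !inE !eqxx orbT se.
- by exists y, p3; rewrite !inE !eqxx orbT se.
by exists z, p3; rewrite !inE !eqxx orbT se.
Qed.
End Clique.

(** * Cycle minors on five roots *)

Section Cycle.
Variables (p0 p1 p2 p3 p4 : T) (Y : {set T}).
Hypothesis rt : config [:: p0; p1; p2; p3; p4] Y.

Let notinY : [/\ p1 \notin Y, p2 \notin Y, p3 \notin Y & p4 \notin Y].
Proof. by split; apply: (config_notin rt); rewrite !inE eqxx ?orbT. Qed.

(** With [v] in the branch set of [p0], both cycle edges at [p0] exist, and only the path from [p1]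
    to [p4] remains. *)
Lemma path_build S1 S2 S3 : S1 \subset Y -> S2 \subset Y -> S3 \subset Y ->
  [disjoint S1 & S2] -> [disjoint S1 & S3] -> [disjoint S2 & S3] ->
  {in S1, forall w, e p1 w} -> {in S2, forall w, e p2 w} -> {in S3, forall w, e p3 w} ->
  adj e (p1 |: S1) (p2 |: S2) -> adj e (p2 |: S2) (p3 |: S3) -> adj e (p3 |: S3) [set p4] ->
  cycle5 e (v |: H) p0 p1 p2 p3 p4.
Proof.
move=> S1Y S2Y S3Y d12 d13 d23 e1 e2 e3 a12 a23 a34; have [up PH YH YP] := rt.
have [h0 h1 h4] : [/\ p0 \in H, p1 \in H & p4 \in H].
  by split; apply: PH; rewrite !inE eqxx ?orbT.
apply: (@cycle5_build _ e (v |: H) p0 p1 p2 p3 p4 [set v] S1 S2 S3) => //.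
- by move=> p /PH pH; rewrite in_setU1 pH orbT.
- exact: config_v rt.
- exact: config_helper rt S1Y.
- exact: config_helper rt S2Y.
- exact: config_helper rt S3Y.
- by rewrite /= d12 d13 d23 !(disjoint_v YH).
- by split; [apply: conn_v|apply: conn_star|apply: conn_star|apply: conn_star].
by split=> //; [apply: adj_v|apply: adj_sym => //; apply: adj_v1].
Qed.

(** Helpers for the two path edges at [p2] share its branch set, so they need not differ. *)
Lemma path_center2 : e p1 p2 || (miss Y p1 + miss Y p2 < #|Y|) ->
  e p2 p3 || (miss Y p2 + miss Y p3 < #|Y|) -> e p3 p4 -> cycle5 e (v |: H) p0 p1 p2 p3 p4.
Proof.
have [n1 n2 n3 n4] := notinY; rewrite se addnC.
move=> /(helper n2 n1)[S1 [s1 e1] a1] /(helper n2 n3)[S3 [s3 e3] a3] e34.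
apply: (@path_build set0 (S1 :|: S3) set0); rewrite ?subUset ?s1 ?sub0set ?setU0 //;
  try by [rewrite -setI_eq0 set0I|rewrite disjoint_sym -setI_eq0 set0I|move=> w; rewrite inE].
- by move=> w /setUP[/e1|/e3].
- by apply: adj_sym => //; apply: adjS a1; rewrite ?setUA ?subsetUl.
- by apply: adjS a3; rewrite // setUCA subsetUr.
by exists p3, p4; rewrite !inE !eqxx.
Qed.

Lemma path_center3 : e p1 p2 -> e p2 p3 || (miss Y p2 + miss Y p3 < #|Y|) ->
  e p3 p4 || (miss Y p3 + miss Y p4 < #|Y|) -> cycle5 e (v |: H) p0 p1 p2 p3 p4.
Proof.
have [n1 n2 n3 n4] := notinY; rewrite [e p2 p3]se [miss Y p2 + _]addnC => e12.
move=> /(helper n3 n2)[S2 [s2 e2] a2] /(helper n3 n4)[S4 [s4 e4] a4].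
apply: (@path_build set0 set0 (S2 :|: S4)); rewrite ?subUset ?s2 ?sub0set ?setU0 //;
  try by [rewrite -setI_eq0 set0I|rewrite disjoint_sym -setI_eq0 set0I|move=> w; rewrite inE].
- by move=> w /setUP[/e2|/e4].
- by exists p1, p2; rewrite !inE !eqxx.
- by apply: adj_sym => //; apply: adjS a2; rewrite ?setUA ?subsetUl.
by apply: adjS a4; rewrite // setUCA subsetUr.
Qed.

Lemma path_two y z : y \in Y -> z \in Y -> y != z -> e p1 y -> e p2 y -> e p2 p3 || e y p3 ->
  e p3 z -> e p4 z -> cycle5 e (v |: H) p0 p1 p2 p3 p4.
Proof.
move=> yY zY yz y1 y2 y3 z3 z4.
apply: (@path_build set0 [set y] [set z]); rewrite ?sub1set ?sub0set ?setU0 ?disjoints1 ?inE //;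
  try by [rewrite -setI_eq0 set0I|move=> w; rewrite inE|move=> w /set1P->].
- by exists p1, y; rewrite !inE !eqxx orbT.
- by case/orP: y3 => y3; [exists p2, p3|exists y, p3]; rewrite !inE !eqxx ?orbT.
by exists z, p4; rewrite !inE !eqxx orbT se.
Qed.

Lemma path_full : miss Y p1 + miss Y p2 + miss Y p3 < #|Y| ->
  miss Y p3 + miss Y p4 + 1 < #|Y| -> cycle5 e (v |: H) p0 p1 p2 p3 p4.
Proof.
have [n1 n2 n3 n4] := notinY => /avoid[y [yY y1 y2 y3]] lt.
have [|z [zY z3 z4]] := @avoid (missed Y p3) (missed Y p4) [set y] Y; first by rewrite cards1.
rewrite inE => zy.
have [[e1 e2] e3] := (missedN yY n1 y1, missedN yY n2 y2, missedN yY n3 y3).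
have [e3' e4'] := (missedN zY n3 z3, missedN zY n4 z4).
by apply: (path_two yY zY) => //; rewrite 1?eq_sym // [e y p3]se e3 orbT.
Qed.

Lemma path_apart : e p2 p3 -> miss Y p1 + miss Y p2 < #|Y| ->
  miss Y p3 + miss Y p4 + 1 < #|Y| -> cycle5 e (v |: H) p0 p1 p2 p3 p4.
Proof.
have [n1 n2 n3 n4] := notinY => e23 /(common2 n1 n2)[y [yY e1 e2]] lt.
have [|z [zY z3 z4]] := @avoid (missed Y p3) (missed Y p4) [set y] Y; first by rewrite cards1.
rewrite inE => zy.
have [e3' e4'] := (missedN zY n3 z3, missedN zY n4 z4).
by apply: (path_two yY zY) => //; rewrite 1?eq_sym // e23.
Qed.

(* Here the two missing edges of the path are bridged by three helpers, two of
   which are adjacent and serve the first edge together. *)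
Lemma path_apart2 : t <= 2 -> [disjoint Y & X] -> e p2 p3 ->
  ~~ e p1 p2 -> ~~ e p3 p4 -> miss Y p1 <= 1 -> miss Y p2 <= 1 -> miss Y p3 <= 1 ->
  miss Y p4 <= 1 -> 2 < #|Y| -> cycle5 e (v |: H) p0 p1 p2 p3 p4.
Proof.
have [n1 n2 n3 n4] := notinY; have [up PH YH YP] := rt.
move=> t2 dYX e23 e12 e34 m1 m2 m3 m4 Y3.
have [|z [zY z3 z4]] := common2 n3 n4; first by move: m3 m4 Y3; clear; lia.
have [|y0 [y0Y y01 y02]] := common2 n1 n2; first by move: m1 m2 Y3; clear; lia.
have [E|y0z] := eqVneq y0 z; last by apply: (path_two y0Y zY) => //; rewrite e23.
have pick p : miss Y p <= 1 -> exists w, [/\ w \in Y, w \notin missed Y p & w != z].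
  move=> mp; have [|w [wY wp wz _]] := @avoid (missed Y p) [set z] set0 Y.
    by rewrite cards1 cards0; move: mp Y3; rewrite /miss; clear; lia.
  by exists w; split=> //; move: wz; rewrite inE.
have [y [yY yp1 yz]] := pick _ m1; have [y' [y'Y y'p2 y'z]] := pick _ m2.
have y1 := missedN yY n1 yp1; have y'2 := missedN y'Y n2 y'p2.
have [y2|y2] := boolP (e p2 y).
  by apply: (path_two yY zY) => //; rewrite e23.
have [/andP[y3 y4]|y34] := boolP (e p3 y && e p4 y).
  by apply: (path_two y0Y yY) => //; rewrite ?E 1?eq_sym // e23.
have yX : y \notin X by apply/negP=> yX; apply: disjointsE dYX yY yX.
(* Missing [p2] and one of [p3], [p4] already exhausts [t <= 2], so [y] sees all of [Y]. *)
have my q : q \in [:: p3; p4] -> ~~ e q y -> missed Y y = set0.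
  move=> qP qy; apply/eqP; rewrite -cards_eq0 -leqn0 -/(miss Y y).
  have qP' : q \in [:: p0; p1; p2; p3; p4].
    by move: qP; rewrite !inE => /orP[] /eqP->; rewrite eqxx ?orbT.
  have p2P : p2 \in [:: p0; p1; p2; p3; p4] by rewrite !inE eqxx !orbT.
  have := @miss_count Y y p2 q YH (subsetP YH _ yY) (PH _ p2P) (PH _ qP') n2.
  rewrite /bad (negPf yX) ![e y _]se y2 qy /= => H1.
  suff : miss Y y + 1 + 1 <= t by move: t2; clear; lia.
  apply: H1 => //; first exact: config_notin rt qP'.
  have := YP _ yY; rewrite /= !inE !negb_or => /and5P[_ _ -> y3 y4].
  move: up qP; rewrite /= !inE !negb_or => /and5P[_ _ /andP[p23 p24] _ _].
  by case/orP=> /eqP->; rewrite ?y3 ?y4 ?p23 ?p24.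
have m0 : missed Y y = set0.
  by move: y34; rewrite negb_and => /orP[y3|y4];
    [apply: my y3|apply: my y4]; rewrite !inE eqxx ?orbT.
have yy' : y != y' by apply: contraNneq y2 => ->.
have eyy' : e y y'.
  apply/negPn/negP=> ney; have : y' \in missed Y y by rewrite inE y'Y eq_sym yy' ney.
  by rewrite m0 inE.
apply: (@path_build [set y] [set y'] [set z]); rewrite ?sub1set ?disjoints1 ?inE //;
  try by move=> w /set1P->.
- by exists y, y'; rewrite !inE !eqxx !orbT.
- by exists p2, p3; rewrite !inE !eqxx.
by exists z, p4; rewrite !inE !eqxx orbT se.
Qed.

(** A helper [y] seen by [p2] is missed by [p3] and by one of [p4], [p0], so it has at most one
    non-neighbour left in [Y]. Then some neighbour [z] of [p3] in [Y] is adjacent to [y], and the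
    gap is bridged through [y] and [z]. *)
Lemma path_crossed : t <= 3 -> [disjoint Y & X] -> e p1 p2 -> e p3 p4 -> 3 < #|Y| ->
  miss Y p2 <= 2 -> miss Y p3 <= 2 ->
  (forall w, w \in Y -> e p2 w -> ~~ e p3 w) -> (forall w, w \in Y -> e p4 w -> ~~ e p0 w) ->
  cycle5 e (v |: H) p0 p1 p2 p3 p4.
Proof.
have [n1 n2 n3 n4] := notinY; have [up PH YH YP] := rt.
move=> t3' dYX e12 e34 Y4 m2 m3 no23 no40.
have [|y [yY y2 _ _]] := @avoid (missed Y p2) set0 set0 Y.
  by rewrite cards0 !addn0; move: m2 Y4; rewrite /miss; clear; lia.
have {}y2 := missedN yY n2 y2; have y3 := no23 _ yY y2.
have yX : y \notin X by apply/negP=> yX; apply: disjointsE dYX yY yX.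
have [q [qP qy]] : exists q, q \in [:: p4; p0] /\ ~~ e q y.
  by case y4: (e p4 y); [exists p0|exists p4]; rewrite ?no40 ?y4 // !inE eqxx ?orbT.
have my : miss Y y <= 1.
  have qP' : q \in [:: p0; p1; p2; p3; p4].
    by move: qP; rewrite !inE => /orP[] /eqP->; rewrite eqxx ?orbT.
  have p3P : p3 \in [:: p0; p1; p2; p3; p4] by rewrite !inE eqxx !orbT.
  have := @miss_count Y y p3 q YH (subsetP YH _ yY) (PH _ p3P) (PH _ qP') n3 (config_notin rt qP').
  rewrite /bad (negPf yX) ![e y _]se y3 qy /= => H1.
  suff : miss Y y + 1 + 1 <= t by move: t3'; clear; lia.
  apply: H1 => //.
  have := YP _ yY; rewrite /= !inE !negb_or => /and5P[y0 _ _ -> y4].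
  move: up qP; rewrite /= !inE !negb_or => /and5P[/and4P[_ _ p03 _] _ _ p34 _].
  by case/orP=> /eqP->; rewrite ?y0 ?y4 ?p34 1?eq_sym ?p03.
have [|z [zY z3 zy _]] := @avoid (missed Y p3) (missed Y y) set0 Y.
  by rewrite cards0; move: m3 my Y4; rewrite /miss; clear; lia.
have {}z3 := missedN zY n3 z3.
have zy' : z != y by apply: contraNneq y3 => <-.
have eyz : e y z by move: zy; rewrite inE zY zy' negbK.
apply: (@path_build set0 [set y] [set z]); rewrite ?sub1set ?sub0set ?setU0 ?disjoints1 ?inE //;
  try by [rewrite -setI_eq0 set0I|move=> w; rewrite inE|move=> w /set1P->].
- by rewrite eq_sym.
- by exists p1, p2; rewrite !inE !eqxx.
- by exists y, z; rewrite !inE !eqxx !orbT.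
by exists p3, p4; rewrite !inE !eqxx.
Qed.
Lemma path_one y : y \in Y -> e p1 p2 -> e p2 y -> e p3 y -> e p3 p4 ->
  cycle5 e (v |: H) p0 p1 p2 p3 p4.
Proof.
move=> yY e12 y2 y3 e34.
apply: (@path_build set0 [set y] set0); rewrite ?sub1set ?sub0set ?setU0 //;
  try by [rewrite -setI_eq0 set0I|rewrite disjoint_sym -setI_eq0 set0I|
          move=> w; rewrite inE|move=> w /set1P->].
- by exists p1, p2; rewrite !inE !eqxx.
- by exists y, p3; rewrite !inE !eqxx orbT se.
by exists p3, p4; rewrite !inE !eqxx.
Qed.

Lemma cycle_miss : [disjoint Y & X] ->
  [/\ miss Y p0 + bad p0 p4 + bad p0 p1 <= t, miss Y p1 + bad p1 p0 + bad p1 p2 <= t,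
      miss Y p2 + bad p2 p1 + bad p2 p3 <= t, miss Y p3 + bad p3 p2 + bad p3 p4 <= t &
      miss Y p4 + bad p4 p3 + bad p4 p0 <= t].
Proof.
move=> dYX; have [up PH YH YP] := rt.
have inP p : p \in [:: p0; p1; p2; p3; p4] -> p \in H /\ p \notin Y.
  by move=> pP; split; [apply: PH|apply: config_notin rt pP].
have [h0 h1 h2] : [/\ p0 \in H /\ p0 \notin Y, p1 \in H /\ p1 \notin Y & p2 \in H /\ p2 \notin Y].
  by split; apply: inP; rewrite !inE eqxx ?orbT.
have [h3 h4] : (p3 \in H /\ p3 \notin Y) /\ (p4 \in H /\ p4 \notin Y).
  by split; apply: inP; rewrite !inE eqxx ?orbT.
move: up; rewrite /= !inE !negb_or !andbT.
move=> /and4P[/and4P[n01 n02 n03 n04] /and3P[n12 n13 n14] /andP[n23 n24] n34].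
case: h0 h1 h2 h3 h4 => [? ?] [? ?] [? ?] [? ?] [? ?].
have n10 : p1 != p0 by rewrite eq_sym.
have n21 : p2 != p1 by rewrite eq_sym.
have n32 : p3 != p2 by rewrite eq_sym.
have n43 : p4 != p3 by rewrite eq_sym.
have n40 : p4 != p0 by rewrite eq_sym.
have n41 : p4 != p1 by rewrite eq_sym.
have n30 : p3 != p0 by rewrite eq_sym.
split; apply: miss_count => //; rewrite /= !inE negb_or ?andbT.
- by rewrite n04 n01 n41.
- by rewrite n10 n12 n02.
- by rewrite n21 n23 n13.
- by rewrite n32 n34 n24.
by rewrite n43 n40 n30.
Qed.

(** With [t = 0] a root outside [X] is adjacent to everything else in [H], which provides both edges
    at [p3]. *)
Lemma cycle_t0 : t = 0 -> 0 < #|Y| -> [disjoint Y & X] -> p3 \notin X ->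
  cycle5 e (v |: H) p0 p1 p2 p3 p4.
Proof.
move=> t0 Y0 dYX x3; have [_ m1 m2 m3 _] := cycle_miss dYX.
have [e32 e34] : e p3 p2 /\ e p3 p4.
  by move: m3; rewrite /bad t0 (negPf x3) /=; case: (e p3 p2); case: (e p3 p4); clear; lia.
apply: path_center2 => //; rewrite 1?[e p2 p3]se ?e32 //.
by apply/orP; right; move: m1 m2 Y0; rewrite t0; clear; lia.
Qed.

(** A missing path edge uses up part of the budget of both its ends, so more gaps come with more
    common helpers. The tight case is [t = 2] with only the middle edge present. *)
Lemma cycle_t12 : 0 < t -> t <= 2 -> t < #|Y| -> [disjoint Y & X] ->
  ~~ ((p1 \in X) && (p2 \in X)) -> ~~ ((p2 \in X) && (p3 \in X)) ->
  ~~ ((p3 \in X) && (p4 \in X)) -> cycle5 e (v |: H) p0 p1 p2 p3 p4.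
Proof.
move=> t0 t2 tY dYX x12 x23 x34; have [_ m1 m2 m3 m4] := cycle_miss dYX.
have {}m1 : miss Y p1 + ~~ e p1 p2 <= t by move: m1; rewrite /bad x12 andbT; clear; lia.
have {}m2 : miss Y p2 + ~~ e p1 p2 + ~~ e p2 p3 <= t.
  by move: m2; rewrite /bad [e p2 p1]se [(p2 \in X) && (p1 \in X)]andbC x12 x23 !andbT.
have {}m3 : miss Y p3 + ~~ e p2 p3 + ~~ e p3 p4 <= t.
  by move: m3; rewrite /bad [e p3 p2]se [(p3 \in X) && (p2 \in X)]andbC x23 x34 !andbT.
have {}m4 : miss Y p4 + ~~ e p3 p4 <= t.
  by move: m4; rewrite /bad [e p4 p3]se [(p4 \in X) && (p3 \in X)]andbC x34 andbT; clear; lia.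
have [E34|E34] := boolP (e p3 p4).
  apply: path_center2 => //; move: m1 m2 m3 t0 t2 tY; rewrite E34; clear;
    by case: (e p1 p2); case: (e p2 p3) => //=; lia.
have [E12|E12] := boolP (e p1 p2).
  apply: path_center3 => //; move: m2 m3 m4 t0 t2 tY; rewrite E12 (negPf E34); clear;
    by case: (e p2 p3) => //=; lia.
have [E23|E23] := boolP (e p2 p3); last first.
  by apply: path_full; move: m1 m2 m3 m4 t0 t2 tY;
    rewrite (negPf E12) (negPf E23) (negPf E34) /=; clear; lia.
have [t1|t1] := leqP t 1.
  by apply: path_apart => //; move: m1 m2 m3 m4 t1 t0 tY;
    rewrite (negPf E12) E23 (negPf E34) /=; clear; lia.
by apply: path_apart2 => //; move: m1 m2 m3 m4 t2 t1 tY;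
  rewrite (negPf E12) E23 (negPf E34) /=; clear; lia.
Qed.

Hypotheses (dYX : [disjoint Y & X]) (Y4 : 3 < #|Y|) (t3' : t <= 3).
Hypothesis noXX : {in [:: p0; p1; p2; p3; p4] &, forall p q, p != q -> ~~ ((p \in X) && (q \in X))}.

Let miss3 : [/\ miss Y p0 + ~~ e p4 p0 + ~~ e p0 p1 <= 3, miss Y p1 + ~~ e p0 p1 + ~~ e p1 p2 <= 3,
      miss Y p2 + ~~ e p1 p2 + ~~ e p2 p3 <= 3, miss Y p3 + ~~ e p2 p3 + ~~ e p3 p4 <= 3 &
      miss Y p4 + ~~ e p3 p4 + ~~ e p4 p0 <= 3].
Proof.
have [up _ _ _] := rt; move: up; rewrite /= !inE !negb_or !andbT.
move=> /and4P[/and4P[n01 n02 n03 n04] /and3P[n12 n13 n14] /andP[n23 n24] n34].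
have nX p q : p \in [:: p0; p1; p2; p3; p4] -> q \in [:: p0; p1; p2; p3; p4] -> p != q ->
    bad p q = ~~ e p q /\ bad q p = ~~ e p q.
  move=> pP qP pq; rewrite /bad (noXX pP qP pq) [_ && (p \in X)]andbC (noXX pP qP pq).
  by rewrite !andbT [e q p]se.
have [i0 i1 i2 i3 i4] : [/\ p0 \in [:: p0; p1; p2; p3; p4], p1 \in [:: p0; p1; p2; p3; p4],
    p2 \in [:: p0; p1; p2; p3; p4], p3 \in [:: p0; p1; p2; p3; p4] & p4 \in [:: p0; p1; p2; p3; p4]].
  by rewrite !inE !eqxx !orbT.
have [b01 b10] := nX _ _ i0 i1 n01; have [b12 b21] := nX _ _ i1 i2 n12.
have [b23 b32] := nX _ _ i2 i3 n23; have [b34 b43] := nX _ _ i3 i4 n34.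
have [b04 b40] := nX _ _ i0 i4 n04.
have := cycle_miss dYX; rewrite b01 b10 b12 b21 b23 b32 b34 b43 b04 b40 [e p0 p4]se => -[m0 m1 m2 m3 m4].
by split; apply: leq_trans t3'.
Qed.

Lemma cycle_t3_near : e p3 p4 && (e p1 p2 && e p2 p3 || ~~ e p1 p2 && ~~ e p2 p3 ||
   [&& ~~ e p1 p2, e p2 p3 & ~~ e p0 p1]) -> cycle5 e (v |: H) p0 p1 p2 p3 p4.
Proof.
move=> /andP[E34 E]; have [_ m1 m2 m3 _] := miss3.
by apply: path_center2 => //; move: E m1 m2 m3 Y4; rewrite E34; clear;
  case: (e p0 p1); case: (e p1 p2); case: (e p2 p3) => //=; lia.
Qed.

Lemma cycle_t3_none : [&& ~~ e p0 p1, ~~ e p1 p2, ~~ e p2 p3, ~~ e p3 p4 & ~~ e p4 p0] ->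
  cycle5 e (v |: H) p0 p1 p2 p3 p4.
Proof.
move=> /and5P[E01 E12 E23 E34 E40]; have [_ m1 m2 m3 m4] := miss3.
by apply: path_full; move: m1 m2 m3 m4 Y4; rewrite E01 E12 E23 E34 E40; clear; lia.
Qed.

(** Here [v] closes the gap between [p4] and [p0]. A common neighbour of [p2] and [p3] closes the
    other one; if there is none, the two gaps are crossed. *)
Lemma cycle_t3_cross : [&& e p0 p1, e p1 p2, ~~ e p2 p3, e p3 p4 & ~~ e p4 p0] ->
  (forall w, w \in Y -> e p4 w -> ~~ e p0 w) -> cycle5 e (v |: H) p0 p1 p2 p3 p4.
Proof.
move=> /and5P[E01 E12 E23 E34 E40] no; have [_ m1 m2 m3 m4] := miss3.
have [/existsP[y /and3P[yY y2 y3]]|] := boolP [exists y, [&& y \in Y, e p2 y & e p3 y]].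
  exact: path_one yY E12 y2 y3 E34.
rewrite negb_exists => /forallP no2; apply: path_crossed => //.
- by move: m2; rewrite E12 E23; clear; lia.
- by move: m3; rewrite E34 E23; clear; lia.
by move=> w wY w2; have := no2 w; rewrite wY w2.
Qed.
End Cycle.

Lemma config_rot (P Q : seq T) Y k : config P Y -> Q = rot k P -> config Q Y.
Proof.
case=> uP PH YH YP ->; split=> //; first by rewrite rot_uniq.
  by move=> p; rewrite mem_rot; apply: PH.
by move=> y /YP; rewrite mem_rot.
Qed.

Lemma count_sub (P : seq T) Z : uniq P -> {subset P <= H} -> count (mem Z) P <= #|Z :&: H|.
Proof.
move=> uP PH; rewrite -size_filter -(card_uniqP (filter_uniq (mem Z) uP)).
by apply: subset_leq_card; apply/subsetP=> p; rewrite mem_filter in_setI /= => /andP[-> /PH].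
Qed.

Lemma dense_clique p0 p1 p2 p3 : uniq [:: p0; p1; p2; p3] ->
  {subset [:: p0; p1; p2; p3] <= H} -> clique4 e (v |: H) p0 p1 p2 p3.
Proof.
have main q0 q1 q2 q3 : uniq [:: q0; q1; q2; q3] -> {subset [:: q0; q1; q2; q3] <= H} ->
    (q0 \in X) || ~~ [|| q1 \in X, q2 \in X | q3 \in X] -> clique4 e (v |: H) q0 q1 q2 q3.
  move=> uq qH q0X; pose P := [:: q0; q1; q2; q3].
  pose Y0 := H :\: [set p in P].
  (* Non-edges inside [X] are not bounded, so helpers must avoid [X] as soon as a root that needs
     them lies in [X]. *)
  pose Y := if [|| q1 \in X, q2 \in X | q3 \in X] then Y0 :\: X else Y0.
  have YY0 : Y \subset Y0 by rewrite /Y; case: ifP => // _; apply: subsetDl.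
  have YH : Y \subset H by apply: subset_trans YY0 (subsetDl _ _).
  have rt : config P Y.
    by split=> // y /(subsetP YY0); rewrite !inE => /andP[].
  have rt_perm Q : perm_eq Q P -> config Q Y.
    case: rt => u1 u2 u3 u4 pe; split=> //; first by rewrite (perm_uniq pe).
      by move=> q; rewrite (perm_mem pe); apply: u2.
    by move=> y /u4; rewrite (perm_mem pe).
  have rt2 : config [:: q0; q2; q1; q3] Y by apply: rt_perm; apply/permP=> Q /=; clear; lia.
  have rt3 : config [:: q0; q3; q1; q2] Y by apply: rt_perm; apply/permP=> Q /=; clear; lia.
  have cnt_mem a b c : uniq [:: a; b; c] -> {subset [:: a; b; c] <= [:: q1; q2; q3]} ->
      miss Y a + bad a b + bad a c <= t.
    move=> uabc sub.
    have inP p : p \in [:: q1; q2; q3] -> p \in H /\ p \notin Y.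
      move=> pq; have pP : p \in P by rewrite inE pq orbT.
      by split; [apply: qH|apply: (config_notin rt)].
    have [[aH aY] [bH bY]] : (a \in H /\ a \notin Y) /\ (b \in H /\ b \notin Y).
      by split; apply: inP; apply: sub; rewrite !inE eqxx ?orbT.
    have [cH cY] : c \in H /\ c \notin Y by apply: inP; apply: sub; rewrite !inE eqxx ?orbT.
    apply: miss_count => // aX; have := sub a; rewrite !inE eqxx /= => /(_ isT) aq.
    rewrite /Y; case: ifP => [_|/negP[]].
      by apply/disjointsP=> y; rewrite in_setD => /andP[/negPf->].
    by case/or3P: aq => /eqP<-; rewrite aX ?orbT.
  have u3 : uniq [:: q1; q2; q3] by move: uq; rewrite cons_uniq => /andP[].
  have m1 := cnt_mem q1 q2 q3 u3 (fun _ => id).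
  have m2 : miss Y q2 + bad q2 q1 + bad q2 q3 <= t.
    apply: cnt_mem; last by move=> p; rewrite !inE orbCA.
    by move: u3; rewrite /= !inE !negb_or !andbT eq_sym => /andP[/andP[-> ->] ->].
  have m3 : miss Y q3 + bad q3 q1 + bad q3 q2 <= t.
    apply: cnt_mem; last by move=> p; rewrite !inE orbCA [X in _ || X]orbC.
    by move: u3; rewrite /= !inE !negb_or !andbT ![q3 == _]eq_sym => /andP[/andP[-> ->] ->].
  have cP : #|[set p in P]| = 4 by rewrite cardsE (card_uniqP uq).
  have PH : [set p in P] \subset H by apply/subsetP=> p; rewrite inE; apply: qH.
  have cY0 : #|Y0| + 4 = #|H| by rewrite cardsDS // cP subnK // -cP subset_leq_card.
  have cXP : #|Y0 :&: X| + count (mem X) P <= #|X :&: H|.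
    have <- : #|[set x in filter (mem X) P]| = count (mem X) P.
      by rewrite cardsE (card_uniqP (filter_uniq (mem X) uq)) size_filter.
    rewrite -cardsUI (_ : _ :&: [set x in filter _ _] = set0) ?cards0 ?addn0.
      apply: subset_leq_card; apply/subsetP=> p; rewrite !in_setU !in_setI in_setD !in_set mem_filter /=.
      by case/orP=> [/andP[/andP[_ ->] ->]//|/andP[-> /qH ->]].
    apply/setP=> p; rewrite in_set0 !in_setI in_setD !in_set mem_filter /=.
    by case: (p \in X); case: (p \in P); rewrite /= ?andbF.
  have cY : #|Y| + (if [|| q1 \in X, q2 \in X | q3 \in X] then #|Y0 :&: X| else 0) = #|Y0|.
    rewrite /Y; case: ifP => _; last by rewrite addn0.
    by rewrite cardsD subnK // subset_leq_card // subsetIl.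
  move: m1 m2 m3 cXP cY q0X; rewrite /bad /= ![e q2 q1]se ![e q3 _]se !addn0.
  have [tr1 tf] := (@triangle_center q0 q1 q2 q3 Y rt, @triangle_full q0 q1 q2 q3 Y rt).
  have tr2 := @triangle_center q0 q2 q1 q3 Y rt2; have tr3 := @triangle_center q0 q3 q1 q2 Y rt3.
  rewrite [e q2 q1]se in tr2; rewrite ![e q3 _]se in tr3.
  move=> m1 m2 m3 cXP cY q0X.
  (* |Y0| >= t + 2. If some of [q1], [q2], [q3] lie in [X], so does [q0], and then discarding the
     remaining vertices of [X], at most 4 - t minus the roots in [X], keeps [Y] large. *)
  have bound : if [|| q1 \in X, q2 \in X | q3 \in X] then
     (2 * t + (q1 \in X) + (q2 \in X) + (q3 \in X) <= #|Y|.+1) &&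
     (t + (q1 \in X) + (q2 \in X) + (q3 \in X) <= 3) else t + 2 <= #|Y|.
    move: cXP cY q0X cY0 H6 XH; clear; case: (q1 \in X); case: (q2 \in X); case: (q3 \in X);
      rewrite ?orbF /=; try (move=> + + ->); rewrite /=; lia.
  have [E23|E23] := boolP (e q2 q3); last have [E13|E13] := boolP (e q1 q3);
    last have [E12|E12] := boolP (e q1 q2).
  - apply: tr1 => //; move: m1 m2 m3 bound t3; rewrite E23; clear;
      case: (e q1 q2); case: (e q1 q3) => //=;
      case: (q1 \in X); case: (q2 \in X); case: (q3 \in X) => /=; lia.
  - apply: clique4_swap12; apply: tr2 => //; move: m1 m2 m3 bound t3; rewrite (negPf E23) E13; clear;
      case: (e q1 q2) => //=;
      case: (q1 \in X); case: (q2 \in X); case: (q3 \in X) => /=; lia.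
  - apply: clique4_swap23; apply: clique4_swap12; apply: tr3 => //;
      move: m1 m2 m3 bound t3; rewrite (negPf E23) (negPf E13) E12; clear;
      case: (q1 \in X); case: (q2 \in X); case: (q3 \in X) => /=; lia.
  apply: tf; move: m1 m2 m3 bound t3; rewrite (negPf E23) (negPf E13) (negPf E12); clear;
    case: (q1 \in X); case: (q2 \in X); case: (q3 \in X) => /=; lia.
move=> up pH.
have rots k : uniq (rot k [:: p0; p1; p2; p3]) /\ {subset rot k [:: p0; p1; p2; p3] <= H}.
  by rewrite rot_uniq; split=> // x; rewrite mem_rot; apply: pH.
have [x0|x0] := boolP (p0 \in X); first by apply: main; rewrite ?x0.
have [x1|x1] := boolP (p1 \in X).
  by have [u s] := rots 1; do 3!apply: (clique4_rot se); apply: main; rewrite ?x1.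
have [x2|x2] := boolP (p2 \in X).
  by have [u s] := rots 2; do 2!apply: (clique4_rot se); apply: main; rewrite ?x2.
have [x3|x3] := boolP (p3 \in X).
  by have [u s] := rots 3; apply: (clique4_rot se); apply: main; rewrite ?x3.
by apply: main; rewrite // (negPf x1) (negPf x2) (negPf x3) orbT.
Qed.
(** All vertices of [X] in [H] are roots, so the helpers avoid [X] and their non-neighbours are all
    counted. The cases follow [t]: larger [t] means fewer roots in [X] and more helpers. *)
Lemma dense_cycle p0 p1 p2 p3 p4 : uniq [:: p0; p1; p2; p3; p4] ->
  {subset [:: p0; p1; p2; p3; p4] <= H} ->
  (forall x, x \in X -> x \in H -> x \in [:: p0; p1; p2; p3; p4]) ->
  cycle5 e (v |: H) p0 p1 p2 p3 p4.
Proof.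
move=> up PH XP; pose P := [:: p0; p1; p2; p3; p4].
pose Y := H :\: [set p in P].
have YH : Y \subset H by apply: subsetDl.
have rt : config P Y by split=> // y; rewrite in_setD in_set => /andP[].
have dYX : [disjoint Y & X].
  apply/disjointsP=> y; rewrite in_setD in_set => /andP[/negP yP yH] yX.
  by apply: yP; apply: XP.
have tY : t < #|Y|.
  have cP : #|[set p in P]| = 5 by rewrite cardsE (card_uniqP up).
  rewrite cardsDS; first by rewrite cP; move: H6; clear; lia.
  by apply/subsetP=> p; rewrite in_set; apply: PH.
have cX : count (mem X) P + t <= 4.
  by apply: leq_trans XH; rewrite leq_add2r; apply: count_sub.
have rt1 : config [:: p1; p2; p3; p4; p0] Y by apply: (config_rot (k := 1) rt).
have rt2 : config [:: p2; p3; p4; p0; p1] Y by apply: (config_rot (k := 2) rt).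
have rt3 : config [:: p3; p4; p0; p1; p2] Y by apply: (config_rot (k := 3) rt).
have rt4 : config [:: p4; p0; p1; p2; p3] Y by apply: (config_rot (k := 4) rt).
have [t0|t0] := posnP t.
  have : [|| p3 \notin X, p4 \notin X, p0 \notin X, p1 \notin X | p2 \notin X].
    move: cX; rewrite t0 /=; move: (p0 \in X) (p1 \in X) (p2 \in X) (p3 \in X) (p4 \in X).
    by do 5!case.
  have Y0 : 0 < #|Y| by apply: leq_ltn_trans tY.
  case/or4P=> [x|x|x|/orP[x|x]].
  - exact: cycle_t0 rt t0 Y0 dYX x.
  - do 4!apply: cycle5_rot; exact: cycle_t0 rt1 t0 Y0 dYX x.
  - do 3!apply: cycle5_rot; exact: cycle_t0 rt2 t0 Y0 dYX x.
  - do 2!apply: cycle5_rot; exact: cycle_t0 rt3 t0 Y0 dYX x.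
  apply: cycle5_rot; exact: cycle_t0 rt4 t0 Y0 dYX x.
have [t2|t2] := leqP t 2.
  pose ok a b c d := [&& ~~ ((a \in X) && (b \in X)), ~~ ((b \in X) && (c \in X)) &
                         ~~ ((c \in X) && (d \in X))].
  have : [|| ok p1 p2 p3 p4, ok p2 p3 p4 p0, ok p3 p4 p0 p1, ok p4 p0 p1 p2 | ok p0 p1 p2 p3].
    have : count (mem X) P <= 3 by move: cX t0; clear; lia.
    rewrite /ok /=; move: (p0 \in X) (p1 \in X) (p2 \in X) (p3 \in X) (p4 \in X).
    by do 5!case.
  case/or4P=> [x|x|x|/orP[x|x]]; case/and3P: x => x1 x2 x3.
  - exact: cycle_t12 rt t0 t2 tY dYX x1 x2 x3.
  - do 4!apply: cycle5_rot; exact: cycle_t12 rt1 t0 t2 tY dYX x1 x2 x3.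
  - do 3!apply: cycle5_rot; exact: cycle_t12 rt2 t0 t2 tY dYX x1 x2 x3.
  - do 2!apply: cycle5_rot; exact: cycle_t12 rt3 t0 t2 tY dYX x1 x2 x3.
  apply: cycle5_rot; exact: cycle_t12 rt4 t0 t2 tY dYX x1 x2 x3.
(* Now [t = 3], so at most one root lies in [X] and every missing cycle edge counts against the
   budget. *)
have Y4 : 3 < #|Y| by apply: leq_ltn_trans tY.
pose noXX (Q : seq T) := {in Q &, forall p q, p != q -> ~~ ((p \in X) && (q \in X))}.
have nx0 : noXX P.
  move=> p q pP qP pq; apply/negP=> /andP[pX qX].
  have : #|[set p; q]| <= #|X :&: H|.
    by apply: subset_leq_card; apply/subsetP=> w /set2P[]->; rewrite in_setI ?pX ?qX PH.
  by rewrite cards2 pq; move: XH t2; clear; lia.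
have nx k : noXX (rot k P) by move=> p q; rewrite !mem_rot; apply: nx0.
have [nx1 nx2] : noXX [:: p1; p2; p3; p4; p0] /\ noXX [:: p2; p3; p4; p0; p1] := conj (nx 1) (nx 2).
have [nx3 nx4] : noXX [:: p3; p4; p0; p1; p2] /\ noXX [:: p4; p0; p1; p2; p3] := conj (nx 3) (nx 4).
pose near a b c d := d && (b && c || ~~ b && ~~ c || [&& ~~ b, c & ~~ a]).
have nearP q0 q1 q2 q3 q4 : config [:: q0; q1; q2; q3; q4] Y -> noXX [:: q0; q1; q2; q3; q4] ->
    near (e q0 q1) (e q1 q2) (e q2 q3) (e q3 q4) -> cycle5 e (v |: H) q0 q1 q2 q3 q4.
  by move=> c n; apply: cycle_t3_near c dYX Y4 t3 n.
pose cross a b c d f := [&& a, b, ~~ c, d & ~~ f].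
have crossP q0 q1 q2 q3 q4 : config [:: q0; q1; q2; q3; q4] Y -> noXX [:: q0; q1; q2; q3; q4] ->
    cross (e q0 q1) (e q1 q2) (e q2 q3) (e q3 q4) (e q4 q0) -> cycle5 e (v |: H) q0 q1 q2 q3 q4.
  move=> c n E; have /and5P[E01 E12 E23 E34 E40] := E.
  have c2 : config [:: q2; q3; q4; q0; q1] Y by apply: (config_rot (k := 2) c).
  have [/existsP[y /and3P[yY y4 y0]]|] := boolP [exists y, [&& y \in Y, e q4 y & e q0 y]].
    by do 3!apply: cycle5_rot; apply: (path_one c2 yY).
  rewrite negb_exists => /forallP no; apply: (cycle_t3_cross c dYX Y4 t3 n E) => w wY w4.
  by have := no w; rewrite wY w4.
(* Every pattern of present and missing cycle edges is, after rotation, a [near] or [cross] pattern,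
   or has no edge at all. *)
have : [|| near (e p0 p1) (e p1 p2) (e p2 p3) (e p3 p4), near (e p1 p2) (e p2 p3) (e p3 p4) (e p4 p0),
        near (e p2 p3) (e p3 p4) (e p4 p0) (e p0 p1) | near (e p3 p4) (e p4 p0) (e p0 p1) (e p1 p2)]
    || [|| near (e p4 p0) (e p0 p1) (e p1 p2) (e p2 p3),
        [&& ~~ e p0 p1, ~~ e p1 p2, ~~ e p2 p3, ~~ e p3 p4 & ~~ e p4 p0],
        cross (e p0 p1) (e p1 p2) (e p2 p3) (e p3 p4) (e p4 p0) |
        cross (e p1 p2) (e p2 p3) (e p3 p4) (e p4 p0) (e p0 p1)]
    || [|| cross (e p2 p3) (e p3 p4) (e p4 p0) (e p0 p1) (e p1 p2),
        cross (e p3 p4) (e p4 p0) (e p0 p1) (e p1 p2) (e p2 p3) |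
        cross (e p4 p0) (e p0 p1) (e p1 p2) (e p2 p3) (e p3 p4)].
  rewrite /near /cross; move: (e p0 p1) (e p1 p2) (e p2 p3) (e p3 p4) (e p4 p0).
  by do 5!case.
case/orP=> [/orP[/or4P[]|/or4P[]]|/or3P[]] E.
- exact: nearP rt nx0 E.
- do 4!apply: cycle5_rot; exact: nearP rt1 nx1 E.
- do 3!apply: cycle5_rot; exact: nearP rt2 nx2 E.
- do 2!apply: cycle5_rot; exact: nearP rt3 nx3 E.
- apply: cycle5_rot; exact: nearP rt4 nx4 E.
- exact: cycle_t3_none rt dYX Y4 t3 nx0 E.
- exact: crossP rt nx0 E.
- do 4!apply: cycle5_rot; exact: crossP rt1 nx1 E.
- do 3!apply: cycle5_rot; exact: crossP rt2 nx2 E.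
- do 2!apply: cycle5_rot; exact: crossP rt3 nx3 E.
apply: cycle5_rot; exact: crossP rt4 nx4 E.
Qed.

Lemma dense_linked n (r : 'I_n -> T) : n <= 5 -> injective r -> (forall i, r i \in H) ->
  (n = 5 -> forall x, x \in X -> x \in H -> exists i, r i = x) -> rminor e (v |: H) r.
Proof.
move=> n5 ri rH onto; have [n4|n4] := leqP n 4.
  apply: (rminor_clique4 se _ dense_clique n4 ri rH).
  by apply: leq_trans H6; rewrite addnC.
have E : n = 5 by move: n4 n5; clear; lia.
subst n; apply: cycle5_rminor; apply: dense_cycle.
- by apply: uniq_o5.
- by move=> x; rewrite !inE; do !case/orP; move/eqP->.
move=> x xX xH; have [i <-] := onto erefl x xX xH.
have -> : i = o5 i by apply: val_inj; rewrite /= inordK.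
by case: i => [[|[|[|[|[|//]]]]] lt] /=; rewrite !inE eqxx ?orbT.
Qed.
End Dense.

(** * The minimal counterexample *)

Section Massed.
Variables (T : finType).
Implicit Types (e : rel T) (A B U V W X Y Z S K H : {set T}).

(** [cnt] counts ordered pairs, so the factor 10 stands for five edges per vertex. *)
Definition massed e W X :=
  [/\ X \subset W, #|X| <= 5, 10 * #|W :\: X| < cnt e W (W :\: X) &
      forall U, U \subset W :\: X -> #|NU e W U| < #|X| -> cnt e W U <= 10 * #|U|].

(* Two adjacent vertices joined to five independent roots are too few for a
   C_5-minor, and sparse pieces attached to at most four vertices do not help. *)
Definition exceptional e W X :=
  [/\ #|X| = 5, cnt e W (W :\: X) <= 10 * #|W :\: X| + 2 &
      exists y z, full_pair e W X y z].

Lemma NU_closed e W U U' : U' \subset U -> U \subset W ->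
  NU e (U :|: NU e W U) U' = NU e W U'.
Proof.
move=> /subsetP sU /subsetP UW; apply/setP=> w.
apply/NUP/NUP => -[u [wW wU uU uw]]; exists u; split=> //.
  by case/setUP: wW => [/UW//|/NUP[? []]].
rewrite in_setU; case wU' : (w \in U) => //=; apply/NUP; exists u; split=> //.
  by rewrite wU'.
exact: sU.
Qed.

Lemma cnt_closed e W U U' : symmetric e -> U' \subset U -> U \subset W ->
  cnt e (U :|: NU e W U) U' = cnt e W U'.
Proof.
move=> se /subsetP sU /subsetP UW; apply: cnt_local => // a b aU.
have aU' := sU _ aU; rewrite in_setU aU' UW //=; case ab: (e a b); rewrite ?andbF //.
rewrite in_setU; case bU: (b \in U) => /=; first by rewrite UW.
rewrite !andbT; apply/NUP/idP => [[u []]//|bW]; exists a; split=> //.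
by rewrite bU.
Qed.

Lemma massed_piece e W U : symmetric e -> U \subset W -> #|NU e W U| <= 5 ->
  10 * #|U| < cnt e W U ->
  (forall U', U' \subset U -> #|NU e W U'| < #|NU e W U| -> cnt e W U' <= 10 * #|U'|) ->
  massed e (U :|: NU e W U) (NU e W U).
Proof.
move=> se UW N5 cU H.
have E : (U :|: NU e W U) :\: NU e W U = U.
  apply/setP=> w; rewrite in_setD in_setU; case wU: (w \in U); rewrite ?andbT /=.
    by apply/NUP=> -[u []]; rewrite wU.
  by case: (w \in NU e W U).
split; rewrite ?E //; first exact: subsetUr.
  by rewrite cnt_closed.
by move=> U' sU; rewrite NU_closed // cnt_closed // => /H; apply.
Qed.

Lemma cnt_ub e W S : symmetric e -> irreflexive e -> S \subset W ->
  cnt e W S <= #|S| * (#|W|.-1 + #|W :\: S|).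
Proof.
move=> se ie SW; rewrite cnt_sum // -sum_nat_const; apply: leq_sum => a aS.
have aW := subsetP SW _ aS; apply: leq_add.
  rewrite (cardsD1 a W) aW /=; apply: subset_leq_card; apply/subsetP=> w.
  by rewrite !inE => /andP[-> aw]; rewrite andbT; apply: contraTneq aw => ->; rewrite ie.
by apply: subset_leq_card; apply/subsetP=> w; rewrite !inE => /and3P[-> ->].
Qed.

(** By [full_pair_linked] such a [K] sees at most two roots; being a component of the rest, it can
    otherwise see only [y] and [z]. Four boundary vertices are fewer than |X|, so [K] is sparse. *)
Lemma full_pair_comps e W X y z : symmetric e -> irreflexive e -> massed e W X ->
  #|X| = 5 -> full_pair e W X y z -> ~ linked e W X ->
  forall K, K \subset W :\: X :\: [set y; z] -> connected_in e K ->
    [disjoint NU e W K & W :\: X :\: [set y; z]] ->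
  #|NU e W K| <= 4 /\ cnt e W K <= 10 * #|K|.
Proof.
move=> se ie [XW X5 m1 m2] X5' fp nl K KU cK dK.
have N4 : #|NU e W K| <= 4.
  rewrite leqNgt; apply/negP=> N5; apply: nl.
  apply: (full_pair_linked se ie XW fp KU cK X5').
  have sub : NU e W K \subset (X :&: NU e W K) :|: [set y; z].
    apply/subsetP=> w wN; rewrite in_setU in_setI wN andbT.
    have := disjointsE dK wN; rewrite !in_setD.
    have -> : w \in W by case/NUP: wN => u [].
    by case: (w \in X) => //=; case: (w \in _) => //= /(_ isT).
  have := leq_trans (subset_leq_card sub) (leq_card_setU _ _).
  by move: N5; rewrite cards2; case: (y != z); clear; lia.
split=> //; apply: m2; last by rewrite X5'.
by apply: subset_trans KU (subsetDl _ _).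
Qed.

(** The 22 ordered pairs are the eleven possible edges at [y] and [z]: ten to the roots and the one
    joining them. *)
Lemma cnt_full_pair e W X y z : symmetric e -> irreflexive e -> X \subset W -> #|X| = 5 ->
  full_pair e W X y z ->
  cnt e W (W :\: X) <= cnt e W (W :\: X :\: [set y; z]) + 22 /\
  #|W :\: X| = #|W :\: X :\: [set y; z]| + 2.
Proof.
move=> se ie XW X5 [yY zY yz _]; set Y := W :\: X.
have yzn : y != z by apply: contraTneq yz => ->; rewrite ie.
have sub : [set y; z] \subset Y by rewrite subUset !sub1set yY.
split; last first.
  by rewrite cardsDS // cards2 yzn subnK // -[2]/(true.+1) -yzn -cards2 subset_leq_card.
rewrite (cntD e W (S1 := Y :\: [set y; z]) (subsetDl _ _)) leq_add2l.
have E1 : Y :\: (Y :\: [set y; z]) = [set y; z] by rewrite setDDr setDv set0U (setIidPr sub).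
have E2 : W :\: (Y :\: [set y; z]) = X :|: [set y; z].
  apply/setP=> w; rewrite in_setD in_setU [w \in _ :\: _]in_setD.
  have := subsetP sub w; have := subsetP XW w; rewrite /Y in_setD.
  case: (w \in X) => /= [->//|]; first by rewrite andbF.
  by case: (w \in [set y; z]) => //= _; [move=> ->|case: (w \in W)].
rewrite E1 E2; apply: leq_trans (cnt_ub se ie (subsetUr _ _)) _.
have -> : (X :|: [set y; z]) :\: [set y; z] = X.
  rewrite setDUl setDv setU0; apply/setDidPl/disjointsP=> w wX /(subsetP sub).
  by rewrite in_setD wX.
rewrite X5 cards2 yzn.
suff : #|X :|: [set y; z]| <= 7 by clear; lia.
by apply: leq_trans (leq_card_setU _ _) _; rewrite X5 cards2 yzn.
Qed.

(** The rest is sparse by components, and 22 = 10 * 2 + 2 is exactly the surplus allowed in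
    [exceptional]. *)
Lemma no_full_pair e W X y z : symmetric e -> irreflexive e -> massed e W X ->
  ~ linked e W X -> ~ exceptional e W X -> #|X| = 5 -> ~ full_pair e W X y z.
Proof.
move=> se ie mass nl nex X5 fp; apply: nex; split=> //; last by exists y, z.
have [XW _ m1 m2] := mass.
have [c1 c2] := cnt_full_pair se ie XW X5 fp; rewrite c2.
suff : cnt e W (W :\: X :\: [set y; z]) <= 10 * #|W :\: X :\: [set y; z]|.
  by move: c1; clear; lia.
apply: cnt_comps => //.
  by apply: subset_trans (subsetDl _ _) (subsetDl _ _).
by move=> K KU cK dK; have [] := full_pair_comps se ie mass X5 fp nl KU cK dK.
Qed.

Definition add_clique e Z : rel T := [rel a b | e a b || [&& a != b, a \in Z & b \in Z]].

(** As [Z] has at most four vertices, its pattern is complete: the deleted part [D] provides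
    pairwise adjacent branch sets around [Z], which realise the added clique edges. *)
Lemma clique_model e D Z V : symmetric e -> linked e (D :|: Z) Z -> #|Z| <= 4 ->
  [disjoint D & V] ->
  exists2 h, model V (add_clique e Z) e (V :|: D) h & forall a, a \in h a.
Proof.
move=> se L Z4 dDV.
have [|||g [cg dg ag] rg] := L #|Z| (@enum_val _ (mem Z)).
- exact: leq_trans Z4 _.
- exact: enum_val_inj.
- by move=> i; apply: enum_valP.
pose idx x := [pick i | @enum_val _ (mem Z) i == x].
pose h x := if idx x is Some i then g i else [set x].
have hP x : (exists2 i, enum_val i = x & h x = g i /\ x \in Z) \/ (h x = [set x] /\ x \notin Z).
  rewrite /h /idx; case: pickP => [i /eqP E|none].
    by left; exists i => //; rewrite -E; split=> //; apply: enum_valP.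
  right; split=> //; apply/negP=> xZ; have := none (enum_rank_in xZ x).
  by rewrite enum_rankK_in // eqxx.
have gZ i b : b \in g i -> b \in D \/ b = enum_val i.
  move=> bi; have [_ /subsetP sub] := cg i (in_setT _); case/setUP: (sub _ bi) => [|bZ]; first by left.
  right; case: (hP b) => [[j Ej _]|[_]]; last by rewrite bZ.
  rewrite -Ej; congr enum_val; apply/eqP/negPn/negP=> ji.
  by apply: (disjointsE (dg _ _ (in_setT j) (in_setT i) ji) _ bi); rewrite -Ej.
have ah x : x \in h x.
  by case: (hP x) => [[i Ei [-> _]]|[-> _]]; [rewrite -Ei|rewrite inE].
exists h => //; split=> [a aV|a b aV bV ab|a b aV bV].
- case: (hP a) => [[i Ei [-> _]]|[-> _]]; last by split; [apply: conn1|rewrite sub1set inE aV].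
  split; first by have [] := cg i (in_setT _).
  apply/subsetP=> b /gZ[bD|->]; first by rewrite inE bD orbT.
  by rewrite Ei inE aV.
- case: (hP a) => [[i Ei [-> aZ]]|[-> aZ]]; case: (hP b) => [[j Ej [-> bZ]]|[-> bZ]].
  + by apply: dg; rewrite ?inE //; apply: contra ab => /eqP E; rewrite -Ei -Ej E.
  + rewrite disjoint_sym disjoints1; apply/negP=> /gZ[bD|E].
      exact: disjointsE dDV bD bV.
    by rewrite E Ei eqxx in ab.
  + rewrite disjoints1; apply/negP=> /gZ[bD|E].
      exact: disjointsE dDV bD aV.
    by rewrite E Ej eqxx in ab.
  by rewrite disjoints1 inE.
case/orP=> [ab|/and3P[ab aZ bZ]]; first by exists a, b.
case: (hP a) => [[i Ei [-> _]]|[_]]; last by rewrite aZ.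
case: (hP b) => [[j Ej [-> _]]|[_]]; last by rewrite bZ.
apply: ag; rewrite ?inE // /pattern Z4; apply: contra ab => /eqP E.
by rewrite -Ei -Ej E.
Qed.

Lemma linked_comp e1 V1 e V X (h : T -> {set T}) : symmetric e ->
  model V1 e1 e V h -> {in X, forall a, a \in h a} -> linked e1 V1 X -> linked e V X.
Proof.
move=> se mh ah L n r n5 ri rX; apply: (rminor_comp se mh _ (L n r n5 ri rX)) => i.
exact: ah.
Qed.

Lemma cnt_add2 e1 e2 W U a b : irreflexive e2 -> symmetric e1 -> symmetric e2 -> subrel e1 e2 ->
  a \in W -> b \in W -> e2 a b -> ~~ e1 a b -> (a \in U) || (b \in U) ->
  cnt e1 W U + 2 <= cnt e2 W U.
Proof.
move=> i2 s1 s2 s12 aW bW ab2 ab1 abU.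
have abn : a != b by apply: contraTneq ab2 => ->; rewrite i2.
have abn' : (a, b) != (b, a) by apply: contra abn => /eqP[->].
have -> : 2 = #|[set (a, b); (b, a)]| by rewrite cards2 abn'.
rewrite -(cardsUI (Ep e1 W U)) (_ : _ :&: _ = set0) ?cards0 ?addn0.
  apply: subset_leq_card; apply/subsetP=> -[c d]; rewrite !inE.
  case/orP=> [/and4P[/= -> -> cd ->]|]; first by rewrite s12.
  by case/orP=> /eqP[-> ->] /=; rewrite aW bW ?ab2 1?s2 ?ab2 // orbC.
apply/setP=> -[c d]; rewrite !inE /=; apply/negP=> /andP[/and4P[_ _ cd _]].
by case/orP=> /eqP[E1 E2]; move: cd; rewrite E1 E2 ?[e1 b a]s1 (negPf ab1).
Qed.

End Massed.

(** * Contractions and reductions in a minimal counterexample *)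

Section Minimal.
Variables (T : finType).
Implicit Types (e : rel T) (A B U V W X Y Z S K H : {set T}).

Lemma setD_split X W U : X \subset W -> U \subset W :\: X ->
  W :\: U = X :|: (W :\: X) :\: U.
Proof.
move=> /subsetP XW /subsetP UY; apply/setP=> w; have := XW w; have := UY w.
rewrite in_setU !in_setD.
by case: (w \in U) => [/(_ isT)/andP[/negPf->]//|_]; case: (w \in X) => //= ->.
Qed.

(** Contraction onto [v]: the relation only gives [v] the neighbours of [u], and [u] disappears by
    passing to [W :\ u]. *)
Definition contract e u v : rel T :=
  [rel a b | (a != b) && [|| e a b, (a == v) && e u b | (b == v) && e u a]].

Lemma contract_sym e u v : symmetric e -> symmetric (contract e u v).
Proof. by move=> se a b; rewrite /contract /= se eq_sym [X in _ || X]orbC. Qed.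

Lemma contract_irr e u v : irreflexive (contract e u v).
Proof. by move=> a; rewrite /contract /= eqxx. Qed.

Lemma contract_neq e u v a b : a != v -> b != v -> irreflexive e -> contract e u v a b = e a b.
Proof.
move=> /negPf av /negPf bv ie; rewrite /contract /= av bv /= !orbF.
by case: eqP => // ->; rewrite ie.
Qed.

Lemma contractW e u v a b : irreflexive e -> e a b -> contract e u v a b.
Proof.
by move=> ie ab; rewrite /contract /= ab andbT; apply: contraTneq ab => ->; rewrite ie.
Qed.

Lemma contract_model e W u v : symmetric e -> u \in W -> v \in W -> e u v ->
  model (W :\ u) (contract e u v) e W (fun a => if a == v then [set u; v] else [set a]).
Proof.
move=> se uW vW uv; split=> [a|a b|a b].
- rewrite !inE => /andP[au aW]; case: eqP => [E|_]; last by split; [apply: conn1|rewrite sub1set].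
  split; last by rewrite subUset !sub1set uW.
  by apply: conn_star => // y /set1P->.
- rewrite !inE => /andP[au aW] /andP[bu bW] ab.
  case: eqP => [av|_]; case: eqP => [bv|_].
  + by rewrite av bv eqxx in ab.
  + by rewrite disjoint_sym disjoints1 !inE negb_or bu -av eq_sym.
  + by rewrite disjoints1 !inE negb_or au -bv.
  by rewrite disjoints1 inE.
move=> aW bW /andP[ab /or3P[eab|/andP[/eqP av ub]|/andP[/eqP bv ua]]].
- exists a, b; split=> //; first by case: eqP => [->|]; rewrite !inE eqxx ?orbT.
  by case: eqP => [->|]; rewrite !inE eqxx ?orbT.
- exists u, b; rewrite av eqxx -av eq_sym (negPf ab); split=> //; first by rewrite !inE eqxx.
  by rewrite inE.
exists a, u; rewrite bv eqxx -bv (negPf ab); split; first by rewrite inE.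
  by rewrite !inE eqxx.
by rewrite se.
Qed.

(** The contraction loses the edge from [u] to [v], one of two parallel edges per common neighbour,
    and the edges from [u] into [X] when [v] is a root, since these end up inside [X]. The factor 2
    reflects ordered pairs. *)
Lemma cnt_contract e W X u v : symmetric e -> irreflexive e -> X \subset W ->
  u \in W :\: X -> v \in W -> e u v ->
  cnt e W (W :\: X) <= cnt (contract e u v) (W :\ u) ((W :\: X) :\ u) +
    2 * #|[set w in nb e W u | [|| w == v, e v w | (v \in X) && (w \in X)]]|.
Proof.
move=> se ie XW uY vW uv; set Y := W :\: X; set near := [set w in _ | _].
have uW : u \in W by move: uY; rewrite inE => /andP[].
have uX : u \notin X by move: uY; rewrite inE => /andP[].
have vu : v != u by apply: contraTneq uv => ->; rewrite ie.
have su : [set u] \subset Y by rewrite sub1set.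
rewrite (cntD e W su) [cnt e W [set u]]cnt_sum ?sub1set // big_set1.
have le1 : #|nb e W u :\: [set u]| <= #|nb e W u| by apply: subset_leq_card; apply: subsetDl.
set far := nb e W u :\: near.
have cfar : #|nb e W u| = #|near| + #|far|.
  have sn : near \subset nb e W u by apply/subsetP=> w; rewrite inE => /andP[].
  by rewrite cardsDS // subnKC // subset_leq_card.
have farP w : w \in far -> [/\ w \in W, e u w, w != v, ~~ e v w & (v \notin X) || (w \notin X)].
  by rewrite !inE => /andP[H /andP[wW uw]]; move: H; rewrite wW uw /= !negb_or negb_and => /and3P[].
suff : cnt e (W :\ u) (Y :\ u) + (#|far| + #|far|) <= cnt (contract e u v) (W :\ u) (Y :\ u).
  by move: le1 cfar; clear; lia.
have i1 : injective (fun w : T => (v, w)) by move=> a b [].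
have i2 : injective (fun w : T => (w, v)) by move=> a b [].
rewrite -{1}(card_imset far i1) -(card_imset far i2).
set F1 := _ @: far; set F2 := _ @: far.
have d12 : F1 :&: F2 = set0.
  apply/setP=> -[a b]; rewrite !inE; apply/negP=> /andP[/imsetP[w wf [-> ->]] /imsetP[w' wf' [_ E]]].
  by have [_ _] := farP _ wf; rewrite E eqxx.
have d0 : Ep e (W :\ u) (Y :\ u) :&: (F1 :|: F2) = set0.
  apply/setP=> -[a b]; rewrite in_set0; apply/negP=> /setIP[]; rewrite in_setU.
  rewrite inE /= => /and4P[_ _ ab _] /orP[] /imsetP[w /farP[_ _ _ nvw _] [E1 E2]].
    by rewrite E1 E2 (negPf nvw) in ab.
  by rewrite E1 E2 se (negPf nvw) in ab.
have -> : #|F1| + #|F2| = #|F1 :|: F2| by rewrite -cardsUI d12 cards0 addn0.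
rewrite -cardsUI d0 cards0 addn0; apply: subset_leq_card; apply/subsetP=> -[a b].
rewrite in_setU in_setU => /or3P[||].
- by rewrite !inE /= => /and4P[-> -> ab ->]; rewrite contractW.
- case/imsetP=> w /farP[wW uw wv _ vwX] [-> ->].
  have wu : w != u by apply: contraTneq uw => ->; rewrite ie.
  by rewrite !inE /contract /= vu vW wW wu eqxx uw eq_sym wv orbT /= !andbT.
case/imsetP=> w /farP[wW uw wv _ vwX] [-> ->].
have wu : w != u by apply: contraTneq uw => ->; rewrite ie.
by rewrite !inE /contract /= vu vW wW wu eqxx uw wv !orbT /= !andbT orbC.
Qed.

(** Each vertex of [U] adjacent to both ends loses one edge, and none gains any because [v] takes
    over what [u] had. *)
Lemma cnt_contract_sub e W U u v : symmetric e -> irreflexive e -> U \subset W :\ u ->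
  u \in W -> v \in W -> v != u -> v \notin U ->
  cnt (contract e u v) (W :\ u) U + 2 * #|[set w in U | e u w && e v w]| <= cnt e W U.
Proof.
move=> se ie UW uW vW vu vU.
have uU : u \notin U by apply/negP=> /(subsetP UW); rewrite !inE eqxx.
have UW' : U \subset W by apply: subset_trans UW (subsetDl _ _).
rewrite (cnt_sum (contract_sym u v se) UW) (cnt_sum se UW').
have -> : #|[set w in U | e u w && e v w]| = \sum_(a in U) (e u a && e v a).
  by rewrite -sum1dep_card big_mkcondr; apply: eq_bigr => a _; case: (e u a && _).
rewrite big_distrr -big_split /=; apply: leq_sum => a aU.
have key S : u \notin S -> v \notin S ->
  #|nb (contract e u v) (W :\ u) a :\: S| + (e u a && e v a) <= #|nb e W a :\: S|.
  move=> uS vS; have av : a != v by apply: contraNneq vU => <-.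
  have au : a != u by apply: contraNneq uU => <-.
  have subN : nb (contract e u v) (W :\ u) a :\: S \subset
     (if e u a then v |: (nb e W a :\: S) :\ u else nb e W a :\: S).
    apply/subsetP=> b; rewrite !inE /contract /= (negPf av) => /and4P[bS /andP[bu bW] ab].
    case/orP=> [eab|/andP[/eqP bv ua]]; case: ifP => ea; rewrite !inE ?bS ?bu ?bW ?eab ?orbT //.
      by rewrite bv eqxx.
    by rewrite ua in ea.
  have := subset_leq_card subN.
  case: ifP => ua /=; last by rewrite addn0.
  have uN : u \in nb e W a :\: S by rewrite !inE uS uW se ua.
  have := cardsD1 u (nb e W a :\: S); rewrite uN cardsU1.
  have -> : v \notin (nb e W a :\: S) :\ u = ~~ e v a.
    by rewrite !inE vS vW vu /= se.
  by case: (e v a); clear; lia.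
have := key U uU vU; have := key set0; rewrite !inE !setD0 => /(_ isT isT).
by clear; lia.
Qed.

Variable N : nat.
Hypothesis IH : forall e W X, #|W| < N -> symmetric e -> irreflexive e ->
  massed e W X -> linked e W X \/ exceptional e W X.

(* A violation of the sparsity condition with a smallest boundary is itself
   massed, hence linked by minimality. *)
Lemma violation e W X : #|W| < N -> symmetric e -> irreflexive e -> X \subset W -> #|X| <= 5 ->
  10 * #|W :\: X| < cnt e W (W :\: X) ->
  massed e W X \/
  exists U, [/\ U \subset W :\: X, #|NU e W U| < #|X|, 10 * #|U| < cnt e W U &
                linked e (U :|: NU e W U) (NU e W U)].
Proof.
move=> WN se ie XW X5 m1.
pose bad U := [&& U \subset W :\: X, #|NU e W U| < #|X| & 10 * #|U| < cnt e W U].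
have [/existsP[U0 bU0]|nobad] := boolP [exists U, bad U]; last first.
  left; split=> // U UY NUX; rewrite leqNgt; apply: contra nobad => cU.
  by apply/existsP; exists U; rewrite /bad UY NUX cU.
right; have [U /and3P[UY NUX cU] minU] := @arg_minnP _ U0 bad (fun U => #|NU e W U|) bU0.
have UW : U \subset W by apply: subset_trans UY (subsetDl _ _).
exists U; split=> //.
have N5 : #|NU e W U| < 5 by apply: leq_trans NUX X5.
have [||||//|[E]] := @IH e (U :|: NU e W U) (NU e W U); last by rewrite E in N5.
- apply: leq_ltn_trans WN; apply: subset_leq_card.
  by rewrite subUset UW (subset_trans (NU_sub _ _ _)) // subsetDl.
- exact: se.
- exact: ie.
apply: massed_piece => //; first by apply: ltnW.
move=> U' sU lt; rewrite leqNgt; apply/negP=> cU'.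
have := minU U'; rewrite /bad (subset_trans sU UY) cU' (ltn_trans lt NUX) leqNgt lt.
by move/(_ isT).
Qed.

Lemma linked_small e V X : #|X| <= 1 -> X \subset V -> linked e V X.
Proof.
move=> X1 /subsetP XV n r n5 ri rX; have n1 := leq_trans (inj_card ri rX) X1.
have ij (i j : 'I_n) : i = j.
  by apply: val_inj => /=; move: (ltn_ord i) (ltn_ord j) n1; clear; lia.
exists (fun i => [set r i]); last by move=> i; rewrite inE.
split=> [i _|i j _ _|i j _ _]; first by split; [apply: conn1|rewrite sub1set XV].
  by rewrite (ij i j) eqxx.
by rewrite /pattern (leq_trans n1) // (ij i j) eqxx.
Qed.

Section Counterexample.
Variables (e : rel T) (W X : {set T}).
Hypotheses (WN : #|W| = N) (se : symmetric e) (ie : irreflexive e).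
Hypotheses (mass : massed e W X) (nl : ~ linked e W X) (nex : ~ exceptional e W X).

Let XW : X \subset W. Proof. by case: mass. Qed.
Let X5 : #|X| <= 5. Proof. by case: mass. Qed.
Let m1 : 10 * #|W :\: X| < cnt e W (W :\: X). Proof. by case: mass. Qed.
Let m2 U : U \subset W :\: X -> #|NU e W U| < #|X| -> cnt e W U <= 10 * #|U|.
Proof. by case: mass => _ _ _; apply. Qed.

(* Replacing the piece behind [Z] by a clique on [Z] gives a smaller graph; if that
   graph has a dense piece behind a small boundary, then the piece together with
   the deleted part is again rigid, with [A] smaller. *)
Lemma no_rigid A Z : ~ rigid e W X A Z.
Proof.
elim: {A}_.+1 {-2}A (ltnSn #|A|) Z => // n IHA A An Z [XA ApW NZ ZA [ltZ LZ]].
have AW : A \subset W := proper_sub ApW.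
have Z4 : #|Z| <= 4 by move: ltZ X5; clear; lia.
pose e' := add_clique e Z; set D := W :\: A in NZ LZ.
have se' : symmetric e'.
  by move=> a b; rewrite /e' /add_clique /= se eq_sym [(a \in Z) && _]andbC.
have ie' : irreflexive e' by move=> a; rewrite /e' /add_clique /= ie eqxx.
have dDA : [disjoint D & A] by apply/disjointsP=> w; rewrite in_setD => /andP[/negPf->].
have ltA : #|A| < N by rewrite -WN proper_card.
have DY : D \subset W :\: X by apply: setDS.
have WDA : W :\: D = A by rewrite setDDr setDv set0U (setIidPr AW).
have YDA : (W :\: X) :\: D = A :\: X.
  apply/setP=> w; rewrite !in_setD; have := subsetP AW w.
  by case: (w \in A) => /= [->|]; case: (w \in X); case: (w \in W).
have cD : cnt e W D <= 10 * #|D|.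
  by apply: m2 => //; apply: leq_ltn_trans (subset_leq_card NZ) ltZ.
have cY : cnt e W (W :\: X) = cnt e W D + cnt e A (A :\: X).
  by rewrite (cntD e W DY) WDA YDA.
have cardY : #|W :\: X| = #|D| + #|A :\: X|.
  by rewrite -YDA (cardsDS DY) subnKC // subset_leq_card.
have cA : 10 * #|A :\: X| < cnt e A (A :\: X).
  by move: m1 cD; rewrite cY cardY; clear; lia.
have cA' : 10 * #|A :\: X| < cnt e' A (A :\: X).
  apply: leq_trans cA _; apply: cnt_mono => a b aA bA ab _.
  by rewrite aA bA /e' /add_clique /= ab.
case: (violation ltA se' ie' XA X5 cA') => [mass'|[U [UY NUX cU LU]]].
  case: (IH ltA se' ie' mass') => [L'|[X5' c' [y [z fp]]]].
    apply: nl; have [h mh ah] := clique_model se LZ Z4 dDA.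
    apply: (linked_mono (V := A :|: D)); first by rewrite subUset AW subsetDl.
    by apply: linked_comp mh _ L' => // a _; apply: ah.
  (* An edge of the clique not inside [X] would add two ordered pairs to a count already above the
     bound, exceeding the surplus of 2. So the full pair already exists in [e]. *)
  have ee a b : a \in A -> b \in A -> e' a b -> (a \notin X) || (b \notin X) -> e a b.
    move=> aA bA ab abX; apply/negPn/negP=> nab.
    have : cnt e A (A :\: X) + 2 <= cnt e' A (A :\: X).
      apply: (cnt_add2 ie' se se' _ aA bA ab nab); last by rewrite !in_setD aA bA !andbT.
      by move=> c d cd; rewrite /e' /add_clique /= cd.
    by move: c' cA; clear; lia.
  apply: (no_full_pair (y := y) (z := z) se ie mass nl nex X5').
  case: fp => yA zA yz fp; move: (yA) (zA); rewrite !in_setD => /andP[yX yA'] /andP[zX zA'].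
  split; rewrite ?in_setD ?yX ?zX ?(subsetP AW) //.
    by apply: ee => //; rewrite yX.
  move=> x xX; have xA := subsetP XA _ xX; have /andP[xy xz] := fp _ xX.
  by rewrite !ee // ?yX ?zX orbT.
set N' := NU e' A U in NUX LU.
have UA : U \subset A by apply: subset_trans UY (subsetDl _ _).
have N'A : N' \subset A :\: U := NU_sub _ _ _.
(* If [U] misses [Z], the clique does not touch it, and [U] violates the sparsity condition of the
   original graph. *)
have [dUZ|] := boolP [disjoint U & Z].
  have ee a b : a \in U -> e' a b = e a b.
    move=> aU; rewrite /e' /add_clique /=; case aZ: (a \in Z); last by rewrite andbF orbF.
    by have := disjointsE dUZ aU aZ.
  have AU w u : w \in W -> u \in U -> e u w -> w \in A.
    move=> wW uU uw; apply/negPn/negP=> wA; have uA := subsetP UA _ uU.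
    apply: (disjointsE dUZ uU); apply: (subsetP NZ); apply/NUP; exists w.
    by rewrite in_setD uA (subsetP AW) // in_setD wA wW se uw.
  have sN : NU e W U \subset N'.
    apply/subsetP=> w /NUP[u [wW wU uU uw]]; apply/NUP; exists u.
    by rewrite ee // (AU w u).
  have : cnt e W U <= 10 * #|U|.
    apply: m2; first by apply: subset_trans UY (setSD _ AW).
    exact: leq_ltn_trans (subset_leq_card sN) NUX.
  rewrite leqNgt => /negP; apply; apply: leq_trans cU _; apply: cnt_mono => a b aA bA ab.
  by rewrite !(subsetP AW) //= => /orP[aU|bU]; [rewrite -ee|rewrite se -ee // se'].
(* [U] meets the clique on [Z], so [Z] lies in [U] and its boundary; the deleted part can then be
   merged with [U]. *)
move=> nd; have ZUN : Z \subset U :|: N'.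
  case/pred0Pn: nd => z /= /andP[zU zZ].
  apply/subsetP=> w wZ; rewrite in_setU; case wU: (w \in U) => //=.
  apply/NUP; exists z; rewrite (subsetP ZA) // wU zU /e' /add_clique /=; split=> //.
  apply/orP; right; rewrite wZ; apply/and3P; split=> //.
  by apply: contraFneq wU => <-.
have WAU : W :\: (A :\: U) = U :|: D.
  by rewrite setDDr (setIidPr (subset_trans UA AW)) setUC.
have U0 : U != set0.
  by apply/negP=> /eqP E; move: cU; rewrite E cnt0.
have ltn : #|A :\: U| < n.
  rewrite cardsDS //; have := subset_leq_card UA; move: U0 An; rewrite -card_gt0; clear; lia.
apply: (IHA _ ltn N'); split=> //.
- apply/subsetP=> x xX; rewrite in_setD (subsetP XA) // andbT.
  by apply/negP=> /(subsetP UY); rewrite in_setD xX.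
- by apply: sub_proper_trans ApW; apply: subsetDl.
- rewrite WAU; apply/subsetP=> w /NUP[u [wW]]; rewrite in_setU negb_or => /andP[wU wD].
  have wA : w \in A by move: wD; rewrite in_setD wW andbT negbK.
  case/setUP=> [uU|uD] uw.
    by apply/NUP; exists u; rewrite wA wU uU /e' /add_clique /= uw.
  have : w \in Z by apply: (subsetP NZ); apply/NUP; exists u.
  by move/(subsetP ZUN); rewrite in_setU (negPf wU).
split=> //; rewrite WAU.
have dD : [disjoint D & U :|: N'].
  by apply: disjointWr dDA; rewrite subUset UA (subset_trans N'A) // subsetDl.
have [h mh ah] := clique_model se LZ Z4 dD.
rewrite (_ : U :|: D :|: N' = U :|: N' :|: D); last by rewrite setUAC.
by apply: linked_comp mh _ LU => // a _; apply: ah.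
Qed.

Lemma linked_core U : U \subset W :\: X -> U != set0 ->
  (forall n (r : 'I_n -> T), n <= 5 -> injective r -> (forall i, r i \in NU e W U) ->
     (n = 5 -> forall x, x \in X -> x \in NU e W U -> exists i, r i = x) ->
     rminor e (U :|: NU e W U) r) -> False.
Proof.
by move=> UY U0 H; apply: nl; apply: link_core UY U0 _ H => // A Z; apply: no_rigid.
Qed.

(** With its boundary as roots the piece is massed and smaller than [W]. If it were linked,
    [linked_core] would link [X] through it. *)
Lemma no_dense_piece U : U \subset W :\: X -> #|NU e W U| <= #|X| -> 10 * #|U| < cnt e W U ->
  U :|: NU e W U != W -> exceptional e (U :|: NU e W U) (NU e W U).
Proof.
move=> UY NX cU neq.
have UW : U \subset W by apply: subset_trans UY (subsetDl _ _).
have sub : U :|: NU e W U \subset W.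
  by rewrite subUset UW (subset_trans (NU_sub _ _ _)) // subsetDl.
have U0 : U != set0.
  by apply/negP=> /eqP E; move: cU; rewrite E cnt0.
have [||L|//] := @IH e (U :|: NU e W U) (NU e W U) _ se ie.
- by rewrite -WN proper_card // properEneq neq.
- apply: massed_piece => //; first exact: leq_trans NX X5.
  move=> U' sU lt; apply: m2; first exact: subset_trans sU UY.
  exact: leq_trans lt NX.
by case: (linked_core UY U0) => n r n5 ri rN _; apply: L.
Qed.

(* Such a [U] has a boundary of exactly [|X|] vertices including [u] and [v], so it
   is exceptional, and its full pair consists of common neighbours of [u] and [v]. *)
Lemma boundary_edge u v U : u \in W :\: X -> v \in W -> v != u ->
  U \subset (W :\: X) :\ u -> v \notin U ->
  #|NU (contract e u v) (W :\ u) U| < #|X| -> 10 * #|U| < cnt e W U ->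
  2 <= #|[set w in U | e u w && e v w]| /\ cnt e W U <= 10 * #|U| + 2.
Proof.
move=> uY vW vu UYu vU ltN cU; set N2 := NU _ _ U in ltN.
have UY : U \subset W :\: X by apply: subset_trans UYu (subsetDl _ _).
have UW : U \subset W by apply: subset_trans UY (subsetDl _ _).
have uU : u \notin U by apply/negP=> /(subsetP UYu); rewrite !inE eqxx.
have [uW uX] : u \in W /\ u \notin X by move: uY; rewrite inE => /andP[].
have sN : NU e W U :\ u \subset N2.
  apply/subsetP=> w; rewrite in_setD1 => /andP[wu /NUP[a [wW wU aU aw]]].
  by apply/NUP; exists a; rewrite in_setD1 wu contractW.
have NX : #|X| <= #|NU e W U| by rewrite leqNgt; apply/negP=> /(m2 UY); rewrite leqNgt cU.
have uN : u \in NU e W U.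
  apply/negPn/negP=> uN; have : #|NU e W U| <= #|N2|.
    by apply: subset_leq_card; apply: subset_trans sN; rewrite subsetD1 subxx.
  by move: NX ltN; clear; lia.
have cN : #|NU e W U| = #|NU e W U :\ u|.+1 by rewrite (cardsD1 u) uN.
have leN := subset_leq_card sN.
have vN : v \in NU e W U.
  apply/negPn/negP=> vN; have vN2 : v \in N2.
    have [a [_ _ aU au]] := NUP _ _ _ _ uN.
    apply/NUP; exists a; rewrite in_setD1 vu; split=> //.
    rewrite /contract /= eqxx [e u a]se au !orbT andbT; apply: contraNneq vU => <- //.
  have : #|NU e W U :\ u| <= #|N2 :\ v|.
    apply: subset_leq_card; apply/subsetP=> w wN; rewrite in_setD1 (subsetP sN) // andbT.
    by apply: contraNneq vN => <-; move: wN; rewrite in_setD1 => /andP[].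
  by have := cardsD1 v N2; rewrite vN2; move: cN NX ltN; clear; lia.
have eqN : #|NU e W U| = #|X| by move: cN leN NX ltN; clear; lia.
have [||_ c2 [y [z [yU zU yz full]]]] := no_dense_piece UY _ cU.
- by rewrite eqN.
- apply/eqP=> E; have XN : X \subset NU e W U.
    apply/subsetP=> x xX; have : x \in U :|: NU e W U by rewrite E (subsetP XW).
    by case/setUP=> // /(subsetP UY); rewrite in_setD xX.
  have XE : X = NU e W U by apply/eqP; rewrite eqEcard XN eqN leqnn.
  by rewrite XE uN in uX.
have UE : (U :|: NU e W U) :\: NU e W U = U.
  apply/setP=> w; rewrite in_setD in_setU; case wU: (w \in U); rewrite ?andbT /=.
    by apply/NUP=> -[a []]; rewrite wU.
  by case: (w \in NU e W U).
rewrite UE in c2 yU zU; rewrite cnt_closed // in c2; split=> //.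
have yzn : y != z by apply: contraTneq yz => ->; rewrite ie.
rewrite -[2]/(true.+1) -yzn -cards2; apply: subset_leq_card.
have [/andP[uy uz] /andP[vy vz]] := (full _ uN, full _ vN).
by apply/subsetP=> w; rewrite !inE => /orP[]/eqP->; rewrite ?yU ?zU ?uy ?uz ?vy ?vz.
Qed.

(* If the contraction is exceptional, then in the original graph the rest beyond
   the full pair and [u] is sparse, so those three vertices alone satisfy the
   hypothesis of [three_linked]. *)
Lemma contract_sparse u v : u \in W :\: X -> v \in W -> e u v ->
  cnt (contract e u v) (W :\ u) ((W :\: X) :\ u) <= 10 * #|(W :\: X) :\ u|.
Proof.
move=> uY vW uv; rewrite leqNgt; apply/negP=> c1.
have [uW uX] : u \in W /\ u \notin X by move: uY; rewrite inE => /andP[].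
have vu : v != u by apply: contraTneq uv => ->; rewrite ie.
set e' := contract e u v in c1; set W' := W :\ u in c1.
have WE : (W :\: X) :\ u = W' :\: X by rewrite /W' !setDDl setUC.
rewrite WE in c1.
have se' : symmetric e' := contract_sym u v se.
have ie' : irreflexive e' := contract_irr e u v.
have XW' : X \subset W' by rewrite subsetD1 XW.
have W'W : W' \subset W by apply: subsetDl.
have W'N : #|W'| < N by rewrite -WN /W' [#|W|](cardsD1 u) uW.
have lift Y : linked e' W' Y -> linked e W Y.
  apply: linked_comp (contract_model se uW vW uv) _ => // a _.
  by case: eqP => [->|]; rewrite !inE eqxx ?orbT.
have nl' : ~ linked e' W' X by move=> /lift.
case: (violation W'N se' ie' XW' X5 c1) => [mass'|[U [UY NUX cU LU]]]; last first.
  have [vU|vU] := boolP (v \in U); last first.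
    have ccs := cnt_contract_sub se ie (subset_trans UY (subsetDl _ _)) uW vW vu vU; rewrite -/e' -/W' in ccs.
    have [||le2 leU] := @boundary_edge u v U uY vW vu _ vU NUX _.
    - by rewrite WE.
    - by move: cU ccs; clear; lia.
    (* Two common neighbours cost four ordered pairs, while [U] is above its bound by at most
       two. *)
    by move: le2 leU cU ccs; clear; lia.
  set N2 := NU e' W' U in NUX LU.
  have UW' : U \subset W' by apply: subset_trans UY (subsetDl _ _).
  have UW : u |: U \subset W by rewrite subUset sub1set uW (subset_trans UW').
  have WA : W :\: (W :\: (u |: U)) = u |: U by rewrite setDDr setDv set0U (setIidPr UW).
  have uU : u \notin U by apply/negP=> /(subsetP UW'); rewrite in_setD1 eqxx.
  have N2W := NU_sub e' W' U.
  (* The piece contains [v], so undoing the contraction only adds [u] to it: boundary and linkedness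
     carry over. *)
  apply: (@no_rigid (W :\: (u |: U)) N2); split.
  - apply/subsetP=> x xX; rewrite in_setD (subsetP XW) // andbT in_setU1.
    apply/norP; split; first by apply: contraNneq uX => <-.
    by apply/negP=> /(subsetP UY); rewrite in_setD xX.
  - rewrite properEneq subsetDl andbT; apply/eqP=> E.
    by move: uW; rewrite -{1}E in_setD in_setU1 eqxx.
  - rewrite WA; apply/subsetP=> w /NUP[a [wW]]; rewrite in_setU1 negb_or => /andP[wu wU].
    rewrite in_setU1 => /orP[/eqP-> uw|aU aw]; last first.
      by apply/NUP; exists a; rewrite in_setD1 wu /e' contractW.
    apply/NUP; exists v; rewrite in_setD1 wu; split=> //.
    rewrite /e' /contract /= eqxx uw /= orbT andbT; apply: contraNneq wU => <- //.
  - apply/subsetP=> w /(subsetP N2W); rewrite !in_setD in_setU1 => /and3P[wU wu wW].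
    by rewrite negb_or wU wW !andbT; move: wu; rewrite in_set1.
  split=> //; rewrite WA.
  have mod2 : model (U :|: N2) e' e (u |: U :|: N2) (fun a => if a == v then [set u; v] else [set a]).
    have [cg dg ag] := contract_model se uW vW uv.
    have sub a : a \in U :|: N2 -> a \in W'.
      by case/setUP=> [/(subsetP UW')//|/(subsetP N2W)]; rewrite in_setD => /andP[].
    split=> [a aU|a b aU bU|a b aU bU].
    - split; first by have [] := cg _ (sub _ aU).
      case: eqP => _; last by rewrite sub1set -setUA in_setU1 aU orbT.
      by rewrite subUset !sub1set !inE eqxx vU !orbT.
    - exact: dg (sub _ aU) (sub _ bU).
    exact: ag (sub _ aU) (sub _ bU).
  apply: linked_comp mod2 _ LU => // a _.
  by case: eqP => [->|]; rewrite !inE eqxx ?orbT.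
case: (IH W'N se' ie' mass') => [//|[X5' c2 [y [z fp]]]].
set U0 := W' :\: X :\: [set y; z].
have [yY zY yz full] := fp.
(* If [v] were neither a root nor in the pair, the edges of the full pair would not involve [v] and
   would already be present before the contraction. *)
have vU0 : v \notin U0.
  apply/negP=> vU0; apply: (no_full_pair (y := y) (z := z) se ie mass nl nex X5').
  move: vU0; rewrite in_setD in_set2 negb_or => /andP[/andP[vy vz]].
  rewrite in_setD => /andP[vX _].
  have yv : y != v by rewrite eq_sym.
  have zv : z != v by rewrite eq_sym.
  split; first by apply: subsetP yY; apply: setSD.
  - by apply: subsetP zY; apply: setSD.
  - by rewrite -(contract_neq u yv zv ie).
  move=> x xX; have xv : x != v by apply: contraNneq vX => <-.
  by rewrite -!(contract_neq u xv _ ie) //; apply: full.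
have U0Y : U0 \subset (W :\: X) :\ u by rewrite WE; apply: subsetDl.
have U0W' : U0 \subset W' by apply: subset_trans (subsetDl _ _) (subsetDl _ _).
have U0W : U0 \subset W := subset_trans U0W' W'W.
have comp K : K \subset U0 -> connected_in e K -> [disjoint NU e W K & U0] ->
  connected_in e' K /\ [disjoint NU e' W' K & U0].
  move=> KU [K0 cK] dK; split.
    split=> // a b aK bK; have := cK a b aK bK; apply: connect_sub => c d /and3P[cK' dK' cd].
    by apply: connect1; rewrite /induced_rel /= cK' dK' /e' contractW.
  apply/disjointsP=> w /NUP[a [wW wK aK aw]] wU; apply: (disjointsE dK _ wU).
  apply/NUP; exists a; split=> //; first exact: subsetP W'W _ wW.
  rewrite -(contract_neq u (v := v)) //.
    by apply: contraNneq vU0 => <-; apply: subsetP KU _ aK.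
  by apply: contraNneq vU0 => <-.
have [XW2 _ m1' m2'] := mass'.
have [cf1 cf2] := cnt_full_pair se' ie' XW2 X5' fp; rewrite -/U0 in cf1 cf2.
have sparse K : K \subset U0 -> connected_in e K -> [disjoint NU e W K & U0] ->
    cnt e W K <= 10 * #|K|.
  move=> KU cK dK; have [cK' dK'] := comp _ KU cK dK.
  have [N4 cntK] := full_pair_comps se' ie' mass' X5' fp nl' KU cK' dK'.
  (* Otherwise the contraction pushes [K], hence [U0], two below its bound. Adding 22 for the full
     pair then does not exceed 10 |W' :\: X|, against [m1']. *)
  rewrite leqNgt; apply/negP=> big.
  have vK : v \notin K by apply: contra vU0 => /(subsetP KU).
  have [||le2 leK] := @boundary_edge u v K uY vW vu _ vK _ big.
  - exact: subset_trans KU U0Y.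
  - by rewrite X5' ltnS.
  have := cnt_contract_sub se ie (subset_trans KU U0W') uW vW vu vK; rewrite -/e' -/W'.
  have := cnt_closed_diff se' U0W' KU dK'.
  have : cnt e' W' (U0 :\: K) <= 10 * #|U0 :\: K|.
    apply: cnt_comps => //; first by apply: subset_trans (subsetDl _ _) U0W'.
    move=> K2 KU2 cK2 dK2; have dK2' := closed_diff se' U0W' KU dK' KU2 dK2.
    have KU2' : K2 \subset U0 := subset_trans KU2 (subsetDl _ _).
    by have [] := full_pair_comps se' ie' mass' X5' fp nl' KU2' cK2 dK2'.
  have : #|U0| = #|K| + #|U0 :\: K| by rewrite cardsDS // subnKC // subset_leq_card.
  by move: le2 leK cf1 cf2 m1'; clear; lia.
have cU0 : cnt e W U0 <= 10 * #|U0| by apply: cnt_comps.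
pose Y3 := u |: [set y; z].
have uyz : u \notin [set y; z].
  by apply/negP=> /set2P[E|E]; move: yY zY; rewrite !inE -E eqxx /= ?andbF.
have yzn : y != z by apply: contraTneq yz => ->; rewrite ie'.
have Y3Y : Y3 \subset W :\: X.
  rewrite subUset sub1set uY subUset !sub1set (subsetP _ _ yY) ?(subsetP _ _ zY) //; exact: setSD.
have YU0 : (W :\: X) :\: U0 = Y3.
  apply/setP=> w; have := subsetP Y3Y w; rewrite /U0 /Y3 !inE.
  by case: (w == y); case: (w == z); case: (w == u); case: (w \in X); case: (w \in W) => //= /(_ isT).
have WU0 : W :\: U0 = X :|: Y3.
  rewrite -YU0; apply: setD_split => //; exact: subset_trans U0Y (subsetDl _ _).
apply: nl; apply: (linked_mono (V := X :|: Y3)).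
  by rewrite subUset XW (subset_trans Y3Y) // subsetDl.
have cY3 : #|Y3| = 3 by rewrite /Y3 cardsU1 uyz cards2 yzn.
apply: three_linked => //.
  by apply/disjointsP=> w wX /(subsetP Y3Y); rewrite in_setD wX.
have U0Y' : U0 \subset W :\: X := subset_trans U0Y (subsetDl _ _).
have := cntD e W U0Y'; rewrite YU0 WU0.
have : #|W :\: X| = #|U0| + 3 by rewrite -cY3 -YU0 (cardsDS U0Y') subnKC // subset_leq_card.
by move: m1 cU0; clear; lia.
Qed.

(** The vertices behind [Z] are either sparse or, when |X| = |Z| = 2, form a dense piece, which
    cannot be exceptional with two boundary vertices. In the sparse case [Z] alone carries more than
    10 |Z| ordered pairs; this forces |Z| = 2, |X| = 5 and all eleven edges, a full pair. *)
Lemma few_boundary Z : Z = [set y in W :\: X | nb e W y :&: X != set0] -> 1 < #|X| ->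
  #|Z| <= 2 -> False.
Proof.
move=> EZ X1 Z2; set Y := W :\: X in EZ; set U := Y :\: Z.
have ZY : Z \subset Y by apply/subsetP=> w; rewrite EZ inE => /andP[].
have UY : U \subset Y by apply: subsetDl.
have YU : Y :\: U = Z by rewrite setDDr setDv set0U (setIidPr ZY).
have WU : W :\: U = X :|: Z by rewrite (setD_split XW UY) YU.
have NZ : NU e W U \subset Z.
  apply/subsetP=> w /NUP[u [wW wU uU uw]].
  have : w \in X :|: Z by rewrite -WU in_setD wU.
  case/setUP=> // wX; move: uU; rewrite in_setD => /andP[/negP uZ uY]; case: uZ.
  by rewrite EZ inE uY; apply/set0Pn; exists w; rewrite !inE wW uw.
have dXZ : [disjoint X & Z].
  by apply/disjointsP=> w wX /(subsetP ZY); rewrite in_setD wX.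
have XZZ : (X :|: Z) :\: Z = X.
  by rewrite setDUl setDv setU0; apply/setDidPl.
have cXZ : #|X :|: Z| = #|X| + #|Z|.
  by rewrite cardsU (_ : X :&: Z = set0) ?cards0 ?subn0 //; apply/eqP; rewrite setI_eq0.
have cY : cnt e W Y = cnt e W U + cnt e (X :|: Z) Z.
  by rewrite (cntD e W UY) YU WU.
have mY : #|Y| = #|U| + #|Z| by rewrite -YU (cardsDS UY) subnKC // subset_leq_card.
have ub := cnt_ub se ie (subsetUr X Z); rewrite XZZ cXZ in ub.
have [ltN|geN] := ltnP #|NU e W U| #|X|; last first.
  have Xeq : #|X| = 2 by have := subset_leq_card NZ; move: X1 geN Z2; clear; lia.
  have NX : #|NU e W U| <= #|X|.
    by apply: leq_trans (subset_leq_card NZ) _; rewrite Xeq.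
  have Zeq : #|Z| = 2 by have := subset_leq_card NZ; move: geN Z2; rewrite Xeq; clear; lia.
  have [||] := no_dense_piece UY NX _.
  - by move: m1 ub; rewrite -/Y cY mY Xeq Zeq; clear; lia.
  - apply/eqP=> E; have /set0Pn[x xX] : X != set0 by rewrite -card_gt0; apply: ltnW.
    have := subsetP XW _ xX; rewrite -E => /setUP[/(subsetP UY)|/(subsetP NZ)/(subsetP ZY)];
      by rewrite in_setD xX.
  by move=> N5; move: NX; rewrite N5 Xeq.
have cU := m2 UY ltN.
have big : 10 * #|Z| < cnt e (X :|: Z) Z by move: m1 cU; rewrite -/Y cY mY; clear; lia.
have [Zeq Xeq] : #|Z| = 2 /\ #|X| = 5.
  by move: Z2 X5 ub big X1; clear; case: #|Z| => [|[|[|]]]; lia.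
have /cards2P[y [z [yz EZ2]]] : #|Z| == 2 by rewrite Zeq.
have yZ : y \in Z by rewrite EZ2 !inE eqxx.
have zZ : z \in Z by rewrite EZ2 !inE eqxx orbT.
have := big; rewrite (cnt_sum se (subsetUr _ _)) EZ2 big_setU1 ?inE // big_set1 -EZ2 Zeq.
have part a b : a \in Z -> b \in Z -> a != b -> Z = [set a; b] ->
  #|nb e (X :|: Z) a| = #|nb e (X :|: Z) a :\: Z| + e a b /\ nb e (X :|: Z) a :\: Z \subset X.
  move=> aZ bZ ab E; split; last first.
    by apply/subsetP=> w; rewrite !inE => /andP[/negPf->]; rewrite orbF => /andP[].
  rewrite (cardsD1 b) addnC; congr addn.
    congr #|pred_of_set _|; apply/setP=> w.
    have wZ : (w \in Z) = (w == a) || (w == b) by rewrite {1}E !inE.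
    rewrite !inE wZ; case: (eqVneq w a) => [->|_] /=; first by rewrite ie !andbF.
    by case: (w == b).
  by rewrite !inE bZ orbT.
have [c1 s1] := part y z yZ zZ yz EZ2.
have [c2 s2] := part z y zZ yZ (eq_ind_r (fun b => ~~ b) yz (eq_sym z y)) (etrans EZ2 (setUC _ _)).
rewrite c1 c2 se /= => tot.
have l1 := subset_leq_card s1; have l2 := subset_leq_card s2; rewrite Xeq in l1 l2.
have eyz : e z y by move: tot l1 l2; case: (e z y) => //; clear; lia.
have full a : nb e (X :|: Z) a :\: Z \subset X -> 5 <= #|nb e (X :|: Z) a :\: Z| ->
  forall x, x \in X -> e x a.
  move=> sa ca x xX; have /eqP E : nb e (X :|: Z) a :\: Z == X by rewrite eqEcard sa Xeq.
  by move: xX; rewrite -E !inE se => /and3P[].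
apply: (no_full_pair (y := y) (z := z) se ie mass nl nex Xeq); split.
- exact: subsetP ZY _ yZ.
- exact: subsetP ZY _ zZ.
- by rewrite se.
move=> x xX; rewrite (full y s1) ?(full z s2) //; move: tot l1 l2; rewrite eyz; clear; lia.
Qed.

Lemma no_counterexample : False.
Proof.
have X1 : 1 < #|X| by rewrite ltnNge; apply/negP=> /linked_small-/(_ e W XW).
set Y := W :\: X; pose Z := [set y in Y | nb e W y :&: X != set0].
have Z3 : 2 < #|Z| by rewrite ltnNge; apply/negP; apply: few_boundary.
(* [f] is the number of edges above the bound; halving rounds up, which spares a proof that [cnt] is
   even. *)
have [f [f0 f1 f2]] : exists f, [/\ 0 < f, cnt e W Y <= 10 * #|Y| + 2 * f &
    10 * #|Y| + 2 * f <= (cnt e W Y).+1].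
  exists ((cnt e W Y).+1 - 10 * #|Y|)./2; move: m1; rewrite -/Y.
  move: (cnt e W Y) #|Y| => c m; have := odd_double_half (c.+1 - 10 * m).
  by rewrite -muln2; move: (_./2) => h; clear; case: (odd _) => /= H1 H2; split; lia.
(* The contracted graph has at most 10 (|Y| - 1) pairs, so at least 9 + 2f of them were lost; twice
   the number of these neighbours accounts for the loss. *)
have near u v : u \in Y -> v \in W -> e u v ->
  5 + f <= #|[set w in nb e W u | [|| w == v, e v w | (v \in X) && (w \in X)]]|.
  move=> uY vW uv; have := cnt_contract se ie XW uY vW uv.
  have := contract_sparse uY vW uv; have := cardsD1 u Y; rewrite -/Y uY.
  by move: f2; clear; lia.
have deg u : u \in Y -> 5 + f <= #|nb e W u|.
  move=> uY; have /set0Pn[v] : nb e W u != set0.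
    apply/negP=> /eqP E0; have uW : u \in W by move: uY; rewrite inE => /andP[].
    have Wu : W :\: (W :\ u) = [set u] by rewrite setDDr setDv set0U; apply/setIidPr; rewrite sub1set.
    (* A vertex without neighbours would be a rigid piece behind the empty separator. *)
    apply: (@no_rigid (W :\ u) set0); split; rewrite ?sub0set ?Wu //.
    - by rewrite subsetD1 XW; move: uY; rewrite inE => /andP[].
    - by rewrite properD1.
    - by apply/subsetP=> w /NUP[a [wW _ /set1P-> uw]]; rewrite -E0 inE wW.
    by split; [rewrite cards0; apply: ltnW|apply: linked_small; rewrite ?cards0 ?sub0set].
  rewrite inE => /andP[vW uv]; apply: leq_trans (near u v uY vW uv) _.
  by apply: subset_leq_card; apply/subsetP=> w; rewrite inE => /andP[].
have [v0 [v0Y dX d0]] : exists v, [/\ v \in Y, #|nb e W v| + #|X :&: nb e W v| <= 9 + f &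
     #|X :&: nb e W v| = 0 -> #|nb e W v| <= 8 + f].
  have [/existsP[v /andP[vY H]]|none] := boolP [exists v, (v \in Y) &&
     (#|nb e W v| + #|X :&: nb e W v| < 9 + f + (nb e W v :&: X != set0))].
    exists v; split=> //; first by move: H; case: (_ != _); clear; lia.
    move=> E; move: H; rewrite E setIC -cards_eq0 E /=; clear; lia.
  have lowb : \sum_(v in Y) (9 + f + (nb e W v :&: X != set0)) <= cnt e W Y.
    rewrite cnt_sum ?subsetDl //; apply: leq_sum => v vY.
    have -> : nb e W v :\: Y = X :&: nb e W v.
      by apply/setP=> w; rewrite !inE; case: (w \in X); case: (w \in W).
    move: none; rewrite negb_exists => /forallP/(_ v); by rewrite vY /= -leqNgt.
  have : \sum_(v in Y) (9 + f + (nb e W v :&: X != set0)) = (9 + f) * #|Y| + #|Z|.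
    rewrite big_split /= sum_nat_const mulnC; congr addn.
    by rewrite /Z -sum1dep_card big_mkcondr; apply: eq_bigr => v _; case: (_ != _).
  move=> E; rewrite E in lowb.
  have [u uZ] : exists u, u \in Z by apply/set0Pn; rewrite -card_gt0; apply: leq_trans Z3.
  have uY : u \in Y by move: uZ; rewrite inE => /andP[].
  have dW : #|nb e W u| <= #|Y| + 4.
    have uW : u \in W by move: uY; rewrite inE => /andP[].
    have : #|nb e W u| <= #|W :\ u|.
      apply: subset_leq_card; apply/subsetP=> w; rewrite !inE => /andP[-> uw]; rewrite andbT.
      by apply: contraTneq uw => ->; rewrite ie.
    have := cardsD1 u W; rewrite uW; have := cardsDS XW; rewrite -/Y.
    by have := subset_leq_card XW; move: X5; clear; lia.
  (* This gives |Y| >= f + 1. The averaged bound reads (f - 1) |Y| + |Z| <= 2f, which then fails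
     because |Z| >= 3. *)
  have := leq_trans (deg u uY) dW.
  by move: f0 f1 Z3 lowb; clear; nia.
have v0X : v0 \notin X by move: v0Y; rewrite inE => /andP[].
have v0W : v0 \in W by move: v0Y; rewrite inE => /andP[].
have NE : NU e W [set v0] = nb e W v0.
  apply/setP=> w; apply/NUP/idP => [[u [wW _ /set1P-> uw]]|]; first by rewrite inE wW.
  move=> wN; have /andP[wW uw] : (w \in W) && e v0 w by move: wN; rewrite inE.
  exists v0; rewrite !inE eqxx; split=> //.
  by apply: contraTneq uw => ->; rewrite ie.
apply: (@linked_core [set v0]); first by rewrite sub1set.
  by apply/set0Pn; exists v0; rewrite inE.
rewrite NE => n r n5 ri rN onto.
have dv := deg _ v0Y.
(* [near] leaves each vertex of the neighbourhood at most |N(v0)| - 5 - f uncounted neighbours of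
   [v0], and this is [t]. *)
apply: (@dense_linked _ e se X (nb e W v0) v0 (#|nb e W v0| - 5 - f)) => //.
- by rewrite inE v0W ie.
- by move=> x; rewrite inE => /andP[].
- by move: dv f0; clear; lia.
- by move: dX dv; clear; lia.
- by move: dX d0 dv; clear; case: #|X :&: _| => [|d]; lia.
move=> x; rewrite inE => /andP[xW vx]; have := near _ _ v0Y xW vx.
set A1 := [set w in _ | _]; set A2 := [set w in _ | _].
have -> : A2 = nb e W v0 :\: A1.
  by apply/setP=> w; rewrite !inE; case: (w \in W); case: (e v0 w); rewrite //= !negb_or ?andbT.
have sA : A1 \subset nb e W v0 by apply/subsetP=> w; rewrite inE => /andP[].
by rewrite cardsDS //; clear; lia.
Qed.

End Counterexample.
End Minimal.

Theorem massed_linked (T : finType) (e : rel T) (W X : {set T}) : symmetric e ->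
  irreflexive e -> massed e W X -> linked e W X \/ exceptional e W X.
Proof.
elim: {W}_.+1 {-2}W (ltnSn #|W|) e X => // n IHn W Wn e X se ie mass.
case: (classic (linked e W X)) => [|nl]; first by left.
case: (classic (exceptional e W X)) => [|nex]; first by right.
have IH (e' : rel T) (W' X' : {set T}) : #|W'| < #|W| -> symmetric e' -> irreflexive e' ->
    massed e' W' X' -> linked e' W' X' \/ exceptional e' W' X'.
  by move=> lt; apply: IHn; apply: leq_trans lt Wn.
by case: (no_counterexample IH (erefl _) se ie mass nl nex).
Qed.

(** * From 10-connectivity to the edge bound *)

Lemma k_connected_NU (T : finType) (e : rel T) k (U : {set T}) : symmetric e -> k_connected e k ->
  #|NU e setT U| < k -> U != set0 -> U :|: NU e setT U = setT.
Proof.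
move=> se [_ kc] Nk /set0Pn[u uU]; apply/setP=> w; rewrite in_setT in_setU.
case wN: (w \in NU e setT U); first by rewrite orbT.
rewrite orbF; have [_ cc] := kc _ Nk.
have uN : u \in ~: NU e setT U by rewrite inE; apply/NUP=> -[a []]; rewrite uU.
have := cc u w uN; rewrite inE wN => /(_ isT) conn.
apply: (connect_preserve (Q := fun a => a \in U) _ conn uU) => a b /and3P[aN bN ab] aU.
apply: contraLR bN => bU; rewrite inE negbK; apply/NUP; exists a.
by rewrite in_setT.
Qed.

Theorem theorem1 (T : finType) (e : rel T)
  (e_sym : symmetric e) (e_irr : irreflexive e) :
  k_connected e 10 -> Ck_minor_linked e 5.
Proof.
move=> kc X X5; have [T10 _] := kc.
have deg v : 10 <= #|nb e setT v|.
  rewrite leqNgt; apply/negP=> lt.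
  have NE : NU e setT [set v] = nb e setT v.
    apply/setP=> w; apply/NUP/idP => [[u [wW _ /set1P-> uw]]|wN]; first by rewrite inE wW.
    have vw : e v w by move: wN; rewrite inE => /andP[].
    exists v; rewrite !inE; split=> //; apply: contraTneq vw => ->; by rewrite e_irr.
  have := k_connected_NU e_sym kc (U := [set v]).
  rewrite NE => /(_ lt) H.
  have : #|T| <= 10.
    rewrite -cardsT -H; last by apply/set0Pn; exists v; rewrite inE.
    by apply: leq_trans (leq_card_setU _ _) _; rewrite cards1.
  by move: T10; clear; lia.
set Y := ~: X.
have YE : setT :\: X = Y by rewrite setTD.
have tot : 10 * #|Y| + \sum_(y in Y) #|nb e setT y :&: X| <= cnt e setT Y.
  rewrite cnt_sum ?subsetT // mulnC -sum_nat_const -big_split; apply: leq_sum => y yY /=.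
  apply: leq_add (deg y) _; apply: subset_leq_card; apply/subsetP=> w.
  by rewrite !inE negbK andbC.
have mass : massed e setT X.
  split; rewrite ?YE ?subsetT ?X5 //.
    (* Strictness needs one edge between [X] and [Y]: a root has ten neighbours, at most five of
       them in [X]. *)
    apply: leq_trans tot; rewrite -addn1 leq_add2l.
    have /set0Pn[x xX] : X != set0 by rewrite -card_gt0 X5.
    have /set0Pn[y] : nb e setT x :\: X != set0.
      rewrite -card_gt0 cardsD.
      have : #|nb e setT x :&: X| <= 5 by rewrite -X5 subset_leq_card // subsetIr.
      by have := deg x; clear; lia.
    rewrite !inE => /andP[yX xy]; rewrite (bigD1 y) ?inE //=.
    apply: leq_trans (leq_addr _ _); rewrite card_gt0; apply/set0Pn; exists x.
    by rewrite !inE xX e_sym xy.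
  move=> U UY N5; case: (eqVneq U set0) => [->|U0]; first by rewrite cnt0.
  have N10 : #|NU e setT U| < 10 by apply: leq_trans N5 _.
  (* A boundary below 10 cannot separate, so all of [X] lies in the boundary of [U], which would
     have at least five vertices. *)
  have E := k_connected_NU e_sym kc N10 U0.
  have XN : X \subset NU e setT U.
    apply/subsetP=> x xX; have : x \in U :|: NU e setT U by rewrite E.
    by case/setUP=> // /(subsetP UY); rewrite inE xX.
  by have := subset_leq_card XN; rewrite X5 leqNgt N5.
rewrite /cycle_linked X5 /=.
case: (massed_linked e_sym e_irr mass) => [L x xi xX|[_ c [y [z [yY zY yz full]]]]]; last first.
  (* Each vertex of the full pair contributes its five edges to [X], so the surplus is at least 10,
     more than the 2 allowed. *)
  exfalso; move: c tot; rewrite YE in yY zY *.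
  rewrite (bigD1 y) //= (bigD1 z) /=; last by rewrite zY; apply: contraTneq yz => ->; rewrite e_irr.
  have nX a : (forall x, x \in X -> e x a) -> nb e setT a :&: X = X.
    move=> H; apply/setIidPr/subsetP=> x xX; rewrite !inE e_sym; exact: H.
  rewrite !nX ?X5; try by move=> x xX; have /andP[] := full x xX.
  by clear; lia.
have rX i : x i \in X.
  have XE : X = [set x j | j in setT].
    apply/eqP; rewrite eqEcard card_imset // cardsT card_ord X5 andbT.
    by apply/subsetP=> v /xX[j <-]; apply: imset_f.
  by rewrite XE; apply: imset_f.
have [g [cg dg ag] xg] := L 5 x (leqnn 5) xi rX.
exists g; split=> [i j ij|]; first by apply: dg.
split=> [i|]; first by have [] := cg i (in_setT _).
by split=> // i; apply: ag; rewrite ?inE // /pattern /=.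
Qed.
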